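(* Let $v$ be a positive integer, let $N>0$ be a real number, and let $\sigma_0<v$. For every complex $s=\sigma+i\tau$ with $\sigma\le\sigma_0$, $s\neq 1$ and $s\notin\{1,\dots,v-1\}$, one has $$\zeta(s)=D(s)+E_{1}(s)+E_{-1}(s)-\frac{\Gamma(1-s+v)}{(1-s)\Gamma(v)}N^{1-s},$$ where $$D(s)=\sum_{n=1}^{\infty}n^{-s}Q\!\left(v,\tfrac{n}{N}\right),\qquad E_{\mu}(s)=(2\pi)^{s-1}\Gamma(1-s)\,e^{i\mu\frac{\pi}{2}(1-s)}\sum_{m=1}^{\infty}E_{\mu}(m,s)\quad(\mu=\pm1),$$ $$E_{\mu}(m,s)=m^{s-1}-\sum_{w=0}^{v-1}\binom{s-1}{w}\left(m+\frac{i\mu}{2\pi N}\right)^{s-1-w}\left(\frac{-i\mu}{2\pi N}\right)^{w}.$$ The three series $D(s)$, $\sum_m E_1(m,s)$ and $\sum_m E_{-1}(m,s)$ converge absolutely (and uniformly on compact subsets of the region $\sigma\le\sigma_0$). For a positive integer $s=k$ with $k<v$, the quantity $E_\mu(k)$ is to be understood as the limit $\lim_{s\to k}E_\mu(s)$, which exists, and the identity holds with this interpretation.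
   Context: $\zeta$ is the Riemann zeta function and $\Gamma$ the Euler gamma function. For a positive integer $v$ and real $m\ge 0$, $Q(v,m)$ denotes the normalized incomplete gamma function $Q(v,m)=\sum_{w=0}^{v-1}\frac{m^{w}}{w!}e^{-m}$ (equivalently $\Gamma(v)^{-1}\int_m^\infty t^{v-1}e^{-t}\,dt$). $\binom{s-1}{w}=\frac{(s-1)(s-2)\cdots(s-w)}{w!}$ is the generalized binomial coefficient. Complex powers $z^{a}$ with $\Re z>0$ are taken with the principal branch of the logarithm.
   Formalization: The last sentence (E_μ(k) as a limit, which exists, and the identity at s=k) is proved for integers 2≤k<v only; k=1 is excluded because ζ(s) and the last term have a pole at s=1, so the identity has no meaning there. *)

(* Defs.v *)
From Stdlib Require Import Reals ClassicalEpsilon Factorial.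
From Coquelicot Require Import Coquelicot.
Open Scope R_scope.

Definition Cexp (z : C) : C :=
  (exp (Re z) * cos (Im z), exp (Re z) * sin (Im z)).

(** Principal logarithm; used only for Re z > 0, where the principal
    argument is atan (Im z / Re z). *)
Definition Clog_pr (z : C) : C := (ln (Cmod z), atan (Im z / Re z)).

Definition Ccpow (z a : C) : C := Cexp (a * Clog_pr z).

Definition Cseries (a : nat -> C) : C :=
  (Series (fun n => Re (a n)), Series (fun n => Im (a n))).

(** Euler gamma function, via Euler/Gauss' limit definition
    Gamma(s) = lim_n n^s n! / (s (s+1) ... (s+n)). *)
Fixpoint Cprod_shift (s : C) (n : nat) : C :=
  match n with
  | O => s
  | S k => (Cprod_shift s k * (s + RtoC (INR (S k))))%C
  end.
Definition gauss_seq (s : C) (n : nat) : C :=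
  (Ccpow (RtoC (INR n)) s * RtoC (INR (fact n)) / Cprod_shift s n)%C.
Definition Gamma (s : C) : C :=
  (real (Lim_seq (fun n => Re (gauss_seq s n))),
   real (Lim_seq (fun n => Im (gauss_seq s n)))).

(** Riemann zeta function: the (unique) function holomorphic on C \ {1}
    which equals sum_{n>=1} n^{-s} for Re s > 1. *)
Definition is_riemann_zeta (Z : C -> C) : Prop :=
  (forall s : C, s <> RtoC 1 -> ex_derive (K := C_AbsRing) (V := C_NormedModule) Z s) /\
  (forall s : C, 1 < Re s ->
     is_series (K := C_AbsRing) (V := C_NormedModule)
       (fun n => Ccpow (RtoC (INR (S n))) (- s)) (Z s)).
Definition zeta : C -> C :=
  epsilon (inhabits (fun _ : C => RtoC 0)) is_riemann_zeta.

(** Normalized incomplete gamma function Q(v,m) = sum_{w=0}^{v-1} m^w/w! e^{-m}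
    (v >= 1). *)
Definition Qinc (v : nat) (m : R) : R :=
  sum_f_R0 (fun w => m ^ w / INR (fact w) * exp (- m)) (v - 1).

Fixpoint Cfalling (z : C) (w : nat) : C :=
  match w with
  | O => RtoC 1
  | S k => (Cfalling z k * (z - RtoC (INR k)))%C
  end.
Definition Cbinom (z : C) (w : nat) : C := (Cfalling z w / RtoC (INR (fact w)))%C.

Definition Dterm (v : nat) (N : R) (n : nat) (s : C) : C :=
  (Ccpow (RtoC (INR (S n))) (- s) * RtoC (Qinc v (INR (S n) / N)))%C.
Definition Dfun (v : nat) (N : R) (s : C) : C := Cseries (fun n => Dterm v N n s).

Definition Eterm (v : nat) (N mu : R) (m : nat) (s : C) : C :=
  (Ccpow (RtoC (INR m)) (s - RtoC 1)
  - sum_n (fun w =>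
       Cbinom (s - RtoC 1) w
       * Ccpow (RtoC (INR m) + (0, (mu / (2 * PI * N))%R)) (s - RtoC 1 - RtoC (INR w))
       * Cpow (0, (- mu / (2 * PI * N))%R) w) (v - 1))%C.

Definition Efun (v : nat) (N mu : R) (s : C) : C :=
  (Ccpow (RtoC (2 * PI)) (s - RtoC 1) * Gamma (RtoC 1 - s)
  * Cexp ((0, (mu * PI / 2)%R) * (RtoC 1 - s))
  * Cseries (fun m => Eterm v N mu (S m) s))%C.

Definition Corr (v : nat) (N : R) (s : C) : C :=
  (Gamma (RtoC 1 - s + RtoC (INR v)) / ((RtoC 1 - s) * Gamma (RtoC (INR v)))
  * Ccpow (RtoC N) (RtoC 1 - s))%C.

Definition unif_conv_series_on (P : C -> Prop) (a : nat -> C -> C) : Prop :=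
  exists f : C -> C, forall eps : R, 0 < eps -> exists M : nat,
    forall n : nat, (M <= n)%nat -> forall s : C, P s ->
      Cmod (sum_n (fun k => a k s) n - f s)%C < eps.

(* Main.v *)
Require Import Defs.
From Stdlib Require Import Reals Lra Lia Factorial ClassicalEpsilon.
From Coquelicot Require Import Coquelicot.
Open Scope R_scope.

(** Write [R_v(s)] for the right-hand side. Then [R_(v+1)(s) - R_v(s)] is a multiple of the
    difference of the two sides of Lipschitz's formula
      [sum_(n>=1) n^(a-1) e^(-n x) = Gamma(a) sum_(m in Z) (x + 2 pi i m)^(-a)],  [a = v + 1 - s], [x = 1/N],
    so [R_v] does not depend on [v > Re s]. For [Re s > 1] the limit [v -> oo] of [R_v(s)] is the Dirichlet
    series: [Q(v, .)] tends to 1, the Taylor remainders [E_mu(m, s)] and the last term tend to 0. Hence [R_2]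
    and the Dirichlet series glue to a function holomorphic off 1, which is zeta by the identity theorem.
    Lipschitz's formula is obtained from the binomial series [sum_k (a)_k / k! q^k = (1 - q)^(-a)] by
    averaging over [q = exp (- (x + 2 pi i j) / M)], [|j| < M / 2], and letting [M -> oo] in Gauss's limit
    for Gamma. Holomorphy here means mere complex differentiability, so the identity theorem and the
    differentiability of the series rest on Goursat's lemma and Cauchy's formula on squares. *)

(** Three obstacles shape the development. [zeta] is picked by [epsilon] from a specification, so
    nothing is known about it until some function meeting the specification has been built and any
    two such functions are shown to agree off 1; the puncture at 1 has to be dealt with in that
    uniqueness argument. [Gamma] and [Cseries] are total: they return a number even where their
    limits do not exist. Every evaluation therefore passes through a convergence statement, and
    Gamma is handled through its reciprocal, whose product converges for every s. Finally [Clog_pr]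
    is a logarithm only on Re z > 0, a half-plane that products may leave; hence only positive
    factors, inverses and quarter turns are ever taken out of a power. *)

Lemma Ceq (z w : C) : Re z = Re w -> Im z = Im w -> z = w.
Proof. destruct z, w; simpl; intros -> ->; reflexivity. Qed.

Lemma im_le_Cmod (c : C) : Rabs (Im c) <= Cmod c.
Proof. eapply Rle_trans; [| apply Rmax_Cmod]. apply Rmax_r. Qed.

Lemma Cmod_le_ReIm (z : C) : Cmod z <= Rabs (Re z) + Rabs (Im z).
Proof.
  replace z with (RtoC (Re z) + (0, 1) * RtoC (Im z))%C at 1
    by (apply Ceq; simpl; ring).
  eapply Rle_trans; [apply Cmod_triangle|].
  rewrite Cmod_mult, !Cmod_R. change (0, 1) with Ci. rewrite Cmod_Ci. lra.
Qed.

Lemma Cmod_sqr (z : C) : Cmod z * Cmod z = Re z * Re z + Im z * Im z.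
Proof. generalize (Cmod2_alt z). simpl. intro H. lra. Qed.

Lemma Cmod_minus_sym (z w : C) : Cmod (z - w) = Cmod (w - z).
Proof. rewrite <- Cmod_opp. f_equal. ring. Qed.

Lemma Cmod_triangle_rev (z w : C) : Cmod z - Cmod w <= Cmod (z - w).
Proof.
  generalize (Cmod_triangle (z - w) w).
  replace (z - w + w)%C with z by ring. lra.
Qed.

Lemma Cmod_triangle_minus (z w : C) : Cmod (z - w) <= Cmod z + Cmod w.
Proof.
  unfold Cminus. eapply Rle_trans; [apply Cmod_triangle|]. rewrite Cmod_opp. lra.
Qed.

Lemma Re_pos_neq (z : C) : 0 < Re z -> z <> RtoC 0.
Proof. intros H E. rewrite E in H. simpl in H. lra. Qed.

Lemma RtoC_neq (x : R) : x <> 0 -> RtoC x <> RtoC 0.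
Proof. intros H E. apply H. now apply RtoC_inj. Qed.

(** * The exponential and the principal power *)

Lemma Cexp_plus (z w : C) : Cexp (z + w) = (Cexp z * Cexp w)%C.
Proof.
  apply Ceq; unfold Cexp, Re, Im; simpl; rewrite exp_plus, ?cos_plus, ?sin_plus; ring.
Qed.

Lemma Cexp_0 : Cexp 0 = RtoC 1.
Proof. apply Ceq; unfold Cexp, Re, Im; simpl; rewrite exp_0, ?cos_0, ?sin_0; ring. Qed.

Lemma Cexp_RtoC (x : R) : Cexp (RtoC x) = RtoC (exp x).
Proof. apply Ceq; unfold Cexp, Re, Im; simpl; rewrite ?cos_0, ?sin_0; ring. Qed.

Lemma Cmod_Cexp (z : C) : Cmod (Cexp z) = exp (Re z).
Proof.
  unfold Cmod, Cexp; cbn [fst snd].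
  replace ((exp (Re z) * cos (Im z)) ^ 2 + (exp (Re z) * sin (Im z)) ^ 2)
    with (Rsqr (exp (Re z)) * (Rsqr (sin (Im z)) + Rsqr (cos (Im z))))
    by (unfold Rsqr; ring).
  rewrite sin2_cos2, Rmult_1_r. apply sqrt_Rsqr. left. apply exp_pos.
Qed.

Lemma Cexp_neq_0 (z : C) : Cexp z <> RtoC 0.
Proof. apply Cmod_gt_0. rewrite Cmod_Cexp. apply exp_pos. Qed.

Lemma Cexp_opp (z : C) : Cexp (- z) = (/ Cexp z)%C.
Proof.
  assert (H : (Cexp z * Cexp (- z))%C = RtoC 1).
  { rewrite <- Cexp_plus. replace (z + - z)%C with (RtoC 0) by ring. apply Cexp_0. }
  rewrite <- (Cmult_1_r (/ Cexp z)%C), <- H. field. apply Cexp_neq_0.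
Qed.

Lemma Cexp_pow (z : C) (n : nat) : (Cexp z ^ n)%C = Cexp (RtoC (INR n) * z).
Proof.
  induction n as [|n IH].
  - simpl. rewrite Cmult_0_l. symmetry. apply Cexp_0.
  - rewrite Cpow_S, IH, <- Cexp_plus, S_INR. f_equal. rewrite RtoC_plus. ring.
Qed.

Lemma Clog_pr_RtoC (r : R) : 0 < r -> Clog_pr (RtoC r) = RtoC (ln r).
Proof.
  intro H. unfold Clog_pr. rewrite Cmod_R, Rabs_pos_eq by lra. simpl.
  unfold Rdiv. rewrite Rmult_0_l, atan_0. reflexivity.
Qed.

Lemma atan_quotient_polar (x y : R) : 0 < x ->
  sqrt (x ^ 2 + y ^ 2) * cos (atan (y / x)) = x /\
  sqrt (x ^ 2 + y ^ 2) * sin (atan (y / x)) = y.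
Proof.
  intro H.
  assert (E : sqrt (x ^ 2 + y ^ 2) = x * sqrt (1 + (y / x)²)).
  { rewrite <- (sqrt_Rsqr x) at 2 by lra. rewrite <- sqrt_mult.
    - f_equal. unfold Rsqr. field. lra.
    - apply Rle_0_sqr.
    - generalize (Rle_0_sqr (y / x)). lra. }
  assert (P : 0 < sqrt (1 + (y / x)²)).
  { apply sqrt_lt_R0. generalize (Rle_0_sqr (y / x)). lra. }
  rewrite E, cos_atan, sin_atan. clear E. revert P. generalize (sqrt (1 + (y / x)²)). intros q P. split; field; lra.
Qed.

Lemma Cexp_Clog_pr (z : C) : 0 < Re z -> Cexp (Clog_pr z) = z.
Proof.
  intro H. destruct (atan_quotient_polar (Re z) (Im z) H) as [H1 H2].
  apply Ceq; unfold Cexp, Clog_pr; cbn [fst snd Re Im]; rewrite exp_ln;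
    try (apply Cmod_gt_0, Re_pos_neq, H); unfold Cmod; assumption.
Qed.

(** A positive factor leaves the quotient Im z / Re z unchanged, so no branch correction appears;
    for two complex factors the sum of the arguments could leave the range of [atan]. *)
Lemma Clog_pr_scal (r : R) (z : C) : 0 < r -> 0 < Re z ->
  Clog_pr (RtoC r * z) = (RtoC (ln r) + Clog_pr z)%C.
Proof.
  intros Hr Hz. apply Ceq; unfold Clog_pr; cbn [fst snd Re Im].
  - rewrite Cmod_mult, Cmod_R, Rabs_pos_eq by lra.
    simpl. apply ln_mult; [lra|]. apply Cmod_gt_0, Re_pos_neq, Hz.
  - unfold Re, Im in *. simpl. rewrite Rplus_0_l. f_equal. field. lra.
Qed.

Lemma Re_inv_pos (z : C) : 0 < Re z -> 0 < Re (/ z).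
Proof.
  intro H. simpl. change (fst z) with (Re z). change (snd z) with (Im z).
  apply Rdiv_lt_0_compat; [exact H|]. nra.
Qed.

Lemma Clog_pr_inv (z : C) : 0 < Re z -> Clog_pr (/ z) = (- Clog_pr z)%C.
Proof.
  intro H. assert (Hz := Re_pos_neq z H).
  apply Ceq; unfold Clog_pr; cbn [fst snd Re Im].
  - rewrite Cmod_inv by assumption. simpl. apply ln_Rinv. apply Cmod_gt_0, Hz.
  - unfold Re, Im in *. simpl. rewrite <- atan_opp. f_equal. field. split; nra.
Qed.

Lemma Ccpow_plus (z a b : C) : Ccpow z (a + b) = (Ccpow z a * Ccpow z b)%C.
Proof. unfold Ccpow. rewrite <- Cexp_plus. f_equal. ring. Qed.

Lemma Ccpow_opp (z a : C) : Ccpow z (- a) = (/ Ccpow z a)%C.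
Proof. unfold Ccpow. rewrite <- Cexp_opp. f_equal. ring. Qed.

Lemma Ccpow_neq_0 (z a : C) : Ccpow z a <> RtoC 0.
Proof. apply Cexp_neq_0. Qed.

Lemma Ccpow_0_r (z : C) : Ccpow z 0 = RtoC 1.
Proof. unfold Ccpow. rewrite Cmult_0_l. apply Cexp_0. Qed.

Lemma Ccpow_INR (z : C) (n : nat) : 0 < Re z -> Ccpow z (RtoC (INR n)) = (z ^ n)%C.
Proof. intro H. unfold Ccpow. rewrite <- Cexp_pow, Cexp_Clog_pr by exact H. reflexivity. Qed.

Lemma Ccpow_1_r (z : C) : 0 < Re z -> Ccpow z 1 = z.
Proof. intro H. change (RtoC 1) with (RtoC (INR 1)). rewrite Ccpow_INR by exact H. simpl. ring. Qed.

Lemma Ccpow_1_l (a : C) : Ccpow 1 a = RtoC 1.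
Proof.
  unfold Ccpow. rewrite Clog_pr_RtoC, ln_1 by lra. rewrite Cmult_0_r. apply Cexp_0.
Qed.

Lemma Ccpow_scal (r : R) (z a : C) : 0 < r -> 0 < Re z ->
  Ccpow (RtoC r * z) a = (Ccpow (RtoC r) a * Ccpow z a)%C.
Proof.
  intros Hr Hz. unfold Ccpow. rewrite Clog_pr_scal, Clog_pr_RtoC by assumption.
  rewrite <- Cexp_plus. f_equal. ring.
Qed.

Lemma Cmod_Ccpow_RtoC (r : R) (a : C) : 0 < r ->
  Cmod (Ccpow (RtoC r) a) = exp (Re a * ln r).
Proof.
  intro H. unfold Ccpow. rewrite Cmod_Cexp, Clog_pr_RtoC by exact H. f_equal. unfold Re. simpl. ring.
Qed.

Lemma exp_monotone (x y : R) : x <= y -> exp x <= exp y.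
Proof. intros [H | ->]; [left; now apply exp_increasing | apply Rle_refl]. Qed.

(** As [atan] takes values between -pi/2 and pi/2, the imaginary part of the exponent costs at most
    a constant factor. All later majorants of complex powers with a complex base rest on this. *)
Lemma Cmod_Ccpow_le (z a : C) :
  Cmod (Ccpow z a) <= exp (Re a * ln (Cmod z)) * exp (Rabs (Im a) * (PI / 2)).
Proof.
  unfold Ccpow. rewrite Cmod_Cexp, <- exp_plus.
  apply exp_monotone. unfold Clog_pr.
  replace (Re _) with (Re a * ln (Cmod z) - Im a * atan (Im z / Re z))
    by (unfold Re, Im; simpl; ring).
  assert (H := atan_bound (Im z / Re z)).
  assert (- (Im a * atan (Im z / Re z)) <= Rabs (Im a) * (PI / 2)).
  { eapply Rle_trans; [apply Rle_abs|]. rewrite Rabs_Ropp, Rabs_mult.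
    apply Rmult_le_compat_l; [apply Rabs_pos|]. apply Rabs_le. lra. }
  lra.
Qed.

(** * Continuity and complex differentiability *)

Definition Ccont (f : C -> C) (z : C) : Prop :=
  forall eps, 0 < eps -> exists d, 0 < d /\
    forall w, Cmod (w - z) < d -> Cmod (f w - f z) < eps.

(** The increment form with a weak inequality includes w = z and forms no quotient. The passage to
    and from Coquelicot's derivative, which occurs in [is_riemann_zeta], is [Cder_is_derive] and
    [is_derive_Cder]. *)
Definition Cder (f : C -> C) (z l : C) : Prop :=
  forall eps, 0 < eps -> exists d, 0 < d /\
    forall w, Cmod (w - z) < d ->
      Cmod (f w - f z - l * (w - z)) <= eps * Cmod (w - z).

Lemma Ccont_const (c z : C) : Ccont (fun _ => c) z.
Proof.
  intros e He. exists 1. split; [lra|]. intros.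
  replace (c - c)%C with (RtoC 0) by ring. rewrite Cmod_0. exact He.
Qed.

Lemma Ccont_id (z : C) : Ccont (fun w => w) z.
Proof. intros e He. exists e. split; auto. Qed.

Lemma Ccont_ext (f g : C -> C) (z : C) (d : R) : 0 < d ->
  (forall w, Cmod (w - z) < d -> f w = g w) -> Ccont f z -> Ccont g z.
Proof.
  intros Hd E H e He. destruct (H e He) as [d' [Hd' H']].
  exists (Rmin d d'). split; [now apply Rmin_pos|].
  intros w Hw.
  rewrite <- !E.
  - apply H'. eapply Rlt_le_trans; [exact Hw | apply Rmin_r].
  - replace (z - z)%C with (RtoC 0) by ring. rewrite Cmod_0. exact Hd.
  - eapply Rlt_le_trans; [exact Hw | apply Rmin_l].
Qed.

Lemma Ccont_comp (f g : C -> C) (z : C) :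
  Ccont g z -> Ccont f (g z) -> Ccont (fun w => f (g w)) z.
Proof.
  intros Hg Hf e He. destruct (Hf e He) as [d [Hd H]].
  destruct (Hg d Hd) as [d' [Hd' H']]. exists d'. split; auto.
Qed.

Lemma Ccont_plus (f g : C -> C) (z : C) :
  Ccont f z -> Ccont g z -> Ccont (fun w => f w + g w)%C z.
Proof.
  intros Hf Hg e He.
  destruct (Hf (e / 2)) as [d [Hd H]]; [lra|].
  destruct (Hg (e / 2)) as [d' [Hd' H']]; [lra|].
  exists (Rmin d d'). split; [now apply Rmin_pos|]. intros w Hw.
  replace (f w + g w - (f z + g z))%C with ((f w - f z) + (g w - g z))%C by ring.
  eapply Rle_lt_trans; [apply Cmod_triangle|].
  assert (Cmod (f w - f z) < e / 2) by (apply H; eapply Rlt_le_trans; [exact Hw | apply Rmin_l]).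
  assert (Cmod (g w - g z) < e / 2) by (apply H'; eapply Rlt_le_trans; [exact Hw | apply Rmin_r]).
  lra.
Qed.

Lemma Ccont_bounded (f : C -> C) (z : C) : Ccont f z ->
  exists d, 0 < d /\ forall w, Cmod (w - z) < d -> Cmod (f w) <= Cmod (f z) + 1.
Proof.
  intro H. destruct (H 1) as [d [Hd H']]; [lra|]. exists d. split; [exact Hd|].
  intros w Hw. specialize (H' w Hw). generalize (Cmod_triangle_rev (f w) (f z)). lra.
Qed.

Lemma Ccont_mult (f g : C -> C) (z : C) :
  Ccont f z -> Ccont g z -> Ccont (fun w => f w * g w)%C z.
Proof.
  intros Hf Hg e He.
  destruct (Ccont_bounded g z Hg) as [d0 [Hd0 B]].
  set (M := Cmod (g z) + 1) in *.
  assert (HM : 0 < M) by (unfold M; generalize (Cmod_ge_0 (g z)); lra).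
  set (L := Cmod (f z) + 1).
  assert (HL : 0 < L) by (unfold L; generalize (Cmod_ge_0 (f z)); lra).
  destruct (Hf (e / 2 / M)) as [d [Hd H]]; [repeat apply Rdiv_lt_0_compat; lra|].
  destruct (Hg (e / 2 / L)) as [d' [Hd' H']]; [repeat apply Rdiv_lt_0_compat; lra|].
  exists (Rmin d0 (Rmin d d')). split; [repeat apply Rmin_pos; assumption|]. intros w Hw.
  assert (Cmod (w - z) < d0 /\ Cmod (w - z) < d /\ Cmod (w - z) < d') as (W0 & W1 & W2).
  { generalize (Rmin_l d0 (Rmin d d')) (Rmin_r d0 (Rmin d d')) (Rmin_l d d') (Rmin_r d d'). lra. }
  replace (f w * g w - f z * g z)%C with ((f w - f z) * g w + f z * (g w - g z))%C by ring.
  eapply Rle_lt_trans; [apply Cmod_triangle|]. rewrite !Cmod_mult.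
  specialize (B w W0). specialize (H w W1). specialize (H' w W2).
  assert (Cmod (f w - f z) * Cmod (g w) <= e / 2 / M * M).
  { apply Rmult_le_compat; try apply Cmod_ge_0; lra. }
  assert (Cmod (f z) * Cmod (g w - g z) < L * (e / 2 / L)).
  { eapply Rle_lt_trans; [apply Rmult_le_compat_l; [apply Cmod_ge_0 | left; apply H']|].
    apply Rmult_lt_compat_r; [apply Rdiv_lt_0_compat; lra | unfold L; lra]. }
  replace (e / 2 / M * M) with (e / 2) in * by (field; lra).
  replace (L * (e / 2 / L)) with (e / 2) in * by (field; lra). lra.
Qed.

Lemma Ccont_opp (f : C -> C) (z : C) : Ccont f z -> Ccont (fun w => - f w)%C z.
Proof.
  intros H. apply (Ccont_ext (fun w => (- (1)) * f w)%C _ z 1); [lra | intros; ring |].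
  apply Ccont_mult; [apply Ccont_const | exact H].
Qed.

Lemma Ccont_minus (f g : C -> C) (z : C) :
  Ccont f z -> Ccont g z -> Ccont (fun w => f w - g w)%C z.
Proof. intros. apply Ccont_plus; [assumption | now apply Ccont_opp]. Qed.

Lemma Ccont_neq_0 (f : C -> C) (z : C) : Ccont f z -> f z <> RtoC 0 ->
  exists d, 0 < d /\ forall w, Cmod (w - z) < d ->
    Cmod (f z) / 2 <= Cmod (f w) /\ f w <> RtoC 0.
Proof.
  intros H N. apply Cmod_gt_0 in N.
  destruct (H (Cmod (f z) / 2)) as [d [Hd H']]; [lra|].
  exists d. split; [exact Hd|]. intros w Hw. specialize (H' w Hw).
  assert (Cmod (f z) / 2 <= Cmod (f w)).
  { rewrite Cmod_minus_sym in H'. generalize (Cmod_triangle_rev (f z) (f w)). lra. }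
  split; [assumption|]. apply Cmod_gt_0. lra.
Qed.

Lemma Ccont_inv (f : C -> C) (z : C) : Ccont f z -> f z <> RtoC 0 ->
  Ccont (fun w => / f w)%C z.
Proof.
  intros H N e He. destruct (Ccont_neq_0 f z H N) as [d [Hd B]].
  assert (P := N). apply Cmod_gt_0 in P.
  set (m := Cmod (f z)) in *.
  destruct (H (e * (m * m / 2))) as [d' [Hd' H']]; [apply Rmult_lt_0_compat; nra|].
  exists (Rmin d d'). split; [now apply Rmin_pos|]. intros w Hw.
  destruct (B w) as [B1 B2]; [eapply Rlt_le_trans; [exact Hw | apply Rmin_l]|].
  specialize (H' w ltac:(eapply Rlt_le_trans; [exact Hw | apply Rmin_r])).
  replace (/ f w - / f z)%C with (- (f w - f z) / (f w * f z))%C by (field; split; assumption).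
  rewrite Cmod_div by (now apply Cmult_neq_0). rewrite Cmod_opp, Cmod_mult. fold m.
  apply Rmult_lt_reg_r with (Cmod (f w) * m); [nra|].
  replace (Cmod (f w - f z) / (Cmod (f w) * m) * (Cmod (f w) * m)) with (Cmod (f w - f z))
    by (field; lra).
  eapply Rlt_le_trans; [exact H'|]. apply Rmult_le_compat_l; nra.
Qed.

Lemma Cder_Ccont (f : C -> C) (z l : C) : Cder f z l -> Ccont f z.
Proof.
  intros H e He. destruct (H 1) as [d [Hd H']]; [lra|].
  set (K := Cmod l + 1).
  assert (HK : 0 < K) by (unfold K; generalize (Cmod_ge_0 l); lra).
  exists (Rmin d (e / K)). split; [apply Rmin_pos; [exact Hd | now apply Rdiv_lt_0_compat]|].
  intros w Hw. specialize (H' w ltac:(eapply Rlt_le_trans; [exact Hw | apply Rmin_l])).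
  assert (W : Cmod (w - z) < e / K) by (eapply Rlt_le_trans; [exact Hw | apply Rmin_r]).
  assert (Cmod (f w - f z) <= K * Cmod (w - z)).
  { replace (f w - f z)%C with ((f w - f z - l * (w - z)) + l * (w - z))%C by ring.
    eapply Rle_trans; [apply Cmod_triangle|]. rewrite Cmod_mult. unfold K. lra. }
  apply Rmult_lt_compat_l with (r := K) in W; [|exact HK].
  replace (K * (e / K)) with e in W by (field; lra). lra.
Qed.

(* Carathéodory's formulation of differentiability reduces the differentiation rules to continuity. *)
Lemma Cder_intro (f p : C -> C) (z l : C) (d : R) : 0 < d -> Ccont p z -> p z = l ->
  (forall w, Cmod (w - z) < d -> (f w = f z + p w * (w - z))%C) -> Cder f z l.
Proof.
  intros Hd Hp E H e He. destruct (Hp e He) as [d' [Hd' H']].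
  exists (Rmin d d'). split; [now apply Rmin_pos|]. intros w Hw.
  rewrite (H w) by (eapply Rlt_le_trans; [exact Hw | apply Rmin_l]).
  specialize (H' w ltac:(eapply Rlt_le_trans; [exact Hw | apply Rmin_r])).
  replace (f z + p w * (w - z) - f z - l * (w - z))%C with ((p w - p z) * (w - z))%C
    by (rewrite E; ring).
  rewrite Cmod_mult. apply Rmult_le_compat_r; [apply Cmod_ge_0 | lra].
Qed.

(** p is the difference quotient, completed by l at z. Besides the differentiation rules it provides
    the regularised quotient of [cauchy_formula] and the cofactor of the zero in
    [Efun_removable]. *)
Lemma Cder_elim (f : C -> C) (z l : C) : Cder f z l ->
  exists p, Ccont p z /\ p z = l /\ forall w, (f w = f z + p w * (w - z))%C.
Proof.
  intro H.
  set (p := fun w => if Ceq_dec w z then l else ((f w - f z) / (w - z))%C).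
  assert (Pz : p z = l) by (unfold p; destruct (Ceq_dec z z); [reflexivity | congruence]).
  assert (Pw : forall w, (f w = f z + p w * (w - z))%C).
  { intro w. unfold p. destruct (Ceq_dec w z) as [->|N]; [ring|].
    field. intro E. apply N. apply Ceq_minus. exact E. }
  exists p. split; [|split; assumption].
  intros e He. destruct (H (e / 2)) as [d [Hd H']]; [lra|].
  exists d. split; [exact Hd|]. intros w Hw. specialize (H' w Hw).
  destruct (Ceq_dec w z) as [->|N].
  { replace (p z - p z)%C with (RtoC 0) by ring. rewrite Cmod_0. exact He. }
  assert (N' : (w - z)%C <> RtoC 0) by (intro E; apply N, Ceq_minus; exact E).
  apply Cmod_gt_0 in N'.
  rewrite Pw, Pz in *. 
  replace (f z + p w * (w - z) - f z - l * (w - z))%C with ((p w - l) * (w - z))%C in H' by ring.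
  rewrite Cmod_mult in H'. apply Rmult_le_reg_r in H'; lra.
Qed.

Lemma Cder_ext (f g : C -> C) (z l : C) (d : R) : 0 < d ->
  (forall w, Cmod (w - z) < d -> f w = g w) -> Cder f z l -> Cder g z l.
Proof.
  intros Hd E H. destruct (Cder_elim f z l H) as (p & Hp & Ep & Hf).
  apply (Cder_intro g p z l d Hd Hp Ep). intros w Hw.
  rewrite <- !E; auto. replace (z - z)%C with (RtoC 0) by ring. rewrite Cmod_0. exact Hd.
Qed.

Lemma Cder_eq (f : C -> C) (z l l' : C) : l = l' -> Cder f z l -> Cder f z l'.
Proof. intros ->; auto. Qed.

Lemma Cder_const (c z : C) : Cder (fun _ => c) z 0.
Proof.
  apply (Cder_intro _ (fun _ => RtoC 0) z 0 1); [lra | apply Ccont_const | reflexivity|].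
  intros. ring.
Qed.

Lemma Cder_id (z : C) : Cder (fun w => w) z 1.
Proof.
  apply (Cder_intro _ (fun _ => RtoC 1) z 1 1); [lra | apply Ccont_const | reflexivity|].
  intros. ring.
Qed.

Lemma Cder_plus (f g : C -> C) (z l m : C) : Cder f z l -> Cder g z m ->
  Cder (fun w => f w + g w)%C z (l + m).
Proof.
  intros Hf Hg. destruct (Cder_elim _ _ _ Hf) as (p & Hp & Ep & Ef).
  destruct (Cder_elim _ _ _ Hg) as (q & Hq & Eq & Eg).
  apply (Cder_intro _ (fun w => p w + q w)%C z _ 1); [lra | now apply Ccont_plus | congruence|].
  intros w _. rewrite (Ef w), (Eg w). ring.
Qed.

Lemma Cder_mult (f g : C -> C) (z l m : C) : Cder f z l -> Cder g z m ->
  Cder (fun w => f w * g w)%C z (l * g z + f z * m).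
Proof.
  intros Hf Hg. destruct (Cder_elim _ _ _ Hf) as (p & Hp & Ep & Ef).
  destruct (Cder_elim _ _ _ Hg) as (q & Hq & Eq & Eg).
  apply (Cder_intro _ (fun w => p w * g w + f z * q w)%C z _ 1); [lra | | congruence|].
  - apply Ccont_plus; apply Ccont_mult; try assumption; try apply Ccont_const.
    eapply Cder_Ccont, Hg.
  - intros w _. rewrite (Ef w), (Eg w). ring.
Qed.

Lemma Cder_scal (c : C) (f : C -> C) (z l : C) : Cder f z l ->
  Cder (fun w => c * f w)%C z (c * l).
Proof.
  intro H. eapply Cder_eq; [|apply Cder_mult; [apply Cder_const | exact H]]. cbv beta. ring.
Qed.

Lemma Cder_opp (f : C -> C) (z l : C) : Cder f z l -> Cder (fun w => - f w)%C z (- l).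
Proof.
  intro H. apply (Cder_ext (fun w => - (1) * f w)%C _ z _ 1); [lra | intros; ring|].
  eapply Cder_eq; [|apply Cder_scal, H]. ring.
Qed.

Lemma Cder_minus (f g : C -> C) (z l m : C) : Cder f z l -> Cder g z m ->
  Cder (fun w => f w - g w)%C z (l - m).
Proof. intros. apply Cder_plus; [assumption | now apply Cder_opp]. Qed.

Lemma Cder_comp (f g : C -> C) (z l m : C) : Cder g z m -> Cder f (g z) l ->
  Cder (fun w => f (g w)) z (l * m).
Proof.
  intros Hg Hf. destruct (Cder_elim _ _ _ Hf) as (p & Hp & Ep & Ef).
  destruct (Cder_elim _ _ _ Hg) as (q & Hq & Eq & Eg).
  apply (Cder_intro _ (fun w => p (g w) * q w)%C z _ 1); [lra | | congruence|].
  - apply Ccont_mult; [|assumption]. apply Ccont_comp; [eapply Cder_Ccont, Hg | assumption].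
  - intros w _. rewrite (Ef (g w)).
    replace (g w - g z)%C with (q w * (w - z))%C by (rewrite (Eg w); ring). ring.
Qed.

Lemma Cder_inv (f : C -> C) (z l : C) : Cder f z l -> f z <> RtoC 0 ->
  Cder (fun w => / f w)%C z (- l / (f z * f z)).
Proof.
  intros Hf N. destruct (Cder_elim _ _ _ Hf) as (p & Hp & Ep & Ef).
  assert (Cf := Cder_Ccont _ _ _ Hf).
  destruct (Ccont_neq_0 f z Cf N) as (d & Hd & B).
  apply (Cder_intro _ (fun w => - p w * / (f w * f z))%C z _ d Hd).
  - apply Ccont_mult; [now apply Ccont_opp|]. apply Ccont_inv.
    + apply Ccont_mult; [assumption | apply Ccont_const].
    + now apply Cmult_neq_0.
  - rewrite Ep. reflexivity.
  - intros w Hw. destruct (B w Hw) as [_ Nw].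
    assert (E : (p w * (w - z) = f w - f z)%C) by (rewrite (Ef w); ring).
    transitivity (/ f z - (p w * (w - z)) * / (f w * f z))%C; [|ring].
    rewrite E. field; split; assumption.
Qed.

Lemma Cder_div (f g : C -> C) (z l m : C) : Cder f z l -> Cder g z m -> g z <> RtoC 0 ->
  Cder (fun w => f w / g w)%C z ((l * g z - f z * m) / (g z * g z)).
Proof.
  intros Hf Hg N.
  eapply Cder_eq; [|apply Cder_mult; [exact Hf | apply Cder_inv; [exact Hg | exact N]]].
  cbv beta. field. exact N.
Qed.

Lemma Cder_pow (f : C -> C) (z l : C) (n : nat) : Cder f z l ->
  exists m, Cder (fun w => f w ^ n)%C z m.
Proof.
  intro H. induction n as [|n [m IH]].
  - exists (RtoC 0). apply (Cder_ext (fun _ => RtoC 1) _ z _ 1); [lra | intros; reflexivity|].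
    apply Cder_const.
  - eexists. apply (Cder_ext (fun w => f w * f w ^ n)%C _ z _ 1); [lra | intros; symmetry; apply Cpow_S|].
    apply Cder_mult; eassumption.
Qed.

Lemma Cder_unique (f : C -> C) (z l m : C) : Cder f z l -> Cder f z m -> l = m.
Proof.
  intros Hl Hm. destruct (Ceq_dec l m) as [E|N]; [exact E|]. exfalso.
  assert (P : 0 < Cmod (l - m)).
  { apply Cmod_gt_0. intro E. apply N, Ceq_minus, E. }
  destruct (Hl (Cmod (l - m) / 4)) as (d & Hd & H1); [lra|].
  destruct (Hm (Cmod (l - m) / 4)) as (d' & Hd' & H2); [lra|].
  set (t := Rmin d d' / 2).
  assert (Ht : 0 < t) by (unfold t; generalize (Rmin_pos d d' Hd Hd'); lra).
  assert (E : Cmod (z + RtoC t - z) = t).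
  { replace (z + RtoC t - z)%C with (RtoC t) by ring. rewrite Cmod_R. apply Rabs_pos_eq. lra. }
  specialize (H1 (z + RtoC t)%C). specialize (H2 (z + RtoC t)%C). rewrite E in H1, H2.
  specialize (H1 ltac:(unfold t in *; generalize (Rmin_l d d'); lra)).
  specialize (H2 ltac:(unfold t in *; generalize (Rmin_r d d'); lra)).
  assert (Cmod ((l - m) * RtoC t) <= Cmod (l - m) / 2 * t).
  { replace ((l - m) * RtoC t)%C with
      ((f (z + RtoC t) - f z - m * (z + RtoC t - z)) - (f (z + RtoC t) - f z - l * (z + RtoC t - z)))%C
      by ring.
    eapply Rle_trans; [apply Cmod_triangle_minus|]. lra. }
  rewrite Cmod_mult, Cmod_R, Rabs_pos_eq in H by lra.
  apply Rmult_le_reg_r in H; lra.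
Qed.

Lemma Cder_is_derive (f : C -> C) (z l : C) :
  Cder f z l -> is_derive (K := C_AbsRing) (V := C_NormedModule) f z l.
Proof.
  intro H. split; [apply is_linear_scal_l|].
  intros x Hx. apply (is_filter_lim_locally_unique (V := AbsRing_NormedModule C_AbsRing)) in Hx.
  subst x. intros eps. destruct (H eps (cond_pos eps)) as (d & Hd & B).
  exists (mkposreal d Hd). intros w Hw.
  change (Cmod (w - z) < d) in Hw. specialize (B w Hw).
  change (Cmod (f w - f z - (w - z) * l) <= eps * Cmod (w - z)).
  replace (f w - f z - (w - z) * l)%C with (f w - f z - l * (w - z))%C by ring. exact B.
Qed.

Lemma is_derive_Cder (f : C -> C) (z l : C) :
  is_derive (K := C_AbsRing) (V := C_NormedModule) f z l -> Cder f z l.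
Proof.
  intros [_ H] e He.
  (* [locally z] converges to z: the required inclusion of filters is the identity. *)
  specialize (H z (fun P Q => Q)).
  destruct (H (mkposreal e He)) as [d B]. exists d. split; [apply cond_pos|].
  intros w Hw. specialize (B w Hw).
  change (Cmod (f w - f z - (w - z) * l) <= e * Cmod (w - z)) in B.
  replace (f w - f z - l * (w - z))%C with (f w - f z - (w - z) * l)%C by ring. exact B.
Qed.

(** * Second-order estimates for the exponential *)

(** Only exp x >= 1 + x is used, at x and at -x. The second instance gives exp x (1 - x) <= 1, and
    (1 - x)(1 + x + 2 x^2) = 1 + x^2 (1 - 2 x) >= 1 for x <= 1/2. *)
Lemma exp_taylor2 (x : R) : Rabs x <= / 2 -> Rabs (exp x - 1 - x) <= 2 * x ^ 2.
Proof.
  intro H. apply Rabs_le_between in H.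
  assert (H1 := exp_ineq1_le x). assert (H2 := exp_ineq1_le (- x)).
  assert (H3 : exp x * exp (- x) = 1) by (rewrite <- exp_plus, Rplus_opp_r; apply exp_0).
  assert (exp x * (1 - x) <= 1) by (generalize (exp_pos x); nra).
  assert (exp x <= 1 + x + 2 * x ^ 2).
  { apply Rmult_le_reg_r with (1 - x); [lra|]. nra. }
  apply Rabs_le. nra.
Qed.

(** Half-angle formula: cos y - 1 = -2 sin(y/2)^2, together with |sin t| <= |t|. *)
Lemma cos_taylor2 (y : R) : Rabs (cos y - 1) <= y ^ 2 / 2.
Proof.
  assert (A : Rabs (sin (y / 2)) <= Rabs (y / 2)).
  { assert (P : forall t, 0 < t -> Rabs (sin t) <= t).
    { intros t Ht. apply Rabs_le. split; [|left; now apply sin_lt_x].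
      destruct (Rle_dec t 1) as [L|L].
      - assert (0 < sin t) by (apply sin_gt_0; generalize PI2_1; lra). lra.
      - generalize (SIN_bound t). lra. }
    destruct (Rtotal_order (y / 2) 0) as [L|[E|L]].
    - rewrite <- (Rabs_Ropp (sin _)), <- sin_neg, <- (Rabs_Ropp (y / 2)).
      rewrite (Rabs_pos_eq (- (y / 2))) by lra. apply P. lra.
    - rewrite E, sin_0, Rabs_R0. lra.
    - rewrite (Rabs_pos_eq (y / 2)) by lra. now apply P. }
  replace y with (2 * (y / 2)) at 1 by field. rewrite cos_2a_sin.
  replace (1 - 2 * sin (y / 2) * sin (y / 2) - 1) with (- (2 * (sin (y / 2) * sin (y / 2)))) by ring.
  rewrite Rabs_Ropp, Rabs_mult, Rabs_mult, (Rabs_pos_eq 2) by lra.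
  assert (Rabs (sin (y / 2)) * Rabs (sin (y / 2)) <= Rabs (y / 2) * Rabs (y / 2))
    by (apply Rmult_le_compat; auto using Rabs_pos).
  replace (Rabs (y / 2) * Rabs (y / 2)) with (y ^ 2 / 4) in H; [lra|].
  rewrite <- Rabs_mult, Rabs_pos_eq; [field | nra].
Qed.

Lemma sin_taylor2 (y : R) : Rabs y <= / 2 -> Rabs (sin y - y) <= y ^ 2.
Proof.
  intro H.
  destruct (MVT_gen (fun t => sin t - t) 0 y (fun t => cos t - 1)) as (c & Hc & E).
  - intros t _. auto_derive; [exact I | ring].
  - intros t _. apply continuity_pt_filterlim.
    apply (ex_derive_continuous (V := R_NormedModule) (fun t => sin t - t)).
    auto_derive. exact I.
  - cbv beta in E. rewrite sin_0 in E. replace (sin y - y) with ((cos c - 1) * y) by lra.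
    rewrite Rabs_mult.
    assert (C := cos_taylor2 c).
    assert (Rabs c <= Rabs y).
    { destruct (Rle_dec 0 y) as [L|L].
      - rewrite Rmin_left, Rmax_right in Hc by lra. rewrite !Rabs_pos_eq; lra.
      - rewrite Rmin_right, Rmax_left in Hc by lra. rewrite !Rabs_left1; lra. }
    rewrite <- (pow2_abs y). rewrite <- (pow2_abs c) in C. generalize (Rabs_pos y) (Rabs_pos c). 
    intros P Q. assert (Rabs c ^ 2 / 2 <= Rabs y) by nra.
    generalize (Rabs_pos (cos c - 1)). nra.
Qed.

Lemma Cexp_taylor2 (z : C) : Cmod z <= / 2 -> Cmod (Cexp z - 1 - z) <= 5 * (Cmod z * Cmod z).
Proof.
  intro H. assert (Hx := Rle_trans _ _ _ (re_le_Cmod z) H). assert (Hy := Rle_trans _ _ _ (im_le_Cmod z) H).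
  eapply Rle_trans; [apply Cmod_le_ReIm|]. rewrite Cmod_sqr.
  unfold Cexp, Re, Im in *. destruct z as [x y]. cbn [fst snd] in *. simpl.
  assert (E := exp_taylor2 x Hx). assert (C := cos_taylor2 y). assert (S := sin_taylor2 y Hy).
  replace (exp x * cos y + - (1) + - x) with ((exp x - 1 - x) * cos y + (1 + x) * (cos y - 1)) by ring.
  replace (exp x * sin y + - 0 + - y) with
    ((exp x - 1 - x) * sin y + ((1 + x) * (sin y - y) + x * y)) by ring.
  assert (Rabs (1 + x) <= 3 / 2) by (apply Rabs_le_between in Hx; apply Rabs_le; lra).
  assert (Rabs (cos y) <= 1) by (generalize (COS_bound y); intro; apply Rabs_le; lra).
  assert (Rabs (sin y) <= 1) by (generalize (SIN_bound y); intro; apply Rabs_le; lra).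
  assert (Rabs ((exp x - 1 - x) * cos y) <= 2 * x ^ 2 * 1)
    by (rewrite Rabs_mult; apply Rmult_le_compat; auto using Rabs_pos).
  assert (Rabs ((exp x - 1 - x) * sin y) <= 2 * x ^ 2 * 1)
    by (rewrite Rabs_mult; apply Rmult_le_compat; auto using Rabs_pos).
  assert (Rabs ((1 + x) * (cos y - 1)) <= 3 / 2 * (y ^ 2 / 2))
    by (rewrite Rabs_mult; apply Rmult_le_compat; auto using Rabs_pos).
  assert (Rabs ((1 + x) * (sin y - y)) <= 3 / 2 * y ^ 2)
    by (rewrite Rabs_mult; apply Rmult_le_compat; auto using Rabs_pos).
  assert (Rabs (x * y) <= (x ^ 2 + y ^ 2) / 2) by (apply Rabs_le; split;
    [generalize (pow2_ge_0 (x+y)) | generalize (pow2_ge_0 (x-y))]; nra).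
  eapply Rle_trans; [apply Rplus_le_compat; [apply Rabs_triang | eapply Rle_trans;
    [apply Rabs_triang | apply Rplus_le_compat_l, Rabs_triang]]|].
  nra.
Qed.

Lemma Cder_Cexp (z : C) : Cder Cexp z (Cexp z).
Proof.
  intros e He. set (K := 5 * Cmod (Cexp z)).
  assert (HK : 0 < K) by (unfold K; rewrite Cmod_Cexp; generalize (exp_pos (Re z)); lra).
  exists (Rmin (/ 2) (e / K)). split; [apply Rmin_pos; [lra | now apply Rdiv_lt_0_compat]|].
  intros w Hw.
  assert (W1 : Cmod (w - z) <= / 2) by (generalize (Rmin_l (/ 2) (e / K)); lra).
  assert (W2 : Cmod (w - z) < e / K) by (generalize (Rmin_r (/ 2) (e / K)); lra).
  replace (Cexp w - Cexp z - Cexp z * (w - z))%C with (Cexp z * (Cexp (w - z) - 1 - (w - z)))%C.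
  2: { replace (Cexp w) with (Cexp z * Cexp (w - z))%C; [ring|].
       rewrite <- Cexp_plus. f_equal. ring. }
  rewrite Cmod_mult. assert (T := Cexp_taylor2 _ W1).
  assert (K * Cmod (w - z) <= e).
  { apply Rmult_lt_compat_l with (r := K) in W2; [|exact HK].
    replace (K * (e / K)) with e in W2 by (field; lra). lra. }
  unfold K in *. generalize (Cmod_ge_0 (Cexp z)) (Cmod_ge_0 (w - z)). nra.
Qed.

Lemma Cder_Cexp_comp (f : C -> C) (z l : C) : Cder f z l ->
  Cder (fun w => Cexp (f w)) z (Cexp (f z) * l).
Proof. intro H. apply Cder_comp; [exact H | apply Cder_Cexp]. Qed.

Lemma Cder_Ccpow_r (b : C) (f : C -> C) (z l : C) : Cder f z l ->
  Cder (fun w => Ccpow b (f w)) z (Ccpow b (f z) * (l * Clog_pr b)).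
Proof.
  intro H. unfold Ccpow. apply (Cder_Cexp_comp (fun w => f w * Clog_pr b)%C).
  eapply Cder_eq; [|apply Cder_mult; [exact H | apply Cder_const]]. cbv beta. ring.
Qed.

(** * Continuity and derivative of the principal logarithm *)

Definition CcontR (f : C -> R) (z : C) : Prop :=
  forall eps, 0 < eps -> exists d, 0 < d /\ forall w, Cmod (w - z) < d -> Rabs (f w - f z) < eps.

Lemma CcontR_comp (h : R -> R) (f : C -> R) (z : C) :
  continuity_pt h (f z) -> CcontR f z -> CcontR (fun w => h (f w)) z.
Proof.
  intros Hh Hf e He. destruct (Hh e He) as (d & Hd & B).
  destruct (Hf d Hd) as (d' & Hd' & B'). exists d'. split; [exact Hd'|].
  intros w Hw. specialize (B' w Hw).
  destruct (Req_dec (f w) (f z)) as [E|N].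
  - rewrite E, Rminus_diag_eq, Rabs_R0 by reflexivity. exact He.
  - apply B. split; [split; [exact I | now apply not_eq_sym] | exact B'].
Qed.

Lemma CcontR_Re (f : C -> C) (z : C) : Ccont f z -> CcontR (fun w => Re (f w)) z.
Proof.
  intros H e He. destruct (H e He) as (d & Hd & B). exists d. split; [exact Hd|].
  intros w Hw. eapply Rle_lt_trans; [|apply (B w Hw)].
  replace (Re (f w) - Re (f z)) with (Re (f w - f z)) by reflexivity. apply re_le_Cmod.
Qed.

Lemma CcontR_Im (f : C -> C) (z : C) : Ccont f z -> CcontR (fun w => Im (f w)) z.
Proof.
  intros H e He. destruct (H e He) as (d & Hd & B). exists d. split; [exact Hd|].
  intros w Hw. eapply Rle_lt_trans; [|apply (B w Hw)].
  replace (Im (f w) - Im (f z)) with (Im (f w - f z)) by reflexivity. apply im_le_Cmod.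
Qed.

Lemma CcontR_Cmod (f : C -> C) (z : C) : Ccont f z -> CcontR (fun w => Cmod (f w)) z.
Proof.
  intros H e He. destruct (H e He) as (d & Hd & B). exists d. split; [exact Hd|].
  intros w Hw. specialize (B w Hw). generalize (Cmod_triangle_rev (f w) (f z)) (Cmod_triangle_rev (f z) (f w)).
  rewrite (Cmod_minus_sym (f z)). intros. apply Rabs_def1; lra.
Qed.

Lemma Ccont_pair (f g : C -> R) (z : C) : CcontR f z -> CcontR g z ->
  Ccont (fun w => (f w, g w)) z.
Proof.
  intros Hf Hg e He. destruct (Hf (e / 2)) as (d & Hd & B); [lra|].
  destruct (Hg (e / 2)) as (d' & Hd' & B'); [lra|].
  exists (Rmin d d'). split; [now apply Rmin_pos|]. intros w Hw.
  specialize (B w ltac:(eapply Rlt_le_trans; [exact Hw | apply Rmin_l])).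
  specialize (B' w ltac:(eapply Rlt_le_trans; [exact Hw | apply Rmin_r])).
  eapply Rle_lt_trans; [apply Cmod_le_ReIm|]. simpl. unfold Rminus in *. lra.
Qed.

Lemma Ccont_RtoC (f : C -> R) (z : C) : CcontR f z -> Ccont (fun w => RtoC (f w)) z.
Proof.
  intros H e He. destruct (H e He) as (d & Hd & B). exists d. split; [exact Hd|].
  intros w Hw. rewrite <- RtoC_minus, Cmod_R. now apply B.
Qed.

Lemma Ccont_Clog_pr (z : C) : 0 < Re z -> Ccont Clog_pr z.
Proof.
  intro H. unfold Clog_pr. apply Ccont_pair.
  - apply (CcontR_comp ln).
    + apply derivable_continuous_pt. exists (/ Cmod z). apply derivable_pt_lim_ln.
      apply Cmod_gt_0, Re_pos_neq, H.
    + apply (CcontR_Cmod (fun w => w)), Ccont_id.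
  - apply (CcontR_comp atan).
    + apply derivable_continuous_pt, derivable_pt_atan.
    (* The real quotient Im w / Re w is treated as a complex quotient so that [Ccont_inv] applies;
       the two agree where Re w > 0. *)
    + assert (C1 : Ccont (fun w => RtoC (Im w) / RtoC (Re w))%C z).
      { apply Ccont_mult.
        - apply Ccont_RtoC, (CcontR_Im (fun w => w)), Ccont_id.
        - apply Ccont_inv; [apply Ccont_RtoC, (CcontR_Re (fun w => w)), Ccont_id|].
          apply RtoC_neq. lra. }
      apply CcontR_Re in C1.
      assert (P : forall w, 0 < Re w -> Re (RtoC (Im w) / RtoC (Re w))%C = Im w / Re w).
      { intros w Hw. rewrite <- RtoC_div by lra. apply re_RtoC. }
      intros e He. destruct (C1 e He) as (d & Hd & B).
      exists (Rmin d (Re z)). split; [now apply Rmin_pos|]. intros w Hw.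
      assert (0 < Re w).
      { generalize (re_le_Cmod (w - z)) (Rmin_r d (Re z)). intros A1 A2.
        apply Rabs_le_between in A1. unfold Re in *. simpl in A1. lra. }
      rewrite <- !P by assumption. apply B. eapply Rlt_le_trans; [exact Hw | apply Rmin_l].
Qed.

Lemma Re_pos_near (z w : C) : Cmod (w - z) < Re z -> 0 < Re w.
Proof.
  intro H. generalize (re_le_Cmod (w - z)). intros A1.
  apply Rabs_le_between in A1. unfold Re in *. simpl in A1. lra.
Qed.

(* The derivative of an inverse function, [Clog_pr] being a continuous right inverse of [Cexp]. *)
Lemma Cder_Clog_pr (z : C) : 0 < Re z -> Cder Clog_pr z (/ z).
Proof.
  intro H. destruct (Cder_elim _ _ _ (Cder_Cexp (Clog_pr z))) as (p & Hp & Ep & E).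
  rewrite Cexp_Clog_pr in Ep by exact H.
  assert (Nz := Re_pos_neq z H).
  assert (Cp : Ccont (fun w => p (Clog_pr w)) z).
  { apply (Ccont_comp p Clog_pr); [now apply Ccont_Clog_pr | exact Hp]. }
  destruct (Ccont_neq_0 _ _ Cp) as (d & Hd & B); [rewrite Ep; exact Nz|].
  apply (Cder_intro _ (fun w => / p (Clog_pr w))%C z _ (Rmin d (Re z))).
  - now apply Rmin_pos.
  - apply Ccont_inv; [exact Cp | rewrite Ep; exact Nz].
  - now rewrite Ep.
  - intros w Hw.
    destruct (B w) as [_ N]; [eapply Rlt_le_trans; [exact Hw | apply Rmin_l]|].
    assert (Pw : 0 < Re w) by (apply (Re_pos_near z); eapply Rlt_le_trans; [exact Hw | apply Rmin_r]).
    specialize (E (Clog_pr w)). rewrite !Cexp_Clog_pr in E by assumption.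
    replace (w - z)%C with (p (Clog_pr w) * (Clog_pr w - Clog_pr z))%C by (rewrite E at 3; ring).
    field. exact N.
Qed.

Lemma Cder_Ccpow_l (a : C) (f : C -> C) (z l : C) : 0 < Re (f z) -> Cder f z l ->
  Cder (fun w => Ccpow (f w) a) z (a * Ccpow (f z) a / f z * l).
Proof.
  intros H Hf. unfold Ccpow.
  eapply Cder_eq; [|apply (Cder_Cexp_comp (fun w => a * Clog_pr (f w))%C), Cder_scal,
    (Cder_comp Clog_pr f _ _ _ Hf (Cder_Clog_pr _ H))].
  cbv beta. field. now apply Re_pos_neq.
Qed.

(** * Constancy on segments *)

(** Restriction to a line reduces complex statements to real calculus: the mean value theorem in
    [Cder_0_segment] and the fundamental theorem in [rint_primitive]. *)
Lemma Cder_path (f : C -> C) (p q l : C) (t : R) : Cder f (p + RtoC t * q)%C l ->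
  is_derive (fun u => Re (f (p + RtoC u * q)%C)) t (Re (l * q)) /\ is_derive (fun u => Im (f (p + RtoC u
    * q)%C)) t (Im (l * q)).
Proof.
  intro H.
  assert (G : forall e, 0 < e -> exists d, 0 < d /\ forall u, Rabs (u - t) < d ->
     Cmod (f (p + RtoC u * q)%C - f (p + RtoC t * q)%C - RtoC (u - t) * (l * q)) <= e * Rabs (u - t)).
  { intros e He. set (K := Cmod q + 1).
    assert (HK : 0 < K) by (unfold K; generalize (Cmod_ge_0 q); lra).
    destruct (H (e / K)) as (d & Hd & B); [now apply Rdiv_lt_0_compat|].
    exists (d / K). split; [now apply Rdiv_lt_0_compat|]. intros u Hu.
    assert (E : (p + RtoC u * q - (p + RtoC t * q) = RtoC (u - t) * q)%C)
      by (rewrite RtoC_minus; ring).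
    specialize (B (p + RtoC u * q)%C). rewrite E, Cmod_mult, Cmod_R in B.
    assert (Q : Rabs (u - t) * Cmod q <= Rabs (u - t) * K).
    { apply Rmult_le_compat_l; [apply Rabs_pos | unfold K; lra]. }
    assert (Rabs (u - t) * K < d).
    { apply Rmult_lt_compat_r with (r := K) in Hu; [|exact HK].
      replace (d / K * K) with d in Hu by (field; lra). exact Hu. }
    specialize (B ltac:(lra)).
    replace (RtoC (u - t) * (l * q))%C with (l * (RtoC (u - t) * q))%C by ring.
    eapply Rle_trans; [exact B|].
    replace (e * Rabs (u - t)) with (e / K * (Rabs (u - t) * K)) by (field; lra).
    apply Rmult_le_compat_l; [left; now apply Rdiv_lt_0_compat | exact Q]. }
  split; (split; [apply is_linear_scal_l|]); intros x Hx;
    apply (is_filter_lim_locally_unique (V := R_NormedModule)) in Hx; subst x;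
    intros eps; destruct (G eps (cond_pos eps)) as (d & Hd & B);
    exists (mkposreal d Hd); intros u Hu;
    (eapply Rle_trans; [|apply (B u Hu)]).
  - eapply Rle_trans; [|apply re_le_Cmod].
    right. change (Rabs ?a = Rabs ?b) with (Rabs a = Rabs b).
    unfold norm, minus, plus, opp, scal, Re; simpl. unfold mult; simpl. unfold abs; simpl.
    f_equal. ring.
  - eapply Rle_trans; [|apply im_le_Cmod].
    right. unfold norm, minus, plus, opp, scal, Im; simpl. unfold mult; simpl. unfold abs; simpl.
    f_equal. ring.
Qed.

Lemma Cder_0_segment (f : C -> C) (p q : C) :
  (forall t, 0 <= t <= 1 -> Cder f (p + RtoC t * q)%C 0) -> f (p + q)%C = f p.
Proof.
  intro H.
  assert (G : forall h : R -> R, (forall t, 0 <= t <= 1 -> is_derive h t 0) -> h 1 = h 0).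
  { intros h Hh. destruct (MVT_gen h 0 1 (fun _ => 0)) as (c & _ & E).
    - intros t Ht. rewrite Rmin_left, Rmax_right in Ht by lra. apply Hh. lra.
    - intros t Ht. rewrite Rmin_left, Rmax_right in Ht by lra.
      apply continuity_pt_filterlim, (ex_derive_continuous (V := R_NormedModule) h).
      exists 0. apply Hh. lra.
    - lra. }
  assert (D : forall t, 0 <= t <= 1 ->
    is_derive (fun u => Re (f (p + RtoC u * q)%C)) t 0 /\ is_derive (fun u => Im (f (p + RtoC u * q)%C)) t 0).
  { intros t Ht. destruct (Cder_path f p q 0 t (H t Ht)) as [A B].
    rewrite Cmult_0_l in A, B. split; assumption. }
  assert (A := G _ (fun t Ht => proj1 (D t Ht))).
  assert (B := G _ (fun t Ht => proj2 (D t Ht))). cbv beta in A, B.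
  rewrite Cmult_1_l, Cmult_0_l, Cplus_0_r in A, B. apply Ceq; assumption.
Qed.

(** * Contour integrals over rectangles and Cauchy's theorem *)

Definition CI (g : R -> C) (a b : R) : C :=
  (RInt (fun t => Re (g t)) a b, RInt (fun t => Im (g t)) a b).

Definition pcont (g : R -> C) (t : R) : Prop :=
  continuous (fun u => Re (g u)) t /\ continuous (fun u => Im (g u)) t.

Lemma pcont_isometry (f : C -> C) (h : R -> C) (t : R) :
  (forall u, Cmod (h u - h t) = Rabs (u - t)) -> Ccont f (h t) -> pcont (fun u => f (h u)) t.
Proof.
  intros Hh Hf. split; apply continuity_pt_filterlim; intros e He;
    destruct (Hf e He) as (d & Hd & B); exists d; (split; [exact Hd|]);
    intros u [_ Hu]; (eapply Rle_lt_trans; [|apply (B (h u)); rewrite Hh; exact Hu]).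
  - apply (re_le_Cmod (f (h u) - f (h t))).
  - apply (im_le_Cmod (f (h u) - f (h t))).
Qed.

Lemma pcont_horizontal (f : C -> C) (y t : R) : Ccont f (t, y) -> pcont (fun u => f (u, y)) t.
Proof.
  intro H. apply (pcont_isometry f (fun u => (u, y))); [|exact H].
  intro u. replace ((u, y) - (t, y))%C with (RtoC (u - t)) by (apply Ceq; simpl; ring).
  apply Cmod_R.
Qed.

Lemma pcont_vertical (f : C -> C) (x t : R) : Ccont f (x, t) -> pcont (fun u => f (x, u)) t.
Proof.
  intro H. apply (pcont_isometry f (fun u => (x, u))); [|exact H].
  intro u. replace ((x, u) - (x, t))%C with (Ci * RtoC (u - t))%C by (apply Ceq; simpl; ring).
  rewrite Cmod_mult, Cmod_Ci, Cmod_R. ring.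
Qed.

Lemma pcont_ex_RInt (g : R -> C) (a b : R) : a <= b -> (forall t, a <= t <= b -> pcont g t) ->
  ex_RInt (fun t => Re (g t)) a b /\ ex_RInt (fun t => Im (g t)) a b.
Proof.
  intros L H.
  split; [apply (ex_RInt_continuous (fun t => Re (g t))) | apply (ex_RInt_continuous (fun t => Im (g t)))];
    intros t; rewrite (Rmin_left a b L), (Rmax_right a b L); intro Ht; apply (H t Ht).
Qed.

Lemma CI_plus (g h : R -> C) (a b : R) : a <= b ->
  (forall t, a <= t <= b -> pcont g t) -> (forall t, a <= t <= b -> pcont h t) ->
  CI (fun t => g t + h t)%C a b = (CI g a b + CI h a b)%C.
Proof.
  intros L Hg Hh. destruct (pcont_ex_RInt g a b L Hg), (pcont_ex_RInt h a b L Hh).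
  apply Ceq; simpl; apply (RInt_plus (V := R_CompleteNormedModule)); assumption.
Qed.

Lemma CI_scal (c : C) (g : R -> C) (a b : R) : a <= b ->
  (forall t, a <= t <= b -> pcont g t) ->
  CI (fun t => c * g t)%C a b = (c * CI g a b)%C.
Proof.
  intros L Hg. destruct (pcont_ex_RInt g a b L Hg) as [E1 E2].
  apply Ceq.
  - change (RInt (fun t => fst c * Re (g t) - snd c * Im (g t)) a b =
      fst c * RInt (fun t => Re (g t)) a b - snd c * RInt (fun t => Im (g t)) a b).
    rewrite <- (RInt_scal (V := R_CompleteNormedModule) (fun t => Re (g t))) by assumption.
    rewrite <- (RInt_scal (V := R_CompleteNormedModule) (fun t => Im (g t))) by assumption.
    apply (RInt_minus (V := R_CompleteNormedModule)); now apply (ex_RInt_scal (V := R_NormedModule)).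
  - change (RInt (fun t => fst c * Im (g t) + snd c * Re (g t)) a b =
      fst c * RInt (fun t => Im (g t)) a b + snd c * RInt (fun t => Re (g t)) a b).
    rewrite <- (RInt_scal (V := R_CompleteNormedModule) (fun t => Re (g t))) by assumption.
    rewrite <- (RInt_scal (V := R_CompleteNormedModule) (fun t => Im (g t))) by assumption.
    apply (RInt_plus (V := R_CompleteNormedModule)); now apply (ex_RInt_scal (V := R_NormedModule)).
Qed.

Lemma CI_ext (g h : R -> C) (a b : R) : a <= b ->
  (forall t, a <= t <= b -> g t = h t) -> CI g a b = CI h a b.
Proof.
  intros L H. apply Ceq; simpl; apply (RInt_ext (V := R_CompleteNormedModule));
    intros t; rewrite Rmin_left, Rmax_right by exact L; intro Ht; rewrite H by lra; reflexivity.
Qed.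

Lemma CI_chasles (g : R -> C) (a m b : R) : a <= m <= b ->
  (forall t, a <= t <= b -> pcont g t) -> CI g a b = (CI g a m + CI g m b)%C.
Proof.
  intros L Hg.
  destruct (pcont_ex_RInt g a m) as [E1 E2]; [lra | intros; apply Hg; lra|].
  destruct (pcont_ex_RInt g m b) as [E3 E4]; [lra | intros; apply Hg; lra|].
  apply Ceq; simpl; symmetry; apply (RInt_Chasles (V := R_CompleteNormedModule)); assumption.
Qed.

(** The factor 2 comes from bounding real and imaginary part separately; it only enlarges later
    constants. *)
Lemma CI_bound (g : R -> C) (a b M : R) : a <= b ->
  (forall t, a <= t <= b -> pcont g t) -> (forall t, a <= t <= b -> Cmod (g t) <= M) ->
  Cmod (CI g a b) <= 2 * (b - a) * M.
Proof.
  intros L Hg HM. destruct (pcont_ex_RInt g a b L Hg) as [E1 E2].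
  eapply Rle_trans; [apply Cmod_le_ReIm|]. simpl.
  assert (Rabs (RInt (fun t => Re (g t)) a b) <= (b - a) * M).
  { apply abs_RInt_le_const; [exact L | exact E1|]. intros t Ht.
    eapply Rle_trans; [apply re_le_Cmod | now apply HM]. }
  assert (Rabs (RInt (fun t => Im (g t)) a b) <= (b - a) * M).
  { apply abs_RInt_le_const; [exact L | exact E2|]. intros t Ht.
    eapply Rle_trans; [apply im_le_Cmod | now apply HM]. }
  lra.
Qed.

Lemma CI_ftc (G g : R -> C) (a b : R) : a <= b -> (forall t, a <= t <= b -> pcont g t) ->
  (forall t, a <= t <= b -> is_derive (fun u => Re (G u)) t (Re (g t)) /\
     is_derive (fun u => Im (G u)) t (Im (g t))) ->
  CI g a b = (G b - G a)%C.
Proof.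
  intros L Hc Hd.
  apply Ceq; simpl; apply is_RInt_unique.
  - apply (is_RInt_derive (fun u => Re (G u)) (fun t => Re (g t)));
      intros t; rewrite (Rmin_left a b L), (Rmax_right a b L); intro Ht; [apply (Hd t Ht) | apply (Hc t Ht)].
  - apply (is_RInt_derive (fun u => Im (G u)) (fun t => Im (g t)));
      intros t; rewrite (Rmin_left a b L), (Rmax_right a b L); intro Ht; [apply (Hd t Ht) | apply (Hc t Ht)].
Qed.

(** The counterclockwise integral of f(w) dw along the boundary: bottom, right, top and left side,
    with dw = i dt on the vertical ones. *)
Definition rint (f : C -> C) (x1 x2 y1 y2 : R) : C :=
  (CI (fun t => f (t, y1)) x1 x2 + Ci * CI (fun t => f (x2, t)) y1 y2
   - CI (fun t => f (t, y2)) x1 x2 - Ci * CI (fun t => f (x1, t)) y1 y2)%C.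

Definition in_rect (x1 x2 y1 y2 : R) (w : C) : Prop :=
  x1 <= Re w <= x2 /\ y1 <= Im w <= y2.

Definition on_bd (x1 x2 y1 y2 : R) (w : C) : Prop :=
  in_rect x1 x2 y1 y2 w /\ (Re w = x1 \/ Re w = x2 \/ Im w = y1 \/ Im w = y2).

Ltac bdt := unfold on_bd, in_rect; simpl; lra.
Ltac pct := intros; first [apply pcont_horizontal | apply pcont_vertical];
  match goal with H : forall w, _ -> Ccont _ w |- _ => apply H; bdt end.

Lemma rint_plus (f g : C -> C) (x1 x2 y1 y2 : R) : x1 <= x2 -> y1 <= y2 ->
  (forall w, on_bd x1 x2 y1 y2 w -> Ccont f w) -> (forall w, on_bd x1 x2 y1 y2 w -> Ccont g w) ->
  rint (fun w => f w + g w)%C x1 x2 y1 y2 = (rint f x1 x2 y1 y2 + rint g x1 x2 y1 y2)%C.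
Proof.
  intros Lx Ly Hf Hg. unfold rint.
  rewrite (CI_plus (fun t => f (t, y1)) (fun t => g (t, y1))), (CI_plus (fun t => f (t, y2)) (fun t => g (t, y2))),
    (CI_plus (fun t => f (x1, t)) (fun t => g (x1, t))), (CI_plus (fun t => f (x2, t)) (fun t => g (x2, t)));
    try assumption; try ring;
    intros; first [apply pcont_horizontal | apply pcont_vertical]; (apply Hf || apply Hg); bdt.
Qed.

Lemma rint_scal (c : C) (f : C -> C) (x1 x2 y1 y2 : R) : x1 <= x2 -> y1 <= y2 ->
  (forall w, on_bd x1 x2 y1 y2 w -> Ccont f w) ->
  rint (fun w => c * f w)%C x1 x2 y1 y2 = (c * rint f x1 x2 y1 y2)%C.
Proof.
  intros Lx Ly Hf. unfold rint.
  rewrite (CI_scal c (fun t => f (t, y1))), (CI_scal c (fun t => f (t, y2))),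
    (CI_scal c (fun t => f (x1, t))), (CI_scal c (fun t => f (x2, t)));
    try assumption; try ring; pct.
Qed.

Lemma rint_ext (f g : C -> C) (x1 x2 y1 y2 : R) : x1 <= x2 -> y1 <= y2 ->
  (forall w, on_bd x1 x2 y1 y2 w -> f w = g w) -> rint f x1 x2 y1 y2 = rint g x1 x2 y1 y2.
Proof.
  intros Lx Ly H. unfold rint.
  rewrite (CI_ext (fun t => f (t, y1)) (fun t => g (t, y1))), (CI_ext (fun t => f (t, y2)) (fun t => g (t, y2))),
    (CI_ext (fun t => f (x1, t)) (fun t => g (x1, t))), (CI_ext (fun t => f (x2, t)) (fun t => g (x2, t)));
    try assumption; try reflexivity; intros; apply H; bdt.
Qed.

Lemma rint_minus (f g : C -> C) (x1 x2 y1 y2 : R) : x1 <= x2 -> y1 <= y2 ->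
  (forall w, on_bd x1 x2 y1 y2 w -> Ccont f w) -> (forall w, on_bd x1 x2 y1 y2 w -> Ccont g w) ->
  rint (fun w => f w - g w)%C x1 x2 y1 y2 = (rint f x1 x2 y1 y2 - rint g x1 x2 y1 y2)%C.
Proof.
  intros Lx Ly Hf Hg.
  rewrite (rint_ext _ (fun w => f w + (- (1)) * g w)%C) by (try assumption; intros; ring).
  rewrite rint_plus, rint_scal; try assumption; [ring|].
  intros w Hw. apply Ccont_mult; [apply Ccont_const | now apply Hg].
Qed.

Lemma rint_bound (f : C -> C) (x1 x2 y1 y2 M : R) : x1 <= x2 -> y1 <= y2 ->
  (forall w, on_bd x1 x2 y1 y2 w -> Ccont f w) ->
  (forall w, on_bd x1 x2 y1 y2 w -> Cmod (f w) <= M) ->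
  Cmod (rint f x1 x2 y1 y2) <= 4 * M * ((x2 - x1) + (y2 - y1)).
Proof.
  intros Lx Ly Hf HM.
  assert (B1 : Cmod (CI (fun t => f (t, y1)) x1 x2) <= 2 * (x2 - x1) * M)
    by (apply CI_bound; [assumption | pct | intros; apply HM; bdt]).
  assert (B2 : Cmod (CI (fun t => f (t, y2)) x1 x2) <= 2 * (x2 - x1) * M)
    by (apply CI_bound; [assumption | pct | intros; apply HM; bdt]).
  assert (B3 : Cmod (CI (fun t => f (x1, t)) y1 y2) <= 2 * (y2 - y1) * M)
    by (apply CI_bound; [assumption | pct | intros; apply HM; bdt]).
  assert (B4 : Cmod (CI (fun t => f (x2, t)) y1 y2) <= 2 * (y2 - y1) * M)
    by (apply CI_bound; [assumption | pct | intros; apply HM; bdt]).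
  unfold rint.
  eapply Rle_trans; [apply Cmod_triangle_minus|]. rewrite Cmod_mult, Cmod_Ci.
  eapply Rle_trans; [apply Rplus_le_compat_r, Cmod_triangle_minus|].
  eapply Rle_trans; [apply Rplus_le_compat_r, Rplus_le_compat_r, Cmod_triangle|].
  rewrite Cmod_mult, Cmod_Ci. lra.
Qed.

Lemma rint_split_v (f : C -> C) (x1 m x2 y1 y2 : R) : x1 <= m <= x2 -> y1 <= y2 ->
  (forall w, in_rect x1 x2 y1 y2 w -> Ccont f w) ->
  rint f x1 x2 y1 y2 = (rint f x1 m y1 y2 + rint f m x2 y1 y2)%C.
Proof.
  intros Lx Ly Hf. unfold rint.
  rewrite (CI_chasles (fun t => f (t, y1)) x1 m x2), (CI_chasles (fun t => f (t, y2)) x1 m x2);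
    try assumption; [ring | |]; pct.
Qed.

Lemma rint_split_h (f : C -> C) (x1 x2 y1 m y2 : R) : x1 <= x2 -> y1 <= m <= y2 ->
  (forall w, in_rect x1 x2 y1 y2 w -> Ccont f w) ->
  rint f x1 x2 y1 y2 = (rint f x1 x2 y1 m + rint f x1 x2 m y2)%C.
Proof.
  intros Lx Ly Hf. unfold rint.
  rewrite (CI_chasles (fun t => f (x1, t)) y1 m y2), (CI_chasles (fun t => f (x2, t)) y1 m y2);
    try assumption; [ring | |]; pct.
Qed.

Lemma rint_primitive (F f : C -> C) (x1 x2 y1 y2 : R) : x1 <= x2 -> y1 <= y2 ->
  (forall w, on_bd x1 x2 y1 y2 w -> Ccont f w) ->
  (forall w, on_bd x1 x2 y1 y2 w -> Cder F w (f w)) -> rint f x1 x2 y1 y2 = RtoC 0.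
Proof.
  intros Lx Ly Hf HF.
  assert (Hh : forall y, (y = y1 \/ y = y2) ->
    CI (fun t => f (t, y)) x1 x2 = (F (x2, y) - F (x1, y))%C).
  { intros y Hy. apply (CI_ftc (fun t => F (t, y))); [assumption | pct |].
    intros t Ht. assert (E : forall u, ((0, y) + RtoC u * 1)%C = (u, y))
      by (intro; apply Ceq; simpl; ring).
    destruct (Cder_path F (0, y) 1 (f (t, y)) t) as [D1 D2];
      [rewrite E; apply HF; bdt|].
    rewrite Cmult_1_r in D1, D2.
    split; [eapply is_derive_ext; [|exact D1] | eapply is_derive_ext; [|exact D2]];
      intro u; cbv beta; now rewrite E. }
  assert (Hv : forall x, (x = x1 \/ x = x2) ->
    (Ci * CI (fun t => f (x, t)) y1 y2)%C = (F (x, y2) - F (x, y1))%C).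
  { intros x Hx. rewrite <- CI_scal; [|assumption | pct].
    apply (CI_ftc (fun t => F (x, t))); [assumption | |].
    - intros t Ht. apply (pcont_vertical (fun w => Ci * f w)%C).
      apply Ccont_mult; [apply Ccont_const | apply Hf; bdt].
    - intros t Ht. assert (E : forall u, ((x, 0) + RtoC u * Ci)%C = (x, u))
        by (intro; apply Ceq; simpl; ring).
      destruct (Cder_path F (x, 0) Ci (f (x, t)) t) as [D1 D2];
        [rewrite E; apply HF; bdt|].
      rewrite (Cmult_comm (f (x, t))) in D1, D2.
      split; [eapply is_derive_ext; [|exact D1] | eapply is_derive_ext; [|exact D2]];
        intro u; cbv beta; now rewrite E. }
  unfold rint. rewrite !Hh, !Hv by auto. ring.
Qed.

(* Bisection: an additive property of rectangles that holds for all small rectangles around each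
   point holds for the whole rectangle. *)
Lemma rect_bisection (P : R -> R -> R -> R -> Prop) (x1 x2 y1 y2 : R) :
  x1 <= x2 -> y1 <= y2 ->
  (forall a b c d, x1 <= a -> a <= b -> b <= x2 -> y1 <= c -> c <= d -> d <= y2 ->
    P a ((a + b) / 2) c ((c + d) / 2) -> P ((a + b) / 2) b c ((c + d) / 2) ->
    P a ((a + b) / 2) ((c + d) / 2) d -> P ((a + b) / 2) b ((c + d) / 2) d -> P a b c d) ->
  (forall z, in_rect x1 x2 y1 y2 z -> exists r, 0 < r /\ forall a b c d,
    x1 <= a -> b <= x2 -> y1 <= c -> d <= y2 -> in_rect a b c d z -> b - a < r -> d - c < r ->
    P a b c d) ->
  P x1 x2 y1 y2.
Proof.
  intros Lx Ly Hadd Hloc. apply NNPP. intro N.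
  (* Rectangles on which P fails, packed with the proof of failure, so that the choice of a bad
     quarter can be iterated. *)
  pose (T := {q : R * R * R * R | let '(a, b, c, d) := q in
    x1 <= a /\ a <= b /\ b <= x2 /\ y1 <= c /\ c <= d /\ d <= y2 /\ ~ P a b c d}).
  assert (step : forall q : T, exists q' : T,
    let '(a, b, c, d) := proj1_sig q in let '(a', b', c', d') := proj1_sig q' in
    a <= a' /\ b' <= b /\ c <= c' /\ d' <= d /\ b' - a' = (b - a) / 2 /\ d' - c' = (d - c) / 2).
  { intros [[[[a b] c] d] H]. cbn [proj1_sig].
    destruct H as (H1 & H2 & H3 & H4 & H5 & H6 & H7).
    destruct (classic (P a ((a + b) / 2) c ((c + d) / 2))) as [Q1|Q1];
    [destruct (classic (P ((a + b) / 2) b c ((c + d) / 2))) as [Q2|Q2];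
    [destruct (classic (P a ((a + b) / 2) ((c + d) / 2) d)) as [Q3|Q3];
    [destruct (classic (P ((a + b) / 2) b ((c + d) / 2) d)) as [Q4|Q4]|]|]|].
    - exfalso. apply H7, Hadd; assumption.
    - unshelve eexists (exist _ ((a + b) / 2, b, (c + d) / 2, d) _); cbv beta iota;
        [repeat split; try assumption; lra | simpl; repeat split; lra].
    - unshelve eexists (exist _ (a, (a + b) / 2, (c + d) / 2, d) _); cbv beta iota;
        [repeat split; try assumption; lra | simpl; repeat split; lra].
    - unshelve eexists (exist _ ((a + b) / 2, b, c, (c + d) / 2) _); cbv beta iota;
        [repeat split; try assumption; lra | simpl; repeat split; lra].
    - unshelve eexists (exist _ (a, (a + b) / 2, c, (c + d) / 2) _); cbv beta iota;
        [repeat split; try assumption; lra | simpl; repeat split; lra]. }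
  set (next := fun q : T => proj1_sig (constructive_indefinite_description _ (step q))).
  assert (T0 : T) by (exists (x1, x2, y1, y2); repeat split; try assumption; lra).
  set (s := fix s n : T := match n with O => T0 | S k => next (s k) end).
  set (A := fun n => fst (fst (fst (proj1_sig (s n))))).
  set (B := fun n => snd (fst (fst (proj1_sig (s n))))).
  set (Cc := fun n => snd (fst (proj1_sig (s n)))).
  set (D := fun n => snd (proj1_sig (s n))).
  assert (Inv : forall n, x1 <= A n /\ A n <= B n /\ B n <= x2 /\ y1 <= Cc n /\ Cc n <= D n /\
    D n <= y2 /\ ~ P (A n) (B n) (Cc n) (D n)).
  { intro n. unfold A, B, Cc, D. destruct (s n) as [[[[a b] c] d] H]. exact H. }
  assert (St : forall n, A n <= A (S n) /\ B (S n) <= B n /\ Cc n <= Cc (S n) /\ D (S n) <= D n /\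
    B (S n) - A (S n) = (B n - A n) / 2 /\ D (S n) - Cc (S n) = (D n - Cc n) / 2).
  { intro n. unfold A, B, Cc, D. cbn [s]. fold s. unfold next.
    generalize (proj2_sig (constructive_indefinite_description _ (step (s n)))).
    destruct (proj1_sig (constructive_indefinite_description _ (step (s n)))) as [[[[a' b'] c'] d'] H'].
    destruct (s n) as [[[[a b] c] d] H]. cbn [proj1_sig fst snd]. auto. }
  clearbody A B Cc D. clear s next step T0.
  assert (W : forall n, B n - A n <= (x2 - x1) / 2 ^ n /\ D n - Cc n <= (y2 - y1) / 2 ^ n).
  { induction n as [|n [IH1 IH2]].
    - destruct (Inv 0%nat) as (? & ? & ? & ? & ? & ? & _). simpl. lra.
    - destruct (St n) as (_ & _ & _ & _ & E1 & E2). rewrite E1, E2. simpl.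
      assert (0 < 2 ^ n) by (apply pow_lt; lra).
      replace ((x2 - x1) / (2 * 2 ^ n)) with ((x2 - x1) / 2 ^ n / 2) by (field; lra).
      replace ((y2 - y1) / (2 * 2 ^ n)) with ((y2 - y1) / 2 ^ n / 2) by (field; lra). lra. }
  assert (nest : forall U V : nat -> R, (forall n, U n <= U (S n)) -> (forall n, V (S n) <= V n) ->
    (forall n, U n <= V n) -> exists z, forall n, U n <= z <= V n).
  { intros U V HU HV HUV.
    assert (MU : forall n m, (n <= m)%nat -> U n <= U m).
    { intros n m L. induction L; [lra | eapply Rle_trans; eauto]. }
    assert (MV : forall n m, (n <= m)%nat -> V m <= V n).
    { intros n m L. induction L; [lra | eapply Rle_trans; eauto]. }
    assert (UV : forall n m, U n <= V m).
    { intros n m. eapply Rle_trans; [apply (MU n (max n m)); lia|].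
      eapply Rle_trans; [apply HUV | apply MV; lia]. }
    destruct (completeness (fun x => exists n, x = U n)) as [z [Hz1 Hz2]].
    - exists (V 0%nat). intros x [n ->]. apply UV.
    - exists (U 0%nat), 0%nat. reflexivity.
    - exists z. intro n. split; [apply Hz1; now exists n|].
      apply Hz2. intros x [m ->]. apply UV. }
  destruct (nest A B) as [zx Hzx]; [intro; apply St | intro; apply St | intro; apply Inv|].
  destruct (nest Cc D) as [zy Hzy]; [intro; apply St | intro; apply St | intro; apply Inv|].
  assert (Iz : in_rect x1 x2 y1 y2 (zx, zy)).
  { generalize (Inv 0%nat) (Hzx 0%nat) (Hzy 0%nat). intros. bdt. }
  destruct (Hloc _ Iz) as (r & Hr & Hl).
  (* The summand 1 keeps K positive when the rectangle degenerates to a point. *)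
  set (K := (x2 - x1) + (y2 - y1) + 1).
  destruct (pow_lt_1_zero (/ 2)) with (y := r / K) as [n Hn].
  { rewrite Rabs_pos_eq; lra. }
  { apply Rdiv_lt_0_compat; unfold K; lra. }
  specialize (Hn n (le_n n)). rewrite pow_inv, Rabs_pos_eq in Hn
    by (left; apply Rinv_0_lt_compat, pow_lt; lra).
  assert (P2 : 0 < / 2 ^ n) by (apply Rinv_0_lt_compat, pow_lt; lra).
  assert (Q : K * / 2 ^ n < r).
  { apply Rmult_lt_compat_l with (r := K) in Hn; [|unfold K; lra].
    replace (K * (r / K)) with r in Hn by (field; unfold K; lra). exact Hn. }
  destruct (W n) as [W1 W2]. unfold Rdiv in W1, W2.
  destruct (Inv n) as (I1 & I2 & I3 & I4 & I5 & I6 & I7). apply I7. unfold K in Q.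
  apply Hl; try assumption; [|nra|nra].
  generalize (Hzx n) (Hzy n). intros. bdt.
Qed.

Lemma Cmod_in_rect (a b c d : R) (z w : C) : in_rect a b c d z -> in_rect a b c d w ->
  Cmod (w - z) <= (b - a) + (d - c).
Proof.
  unfold in_rect. intros Hz Hw. eapply Rle_trans; [apply Cmod_le_ReIm|].
  replace (Re (w - z)) with (Re w - Re z) by reflexivity.
  replace (Im (w - z)) with (Im w - Im z) by reflexivity.
  assert (Rabs (Re w - Re z) <= b - a) by (apply Rabs_le; lra).
  assert (Rabs (Im w - Im z) <= d - c) by (apply Rabs_le; lra). lra.
Qed.

(** The bound e times the squared half-perimeter is additive under quartering, because four quarters
    each have half the half-perimeter. Near a point the affine part of f has a primitive and
    integrates to 0, while the remainder is at most e/4 times the half-perimeter. *)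
Lemma goursat (f : C -> C) (x1 x2 y1 y2 : R) : x1 <= x2 -> y1 <= y2 ->
  (forall w, in_rect x1 x2 y1 y2 w -> exists l, Cder f w l) -> rint f x1 x2 y1 y2 = RtoC 0.
Proof.
  intros Lx Ly Hf.
  assert (Hc : forall w, in_rect x1 x2 y1 y2 w -> Ccont f w).
  { intros w Hw. destruct (Hf w Hw) as [l Hl]. now apply Cder_Ccont in Hl. }
  assert (K : forall e, 0 < e -> Cmod (rint f x1 x2 y1 y2) <= e * ((x2 - x1) + (y2 - y1)) ^ 2).
  { intros e He.
    apply (rect_bisection (fun a b c d => Cmod (rint f a b c d) <= e * ((b - a) + (d - c)) ^ 2));
      try assumption.
    - intros a b c d H1 H2 H3 H4 H5 H6 P1 P2 P3 P4.
      assert (Hc' : forall w, in_rect a b c d w -> Ccont f w)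
        by (intros w Hw; apply Hc; unfold in_rect in *; lra).
      rewrite (rint_split_v f a ((a + b) / 2) b) by (try assumption; lra).
      rewrite (rint_split_h f a ((a + b) / 2) c ((c + d) / 2) d)
        by (try lra; intros w Hw; apply Hc'; unfold in_rect in *; lra).
      rewrite (rint_split_h f ((a + b) / 2) b c ((c + d) / 2) d)
        by (try lra; intros w Hw; apply Hc'; unfold in_rect in *; lra).
      eapply Rle_trans; [apply Cmod_triangle|].
      eapply Rle_trans; [apply Rplus_le_compat; apply Cmod_triangle|].
      nra.
    - intros z Hz. destruct (Hf z Hz) as [l Hl].
      destruct (Hl (e / 4)) as (r & Hr & B); [lra|].
      exists (r / 2). split; [lra|]. intros a b c d H1 H2 H3 H4 Hin Hw1 Hw2.
      assert (Lab : a <= b) by (unfold in_rect in Hin; lra).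
      assert (Lcd : c <= d) by (unfold in_rect in Hin; lra).
      assert (Hc' : forall w, in_rect a b c d w -> Ccont f w)
        by (intros w Hw; apply Hc; unfold in_rect in *; lra).
      set (g := fun w => (f z + l * (w - z))%C).
      assert (Cg : forall w, Cder g w l).
      { intro w. eapply Cder_eq; [|apply Cder_plus; [apply Cder_const | apply Cder_scal, Cder_minus;
          [apply Cder_id | apply Cder_const]]]. ring. }
      assert (G0 : rint g a b c d = RtoC 0).
      { apply (rint_primitive (fun w => f z * w + l * ((w - z) * (w - z)) * RtoC (/ 2))%C); try assumption.
        - intros w _. eapply Cder_Ccont, Cg.
        - intros w _. eapply Cder_eq.
          2: { apply Cder_plus; [apply Cder_scal, Cder_id|].
               apply Cder_mult; [|apply Cder_const]. apply Cder_scal.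
               apply Cder_mult; (apply Cder_minus; [apply Cder_id | apply Cder_const]). }
          unfold g. cbv beta. rewrite RtoC_inv by lra. field. }
      replace (rint f a b c d) with (rint (fun w => f w - g w)%C a b c d).
      2: { rewrite rint_minus, G0; try assumption; [ring | |].
           - intros w [Hw _]. now apply Hc'.
           - intros w _. eapply Cder_Ccont, Cg. }
      eapply Rle_trans.
      + apply rint_bound with (M := e / 4 * ((b - a) + (d - c))); try assumption.
        * intros w [Hw _]. apply Ccont_minus; [now apply Hc' | eapply Cder_Ccont, Cg].
        * intros w [Hw _]. assert (Hd := Cmod_in_rect _ _ _ _ _ _ Hin Hw).
          specialize (B w ltac:(lra)). unfold g.
          replace (f w - (f z + l * (w - z)))%C with (f w - f z - l * (w - z))%C by ring.
          eapply Rle_trans; [exact B|]. apply Rmult_le_compat_l; lra.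
      + right. field. }
  destruct (Ceq_dec (rint f x1 x2 y1 y2) 0) as [E|N]; [exact E|].
  apply Cmod_gt_0 in N. exfalso. set (c := Cmod (rint f x1 x2 y1 y2)) in *.
  set (S := ((x2 - x1) + (y2 - y1)) ^ 2) in *. assert (0 <= S) by apply pow2_ge_0.
  specialize (K (c / 2 / (S + 1))). specialize (K ltac:(repeat apply Rdiv_lt_0_compat; lra)).
  assert (c / 2 / (S + 1) * S <= c / 2).
  { apply Rmult_le_reg_r with (S + 1); [lra|].
    replace (c / 2 / (S + 1) * S * (S + 1)) with (c / 2 * S) by (field; lra). nra. }
  lra.
Qed.

(** Cutting out a square of half-side e around z leaves four rectangles where [goursat] applies. By
    continuity f is bounded by M near z, so the square contributes at most 16 M e, for arbitrarily
    small e. *)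
Lemma goursat_punctured (f : C -> C) (z : C) (x1 x2 y1 y2 : R) :
  x1 < Re z < x2 -> y1 < Im z < y2 ->
  (forall w, in_rect x1 x2 y1 y2 w -> Ccont f w) ->
  (forall w, in_rect x1 x2 y1 y2 w -> w <> z -> exists l, Cder f w l) ->
  rint f x1 x2 y1 y2 = RtoC 0.
Proof.
  intros Lx Ly Hc Hf.
  destruct (Ccont_bounded f z) as (d & Hd & B); [apply Hc; unfold in_rect; lra|].
  set (M := Cmod (f z) + 1) in *. assert (HM : 0 < M) by (unfold M; generalize (Cmod_ge_0 (f z)); lra).
  assert (K : forall e, 0 < e -> e < d / 4 -> e < Re z - x1 -> e < x2 - Re z -> e < Im z - y1 ->
    e < y2 - Im z -> Cmod (rint f x1 x2 y1 y2) <= 16 * M * e).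
  { intros e He E0 E1 E2 E3 E4.
    rewrite (rint_split_v f x1 (Re z - e) x2) by (try assumption; lra).
    rewrite (rint_split_v f (Re z - e) (Re z + e) x2)
      by (try lra; intros w Hw; apply Hc; unfold in_rect in *; lra).
    rewrite (rint_split_h f (Re z - e) (Re z + e) y1 (Im z - e) y2)
      by (try lra; intros w Hw; apply Hc; unfold in_rect in *; lra).
    rewrite (rint_split_h f (Re z - e) (Re z + e) (Im z - e) (Im z + e) y2)
      by (try lra; intros w Hw; apply Hc; unfold in_rect in *; lra).
    rewrite (goursat f x1 (Re z - e) y1 y2), (goursat f (Re z + e) x2 y1 y2),
      (goursat f (Re z - e) (Re z + e) y1 (Im z - e)), (goursat f (Re z - e) (Re z + e) (Im z + e) y2);
      try lra; try (intros w Hw; apply Hf;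
        [unfold in_rect in *; lra | intro Ew; rewrite Ew in Hw; unfold in_rect in Hw; lra]).
    replace (0 + (0 + (rint f (Re z - e) (Re z + e) (Im z - e) (Im z + e) + 0) + 0))%C
      with (rint f (Re z - e) (Re z + e) (Im z - e) (Im z + e)) by ring.
    eapply Rle_trans; [apply rint_bound with (M := M); try lra|].
    - intros w [Hw _]. apply Hc. unfold in_rect in *. lra.
    - intros w [Hw _]. apply B.
      assert (in_rect (Re z - e) (Re z + e) (Im z - e) (Im z + e) z) by (unfold in_rect; lra).
      assert (Q := Cmod_in_rect _ _ _ _ _ _ H Hw). lra.
    - right. ring. }
  destruct (Ceq_dec (rint f x1 x2 y1 y2) 0) as [E|N]; [exact E|].
  apply Cmod_gt_0 in N. exfalso. set (c := Cmod (rint f x1 x2 y1 y2)) in *.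
  set (e := Rmin (c / (32 * M)) (Rmin (d / 8) (Rmin ((Re z - x1) / 2) (Rmin ((x2 - Re z) / 2)
    (Rmin ((Im z - y1) / 2) ((y2 - Im z) / 2)))))).
  assert (He : 0 < e).
  { unfold e. repeat apply Rmin_pos; try lra. apply Rdiv_lt_0_compat; lra. }
  assert (e <= c / (32 * M) /\ e <= d / 8 /\ e <= (Re z - x1) / 2 /\ e <= (x2 - Re z) / 2 /\
    e <= (Im z - y1) / 2 /\ e <= (y2 - Im z) / 2) as (G1 & G2 & G3 & G4 & G5 & G6).
  { unfold e. repeat split;
    repeat (first [apply Rmin_l | apply Rmin_r | eapply Rle_trans; [apply Rmin_r|]]). }
  specialize (K e He ltac:(lra) ltac:(lra) ltac:(lra) ltac:(lra) ltac:(lra)).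
  assert (16 * M * e <= c / 2).
  { apply Rmult_le_compat_l with (r := 16 * M) in G1; [|lra].
    replace (16 * M * (c / (32 * M))) with (c / 2) in G1 by (field; lra). exact G1. }
  lra.
Qed.

Lemma atan_complement (a b : R) : 0 < a -> 0 < b -> atan (a / b) + atan (b / a) = PI / 2.
Proof.
  intros Ha Hb. replace (a / b) with (/ (b / a)) by (field; lra).
  rewrite atan_inv; [ring | now apply Rdiv_lt_0_compat].
Qed.

(** A primitive for each side separately avoids a logarithm that would have to wind around z: along
    a horizontal side Im (w - z) is a nonzero constant, so up to a constant the argument is minus
    the arctangent of Re (w - z) / Im (w - z). *)
Lemma CI_inv_horizontal (z : C) (y a b : R) : a <= b -> y <> Im z ->
  CI (fun t => / ((t, y) - z))%C a b =
  (ln ((b - Re z) ^ 2 + (y - Im z) ^ 2) / 2 - ln ((a - Re z) ^ 2 + (y - Im z) ^ 2) / 2,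
   - atan ((b - Re z) / (y - Im z)) + atan ((a - Re z) / (y - Im z))).
Proof.
  intros L N.
  assert (N' : y - Im z <> 0) by lra.
  assert (Q : forall t, 0 < (t - Re z) ^ 2 + (y - Im z) ^ 2).
  { intro t. generalize (pow2_ge_0 (t - Re z)) (pow2_gt_0 _ N'). lra. }
  rewrite (CI_ftc (fun t => (ln ((t - Re z) ^ 2 + (y - Im z) ^ 2) / 2, - atan ((t - Re z) / (y - Im z)))) ).
  - apply Ceq; simpl; ring.
  - exact L.
  - intros t Ht. apply (pcont_horizontal (fun w => / (w - z))%C). apply Ccont_inv.
    + apply Ccont_minus; [apply Ccont_id | apply Ccont_const].
    + intro E. apply (f_equal Im) in E. unfold Im in *. simpl in E. lra.
  - intros t Ht. assert (Qt := Q t). split.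
    + unfold Re, Im in *. simpl in *. auto_derive; [lra | field; lra].
    + unfold Re, Im in *. simpl in *. auto_derive; [exact I | field; repeat split; lra].
Qed.

Lemma CI_inv_vertical (z : C) (x a b : R) : a <= b -> x <> Re z ->
  (Ci * CI (fun t => / ((x, t) - z)) a b)%C =
  (ln ((x - Re z) ^ 2 + (b - Im z) ^ 2) / 2 - ln ((x - Re z) ^ 2 + (a - Im z) ^ 2) / 2,
   atan ((b - Im z) / (x - Re z)) - atan ((a - Im z) / (x - Re z))).
Proof.
  intros L N.
  assert (N' : x - Re z <> 0) by lra.
  assert (Q : forall t, 0 < (x - Re z) ^ 2 + (t - Im z) ^ 2).
  { intro t. generalize (pow2_ge_0 (t - Im z)) (pow2_gt_0 _ N'). lra. }
  assert (Cc : forall t, Ccont (fun w => / (w - z))%C (x, t)).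
  { intro t. apply Ccont_inv.
    + apply Ccont_minus; [apply Ccont_id | apply Ccont_const].
    + intro E. apply (f_equal Re) in E. unfold Re in *. simpl in E. lra. }
  rewrite <- CI_scal; [|exact L | intros; apply (pcont_vertical (fun w => / (w - z))%C); apply Cc].
  rewrite (CI_ftc (fun t => (ln ((x - Re z) ^ 2 + (t - Im z) ^ 2) / 2, atan ((t - Im z) / (x - Re z)))) ).
  - apply Ceq; simpl; ring.
  - exact L.
  - intros t Ht. apply (pcont_vertical (fun w => Ci * / (w - z))%C).
    apply Ccont_mult; [apply Ccont_const | apply Cc].
  - intros t Ht. assert (Qt := Q t). split.
    + unfold Re, Im in *. simpl in *. auto_derive; [lra | field; lra].
    + unfold Re, Im in *. simpl in *. auto_derive; [exact I | field; repeat split; lra].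
Qed.

(** The logarithms cancel around the boundary. The eight arctangents pair up at the four corners,
    each pair being atan(a/b) + atan(b/a) = pi/2. *)
Lemma rint_inv (z : C) (x1 x2 y1 y2 : R) : x1 < Re z < x2 -> y1 < Im z < y2 ->
  rint (fun w => / (w - z))%C x1 x2 y1 y2 = (0, 2 * PI).
Proof.
  intros Lx Ly. unfold rint.
  rewrite !CI_inv_horizontal, !CI_inv_vertical by lra.
  apply Ceq; simpl; [ring|].
  replace ((x2 - Re z) / (y1 - Im z)) with (- ((x2 - Re z) / (Im z - y1))) by (field; lra).
  replace ((x1 - Re z) / (y1 - Im z)) with ((Re z - x1) / (Im z - y1)) by (field; lra).
  replace ((x1 - Re z) / (y2 - Im z)) with (- ((Re z - x1) / (y2 - Im z))) by (field; lra).
  replace ((y1 - Im z) / (x2 - Re z)) with (- ((Im z - y1) / (x2 - Re z))) by (field; lra).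
  replace ((y2 - Im z) / (x1 - Re z)) with (- ((y2 - Im z) / (Re z - x1))) by (field; lra).
  replace ((y1 - Im z) / (x1 - Re z)) with ((Im z - y1) / (Re z - x1)) by (field; lra).
  rewrite !atan_opp.
  generalize (atan_complement (x2 - Re z) (Im z - y1)) (atan_complement (Re z - x1) (Im z - y1))
    (atan_complement (x2 - Re z) (y2 - Im z)) (atan_complement (Re z - x1) (y2 - Im z)).
  intros A1 A2 A3 A4. specialize (A1 ltac:(lra) ltac:(lra)). specialize (A2 ltac:(lra) ltac:(lra)).
  specialize (A3 ltac:(lra) ltac:(lra)). specialize (A4 ltac:(lra) ltac:(lra)). lra.
Qed.

Lemma on_bd_neq (x1 x2 y1 y2 : R) (z w : C) : x1 < Re z < x2 -> y1 < Im z < y2 ->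
  on_bd x1 x2 y1 y2 w -> (w - z)%C <> RtoC 0.
Proof.
  intros Lx Ly [_ H] E. assert (w = z) by (now apply Ceq_minus). subst w. lra.
Qed.

(** With f(w) = f(z) + p(w) (w - z), the integrand is p(w) + f(z) / (w - z). Here p is
    differentiable off z and continuous at z, which is exactly what [goursat_punctured] accepts. *)
Lemma cauchy_formula (f : C -> C) (z : C) (x1 x2 y1 y2 : R) :
  x1 < Re z < x2 -> y1 < Im z < y2 ->
  (forall w, in_rect x1 x2 y1 y2 w -> exists l, Cder f w l) ->
  rint (fun w => f w * / (w - z))%C x1 x2 y1 y2 = ((0, (2 * PI)%R) * f z)%C.
Proof.
  intros Lx Ly Hf.
  destruct (Hf z) as [l Hl]; [unfold in_rect; lra|].
  destruct (Cder_elim f z l Hl) as (p & Hp & Ep & E).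
  assert (Dp : forall w, in_rect x1 x2 y1 y2 w -> w <> z -> exists m, Cder p w m).
  { intros w Hw N. destruct (Hf w Hw) as [m Hm].
    assert (N' : (w - z)%C <> RtoC 0) by (intro Q; apply N, Ceq_minus, Q).
    eexists. apply (Cder_ext (fun u => (f u - f z) / (u - z))%C _ w _ (Cmod (w - z))).
    - now apply Cmod_gt_0.
    - intros u Hu. rewrite (E u). field. intro Q. apply Ceq_minus in Q. subst u.
      rewrite Cmod_minus_sym in Hu. lra.
    - apply Cder_div; [apply Cder_minus; [exact Hm | apply Cder_const] |
        apply Cder_minus; [apply Cder_id | apply Cder_const] | exact N']. }
  assert (Cp : forall w, in_rect x1 x2 y1 y2 w -> Ccont p w).
  { intros w Hw. destruct (Ceq_dec w z) as [->|N]; [exact Hp|].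
    destruct (Dp w Hw N) as [m Hm]. eapply Cder_Ccont, Hm. }
  assert (Ci' : forall w, on_bd x1 x2 y1 y2 w -> Ccont (fun u => / (u - z))%C w).
  { intros w Hw. apply Ccont_inv; [apply Ccont_minus; [apply Ccont_id | apply Ccont_const]|].
    eapply on_bd_neq; eauto. }
  rewrite (rint_ext _ (fun w => p w + f z * / (w - z))%C); try lra.
  - rewrite rint_plus, rint_scal, rint_inv, (goursat_punctured p z); try lra; try assumption; [ring | |].
    + intros w [Hw _]. now apply Cp.
    + intros w Hw. apply Ccont_mult; [apply Ccont_const | now apply Ci'].
  - intros w Hw. rewrite (E w) at 1. field. eapply on_bd_neq; eauto.
Qed.

(** * Sequences of complex numbers *)

Definition Clim (u : nat -> C) (l : C) : Prop :=
  forall eps, 0 < eps -> exists n0, forall n, (n0 <= n)%nat -> Cmod (u n - l) < eps.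

Lemma Clim_is_lim_seq (u : nat -> C) (l : C) : Clim u l <->
  is_lim_seq (fun n => Re (u n)) (Re l) /\ is_lim_seq (fun n => Im (u n)) (Im l).
Proof.
  split.
  - intro H. split; apply is_lim_seq_spec; intros e; destruct (H e (cond_pos e)) as [n0 B];
      exists n0; intros n Hn; (eapply Rle_lt_trans; [|apply (B n Hn)]).
    + apply (re_le_Cmod (u n - l)).
    + apply (im_le_Cmod (u n - l)).
  - intros [H1 H2] e He. apply is_lim_seq_spec in H1. apply is_lim_seq_spec in H2.
    assert (P : 0 < e / 2) by lra.
    destruct (H1 (mkposreal _ P)) as [n1 B1], (H2 (mkposreal _ P)) as [n2 B2].
    exists (max n1 n2). intros n Hn. simpl in B1, B2.
    specialize (B1 n ltac:(lia)). specialize (B2 n ltac:(lia)).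
    eapply Rle_lt_trans; [apply Cmod_le_ReIm|].
    change (Re (u n - l)) with (Re (u n) - Re l). change (Im (u n - l)) with (Im (u n) - Im l). lra.
Qed.

Lemma Clim_Cmod (u : nat -> C) (l : C) : Clim u l <-> is_lim_seq (fun n => Cmod (u n - l)) 0.
Proof.
  split.
  - intro H. apply is_lim_seq_spec. intros e. destruct (H e (cond_pos e)) as [n0 B].
    exists n0. intros n Hn. rewrite Rminus_0_r, Rabs_pos_eq by apply Cmod_ge_0. now apply B.
  - intros H e He. apply is_lim_seq_spec in H. destruct (H (mkposreal e He)) as [n0 B].
    exists n0. intros n Hn. specialize (B n Hn). simpl in B.
    rewrite Rminus_0_r, Rabs_pos_eq in B by apply Cmod_ge_0. exact B.
Qed.

Lemma Clim_unique (u : nat -> C) (l m : C) : Clim u l -> Clim u m -> l = m.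
Proof.
  intros H1 H2. apply Clim_is_lim_seq in H1, H2. destruct H1 as [A1 B1], H2 as [A2 B2].
  apply is_lim_seq_unique in A1, A2, B1, B2.
  apply Ceq.
  - assert (E : Finite (Re l) = Finite (Re m)) by congruence. now injection E.
  - assert (E : Finite (Im l) = Finite (Im m)) by congruence. now injection E.
Qed.

Lemma Clim_const (c : C) : Clim (fun _ => c) c.
Proof.
  intros e He. exists 0%nat. intros. replace (c - c)%C with (RtoC 0) by ring. now rewrite Cmod_0.
Qed.

Lemma Clim_ext_loc (u v : nat -> C) (l : C) (n0 : nat) :
  (forall n, (n0 <= n)%nat -> u n = v n) -> Clim u l -> Clim v l.
Proof.
  intros E H e He. destruct (H e He) as [n1 B]. exists (max n0 n1). intros n Hn.
  rewrite <- E by lia. apply B. lia.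
Qed.

Lemma Clim_ext (u v : nat -> C) (l : C) : (forall n, u n = v n) -> Clim u l -> Clim v l.
Proof. intro E. apply (Clim_ext_loc u v l 0). auto. Qed.

Lemma Clim_subseq (u : nat -> C) (l : C) (phi : nat -> nat) :
  (forall n, (n <= phi n)%nat) -> Clim u l -> Clim (fun n => u (phi n)) l.
Proof.
  intros P H e He. destruct (H e He) as [n0 B]. exists n0. intros n Hn. apply B.
  generalize (P n). lia.
Qed.

Lemma Clim_shift (u : nat -> C) (l : C) : Clim (fun n => u (S n)) l -> Clim u l.
Proof.
  intros H e He. destruct (H e He) as [n0 B]. exists (S n0). intros n Hn.
  destruct n as [|n]; [lia|]. apply B. lia.
Qed.

Lemma Clim_Ccont (f : C -> C) (u : nat -> C) (l : C) : Ccont f l -> Clim u l ->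
  Clim (fun n => f (u n)) (f l).
Proof.
  intros Hf H e He. destruct (Hf e He) as (d & Hd & B). destruct (H d Hd) as [n0 B'].
  exists n0. intros n Hn. now apply B, B'.
Qed.

Lemma Clim_plus (u v : nat -> C) (l m : C) : Clim u l -> Clim v m ->
  Clim (fun n => u n + v n)%C (l + m).
Proof.
  intros H1 H2. apply Clim_is_lim_seq in H1, H2. apply Clim_is_lim_seq.
  split; apply is_lim_seq_plus'; tauto.
Qed.

Lemma Clim_mult (u v : nat -> C) (l m : C) : Clim u l -> Clim v m ->
  Clim (fun n => u n * v n)%C (l * m).
Proof.
  intros H1 H2. apply Clim_is_lim_seq in H1, H2. apply Clim_is_lim_seq.
  destruct H1 as [A1 B1], H2 as [A2 B2]. split.
  - apply (is_lim_seq_minus' (fun n => Re (u n) * Re (v n)) (fun n => Im (u n) * Im (v n)));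
      now apply is_lim_seq_mult'.
  - apply (is_lim_seq_plus' (fun n => Re (u n) * Im (v n)) (fun n => Im (u n) * Re (v n)));
      now apply is_lim_seq_mult'.
Qed.

Lemma Clim_scal (c : C) (u : nat -> C) (l : C) : Clim u l -> Clim (fun n => c * u n)%C (c * l).
Proof. intro H. apply Clim_mult; [apply Clim_const | exact H]. Qed.

Lemma Clim_opp (u : nat -> C) (l : C) : Clim u l -> Clim (fun n => - u n)%C (- l).
Proof. apply Clim_Ccont, Ccont_opp, Ccont_id. Qed.

Lemma Clim_minus (u v : nat -> C) (l m : C) : Clim u l -> Clim v m ->
  Clim (fun n => u n - v n)%C (l - m).
Proof. intros. apply Clim_plus; [assumption | now apply Clim_opp]. Qed.

Lemma Clim_inv (u : nat -> C) (l : C) : l <> RtoC 0 -> Clim u l -> Clim (fun n => / u n)%C (/ l).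
Proof. intro N. apply (Clim_Ccont (fun z => / z)%C), Ccont_inv; [apply Ccont_id | exact N]. Qed.

Lemma Clim_RtoC (u : nat -> R) (l : R) : is_lim_seq u l -> Clim (fun n => RtoC (u n)) (RtoC l).
Proof.
  intro H. apply Clim_is_lim_seq. split; [exact H | apply is_lim_seq_const].
Qed.

Lemma Clim_le (u : nat -> C) (l : C) (M : R) : Clim u l -> (forall n, Cmod (u n) <= M) -> Cmod l <= M.
Proof.
  intros H B. apply Rnot_lt_le. intro L. destruct (H (Cmod l - M)) as [n0 B']; [lra|].
  specialize (B' n0 (le_n n0)). specialize (B n0). rewrite Cmod_minus_sym in B'.
  generalize (Cmod_triangle_rev l (u n0)). lra.
Qed.

Lemma Clim_cauchy (u : nat -> C) :
  (forall e, 0 < e -> exists n0, forall n m, (n0 <= n)%nat -> (n0 <= m)%nat -> Cmod (u n - u m) < e) ->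
  exists l, Clim u l.
Proof.
  intro H.
  destruct (Rcomplete.R_complete (fun n => Re (u n))) as [a Ha].
  { intros e He. destruct (H e He) as [n0 B]. exists n0. intros n m Hn Hm.
    eapply Rle_lt_trans; [|apply (B n m Hn Hm)]. apply (re_le_Cmod (u n - u m)). }
  destruct (Rcomplete.R_complete (fun n => Im (u n))) as [b Hb].
  { intros e He. destruct (H e He) as [n0 B]. exists n0. intros n m Hn Hm.
    eapply Rle_lt_trans; [|apply (B n m Hn Hm)]. apply (im_le_Cmod (u n - u m)). }
  exists (a, b). apply Clim_is_lim_seq. split; apply is_lim_seq_Reals; assumption.
Qed.

(** * Consequences of Cauchy's formula *)

Lemma Cmod_2PI_imag : Cmod (0, 2 * PI) = 2 * PI.
Proof.
  replace (0, 2 * PI) with (Ci * RtoC (2 * PI))%C by (apply Ceq; simpl; ring).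
  rewrite Cmod_mult, Cmod_Ci, Cmod_R, Rabs_pos_eq; generalize PI_RGT_0; lra.
Qed.

(** The kernel identity 1/(w-z) - 1/(w-c) - (z-c)/(w-c)^2 = (z-c)^2 / ((w-z)(w-c)^2) is integrated
    against f over the square of half-side p = r/2. The point is that the constant depends on M and
    r only, so it is uniform over a family of functions. The 128 comes from 4 (M (2/p) p^(-2)) (4 p)
    = 32 M / p^2; the factor 1/(2 pi) is estimated by 1. *)
Lemma cauchy_second_order (f : C -> C) (c : C) (r M : R) : 0 < r ->
  (forall w, Cmod (w - c) < r -> exists l, Cder f w l) ->
  (forall w, Cmod (w - c) < r -> Cmod (f w) <= M) ->
  exists A, forall z, Cmod (z - c) < r / 4 ->
    Cmod (f z - f c - A * (z - c)) <= 128 * M / (r * r) * (Cmod (z - c) * Cmod (z - c)).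
Proof.
  intros Hr Hf HM. set (p := r / 2).
  set (x1 := Re c - p). set (x2 := Re c + p). set (y1 := Im c - p). set (y2 := Im c + p).
  assert (Hp : 0 < p) by (unfold p; lra).
  assert (In : forall w, in_rect x1 x2 y1 y2 w -> Cmod (w - c) < r).
  { intros w [H1 H2]. apply Rsqr_incrst_0; [|apply Cmod_ge_0 | lra]. unfold Rsqr.
    rewrite Cmod_sqr. change (Re (w - c)) with (Re w - Re c). change (Im (w - c)) with (Im w - Im c).
    unfold x1, x2, y1, y2 in *.
    assert ((Re w - Re c) * (Re w - Re c) <= p * p) by nra.
    assert ((Im w - Im c) * (Im w - Im c) <= p * p) by nra.
    unfold p in *. nra. }
  assert (Bd : forall w, on_bd x1 x2 y1 y2 w -> p <= Cmod (w - c)).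
  { intros w [_ H]. generalize (re_le_Cmod (w - c)) (im_le_Cmod (w - c)).
    change (Re (w - c)) with (Re w - Re c). change (Im (w - c)) with (Im w - Im c).
    unfold x1, x2, y1, y2 in *. intros R1 R2. apply Rabs_le_between in R1, R2.
    destruct H as [H|[H|[H|H]]]; lra. }
  assert (HfR : forall w, in_rect x1 x2 y1 y2 w -> exists l, Cder f w l)
    by (intros w Hw; apply Hf, In, Hw).
  assert (Fc : forall w, on_bd x1 x2 y1 y2 w -> Ccont f w).
  { intros w [Hw _]. destruct (HfR w Hw) as [l Hl]. eapply Cder_Ccont, Hl. }
  assert (Ic : forall z, Cmod (z - c) < p -> forall w, on_bd x1 x2 y1 y2 w ->
    Ccont (fun u => / (u - z))%C w /\ (w - z)%C <> RtoC 0).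
  { intros z Hz w Hw.
    assert ((w - z)%C <> RtoC 0).
    { intro E. apply Ceq_minus in E. subst w. specialize (Bd z Hw). lra. }
    split; [|assumption]. apply Ccont_inv; [apply Ccont_minus; [apply Ccont_id | apply Ccont_const]|].
    assumption. }
  assert (C0 : Cmod (c - c) = 0) by (replace (c - c)%C with (RtoC 0) by ring; apply Cmod_0).
  assert (HM0 : 0 <= M).
  { eapply Rle_trans; [apply Cmod_ge_0|]. apply (HM c). lra. }
  assert (P0 := PI_RGT_0).
  assert (N2 : (0, 2 * PI) <> RtoC 0).
  { intro E. apply (f_equal Im) in E. simpl in E. lra. }
  set (A0 := rint (fun w => f w * (/ (w - c) * / (w - c)))%C x1 x2 y1 y2).
  exists (A0 / (0, (2 * PI)%R))%C. intros z Hz.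
  assert (Hzp : Cmod (z - c) < p) by (unfold p; lra).
  assert (Rz : x1 < Re z < x2 /\ y1 < Im z < y2).
  { generalize (re_le_Cmod (z - c)) (im_le_Cmod (z - c)).
    change (Re (z - c)) with (Re z - Re c). change (Im (z - c)) with (Im z - Im c).
    intros R1 R2. apply Rabs_le_between in R1, R2. unfold x1, x2, y1, y2. lra. }
  set (D := (f z - f c - A0 / (0, (2 * PI)%R) * (z - c))%C).
  assert (E : ((0, (2 * PI)%R) * D)%C =
    rint (fun w => (z - c) * (z - c) * (f w * (/ (w - z) * (/ (w - c) * / (w - c)))))%C x1 x2 y1 y2).
  { replace ((0, (2 * PI)%R) * D)%C with
      ((0, (2 * PI)%R) * f z - (0, (2 * PI)%R) * f c - (z - c) * A0)%C by (unfold D; field; exact N2).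
    rewrite <- (cauchy_formula f z x1 x2 y1 y2), <- (cauchy_formula f c x1 x2 y1 y2);
      try tauto; try (unfold x1, x2, y1, y2; lra).
    assert (G : forall u, Cmod (u - c) < p -> forall w, on_bd x1 x2 y1 y2 w -> Ccont (fun w => f w * / (w - u))%C w).
    { intros u Hu w Hw. apply Ccont_mult; [now apply Fc | now apply Ic]. }
    assert (G2 : forall w, on_bd x1 x2 y1 y2 w -> Ccont (fun w => f w * (/ (w - c) * / (w - c)))%C w).
    { intros w Hw. apply Ccont_mult; [now apply Fc | apply Ccont_mult; apply Ic; trivial; lra]. }
    unfold A0. rewrite <- rint_scal; try assumption; try (unfold x1, x2, y1, y2; lra).
    rewrite <- rint_minus; try (unfold x1, x2, y1, y2; lra); try (apply G; lra).
    rewrite <- rint_minus; try (unfold x1, x2, y1, y2; lra).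
    - apply rint_ext; try (unfold x1, x2, y1, y2; lra). intros w Hw.
      assert ((w - z)%C <> RtoC 0) by (now apply Ic).
      assert ((w - c)%C <> RtoC 0) by (apply Ic; trivial; lra).
      field. split; assumption.
    - intros w Hw. apply Ccont_minus; apply G; trivial; lra.
    - intros w Hw. apply Ccont_mult; [apply Ccont_const | now apply G2]. }
  assert (B : Cmod ((0, (2 * PI)%R) * D) <= 4 * (Cmod (z - c) * Cmod (z - c) * (M * (2 / p * (/ p * / p)))) * (2
    * p + 2 * p)).
  { rewrite E. replace (2 * p + 2 * p) with ((x2 - x1) + (y2 - y1)) by (unfold x1, x2, y1, y2; ring).
    apply rint_bound; try (unfold x1, x2, y1, y2; lra).
    - intros w Hw. apply Ccont_mult; [apply Ccont_const|]. apply Ccont_mult; [now apply Fc|].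
      apply Ccont_mult; [now apply Ic|]. apply Ccont_mult; apply Ic; trivial; lra.
    - intros w Hw. rewrite !Cmod_mult, !Cmod_inv by (apply Ic; trivial; lra).
      apply Rmult_le_compat_l; [apply Rmult_le_pos; apply Cmod_ge_0|].
      assert (Q := Bd w Hw).
      assert (Q2 : p / 2 <= Cmod (w - z)).
      { generalize (Cmod_triangle_rev (w - c) (z - c)).
        replace (w - c - (z - c))%C with (w - z)%C by ring. unfold p in *. lra. }
      assert (I1 : 0 < / Cmod (w - c) <= / p).
      { split; [apply Rinv_0_lt_compat; lra | apply Rinv_le_contravar; lra]. }
      assert (I2 : 0 < / Cmod (w - z) <= 2 / p).
      { split; [apply Rinv_0_lt_compat; lra|]. replace (2 / p) with (/ (p / 2)) by (field; lra).
        apply Rinv_le_contravar; lra. }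
      apply Rmult_le_compat; [apply Cmod_ge_0 | nra | destruct Hw; now apply HM, In|].
      apply Rmult_le_compat; [lra | nra | lra|]. nra. }
  rewrite Cmod_mult, Cmod_2PI_imag in B.
  replace (4 * (Cmod (z - c) * Cmod (z - c) * (M * (2 / p * (/ p * / p)))) * (2 * p + 2 * p))
    with (128 * M / (r * r) * (Cmod (z - c) * Cmod (z - c))) in B by (unfold p; field; lra).
  assert (1 <= 2 * PI) by (generalize PI2_1; lra).
  generalize (Cmod_ge_0 D). nra.
Qed.

(** The second-order bound is the same for all n, so A n differs from the difference quotient of F n
    with step h by at most K h. Pointwise convergence at c and c + h then makes A a Cauchy sequence,
    and the bound passes to the limit function. *)
Lemma vitali (F : nat -> C -> C) (f : C -> C) (c : C) (r M : R) : 0 < r ->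
  (forall n w, Cmod (w - c) < r -> exists l, Cder (F n) w l) ->
  (forall n w, Cmod (w - c) < r -> Cmod (F n w) <= M) ->
  (forall w, Cmod (w - c) < r -> Clim (fun n => F n w) (f w)) ->
  exists l, Cder f c l /\ forall F', (forall n, Cder (F n) c (F' n)) -> Clim F' l.
Proof.
  intros Hr HF HM Hl.
  assert (C0 : Cmod (c - c) = 0) by (replace (c - c)%C with (RtoC 0) by ring; apply Cmod_0).
  set (K := 128 * M / (r * r)).
  assert (HM0 : 0 <= M) by (eapply Rle_trans; [apply Cmod_ge_0 | apply (HM 0%nat c); lra]).
  assert (HK : 0 <= K).
  { unfold K, Rdiv. apply Rmult_le_pos; [lra|]. left. apply Rinv_0_lt_compat. nra. }
  set (A := fun n => proj1_sig (constructive_indefinite_description _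
    (cauchy_second_order (F n) c r M Hr (HF n) (HM n)))).
  assert (HA : forall n z, Cmod (z - c) < r / 4 ->
    Cmod (F n z - F n c - A n * (z - c)) <= K * (Cmod (z - c) * Cmod (z - c))).
  { intro n. exact (proj2_sig (constructive_indefinite_description _
      (cauchy_second_order (F n) c r M Hr (HF n) (HM n)))). }
  clearbody A.
  (* A quadratic error determines the derivative. This serves twice: for the limit function, and to
     identify A n with a given derivative of F n. *)
  assert (Quad : forall (g : C -> C) L, (forall z, Cmod (z - c) < r / 4 ->
    Cmod (g z - g c - L * (z - c)) <= K * (Cmod (z - c) * Cmod (z - c))) -> Cder g c L).
  { intros g L H e He. exists (Rmin (r / 4) (e / (K + 1))).
    split; [apply Rmin_pos; [lra | apply Rdiv_lt_0_compat; lra]|]. intros z Hz.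
    eapply Rle_trans; [apply H; eapply Rlt_le_trans; [exact Hz | apply Rmin_l]|].
    rewrite <- Rmult_assoc. apply Rmult_le_compat_r; [apply Cmod_ge_0|].
    assert (Hz2 : Cmod (z - c) <= e / (K + 1)) by (left; eapply Rlt_le_trans; [exact Hz | apply Rmin_r]).
    apply Rmult_le_compat_l with (r := K + 1) in Hz2; [|lra].
    replace ((K + 1) * (e / (K + 1))) with e in Hz2 by (field; lra).
    generalize (Cmod_ge_0 (z - c)). nra. }
  destruct (Clim_cauchy A) as [L HL].
  (* With this h the two second-order errors K h^2 and the four convergence errors are each at most
     e h / 8, which is six eighths of the allowance e h. *)
  { intros e He. set (h := Rmin (r / 8) (e / (8 * (K + 1)))).
    assert (Hh : 0 < h) by (unfold h; apply Rmin_pos; [lra | apply Rdiv_lt_0_compat; lra]).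
    assert (Hh1 : h <= r / 8) by apply Rmin_l.
    assert (Hh2 : 8 * K * h <= e).
    { assert (X : h <= e / (8 * (K + 1))) by apply Rmin_r.
      apply Rmult_le_compat_l with (r := 8 * (K + 1)) in X; [|lra].
      replace (8 * (K + 1) * (e / (8 * (K + 1)))) with e in X by (field; lra). lra. }
    set (z := (c + RtoC h)%C).
    assert (Ez : (z - c)%C = RtoC h) by (unfold z; ring).
    assert (Mz : Cmod (z - c) = h) by (rewrite Ez, Cmod_R; apply Rabs_pos_eq; lra).
    assert (Ph : 0 < e * h / 8) by nra.
    destruct (Hl z ltac:(lra) _ Ph) as [n1 B1]. destruct (Hl c ltac:(lra) _ Ph) as [n2 B2].
    exists (max n1 n2). intros n m Hn Hm.
    assert (X : Cmod ((A n - A m) * RtoC h) < e * h).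
    { replace ((A n - A m) * RtoC h)%C with
        ((F m z - F m c - A m * (z - c)) - (F n z - F n c - A n * (z - c))
         + ((F n z - f z) - (F m z - f z)) - ((F n c - f c) - (F m c - f c)))%C
        by (rewrite Ez; ring).
      eapply Rle_lt_trans; [apply Cmod_triangle_minus|].
      eapply Rle_lt_trans; [apply Rplus_le_compat_r, Cmod_triangle|].
      eapply Rle_lt_trans; [apply Rplus_le_compat;
        [apply Rplus_le_compat; apply Cmod_triangle_minus | apply Cmod_triangle_minus]|].
      generalize (HA n z ltac:(lra)) (HA m z ltac:(lra)) (B1 n ltac:(lia)) (B1 m ltac:(lia))
        (B2 n ltac:(lia)) (B2 m ltac:(lia)). rewrite Mz. nra. }
    rewrite Cmod_mult, Cmod_R, Rabs_pos_eq in X by lra. nra. }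
  exists L. split.
  - apply Quad. intros z Hz. apply (Clim_le (fun n => F n z - F n c - A n * (z - c))%C).
    + apply Clim_minus; [apply Clim_minus; apply Hl; lra|].
      apply Clim_mult; [exact HL | apply Clim_const].
    + intro n. now apply HA.
  - intros F' HF'. apply (Clim_ext A); [|exact HL]. intro n.
    apply (Cder_unique (F n) c); [|apply HF']. apply Quad, HA.
Qed.

(* Cauchy's formula for [H w / (w - b) ^ n] at the centre of a square of half-side 1: the part of the
   boundary where [H] does not vanish is farther from [b] than the centre, so [n -> oo] gives [H c = 0]. *)
Lemma strip_step (H : C -> C) (A : R) : (forall w, exists l, Cder H w l) -> 5 / 4 <= A ->
  (forall w, - A < Im w < A -> H w = RtoC 0) ->
  forall c, A <= Im c < A + / 8 -> H c = RtoC 0.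
Proof.
  intros HH HA H0 c Hc.
  set (x1 := Re c - 1). set (x2 := Re c + 1). set (y1 := Im c - 1). set (y2 := Im c + 1).
  set (b := (c - RtoC 2 * Ci)%C).
  assert (Rb : Re b = Re c) by (unfold b, Re; simpl; ring).
  assert (Ib : Im b = Im c - 2) by (unfold b, Im; simpl; ring).
  assert (Hcont : forall w, Ccont H w).
  { intro w. destruct (HH w) as [l Hl]. eapply Cder_Ccont, Hl. }
  (* Boundedness on the closed square, by bisection in place of a compactness theorem. *)
  assert (BM : exists M, forall w, in_rect x1 x2 y1 y2 w -> Cmod (H w) <= M).
  { apply (rect_bisection (fun a b c d => exists M, forall w, in_rect a b c d w -> Cmod (H w) <= M));
      try (unfold x1, x2, y1, y2; lra).
    - intros a' b' c' d' _ _ _ _ _ _ [M1 H1] [M2 H2] [M3 H3] [M4 H4].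
      exists (Rmax (Rmax M1 M2) (Rmax M3 M4)). intros w Hw.
      generalize (Rmax_l (Rmax M1 M2) (Rmax M3 M4)) (Rmax_r (Rmax M1 M2) (Rmax M3 M4))
        (Rmax_l M1 M2) (Rmax_r M1 M2) (Rmax_l M3 M4) (Rmax_r M3 M4). intros.
      specialize (H1 w). specialize (H2 w). specialize (H3 w). specialize (H4 w).
      unfold in_rect in *.
      destruct (Rle_dec (Re w) ((a' + b') / 2)), (Rle_dec (Im w) ((c' + d') / 2)).
      + specialize (H1 ltac:(lra)). lra.
      + specialize (H3 ltac:(lra)). lra.
      + specialize (H2 ltac:(lra)). lra.
      + specialize (H4 ltac:(lra)). lra.
    - intros z _. destruct (Ccont_bounded H z (Hcont z)) as (d & Hd & B).
      exists (d / 2). split; [lra|]. intros a' b' c' d' _ _ _ _ Hz L1 L2.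
      exists (Cmod (H z) + 1). intros w Hw. apply B.
      generalize (Cmod_in_rect _ _ _ _ _ _ Hz Hw). lra. }
  destruct BM as [M HM].
  assert (HM0 : 0 <= M).
  { eapply Rle_trans; [apply Cmod_ge_0 | apply (HM c)]. unfold in_rect, x1, x2, y1, y2; lra. }
  assert (Nb : forall w, in_rect x1 x2 y1 y2 w -> (w - b)%C <> RtoC 0).
  { intros w Hw E. apply Ceq_minus in E. subst w. unfold in_rect, y1 in Hw. lra. }
  assert (Cb : Cmod (c - b) = 2).
  { replace (c - b)%C with (RtoC 2 * Ci)%C by (unfold b; ring).
    rewrite Cmod_mult, Cmod_Ci, Cmod_R, Rabs_pos_eq; lra. }
  assert (Key : forall n, Cmod (H c) <= 16 * M * (16 / 17) ^ n).
  { intro n.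
    set (G := fun w => (H w * / (w - b) ^ n)%C).
    assert (HG : forall w, in_rect x1 x2 y1 y2 w -> exists l, Cder G w l).
    { intros w Hw. destruct (HH w) as [l Hl].
      destruct (Cder_pow (fun w => w - b)%C w (1 - 0) n) as [m Hm].
      { apply Cder_minus; [apply Cder_id | apply Cder_const]. }
      eexists. apply Cder_mult; [exact Hl|]. apply Cder_inv; [exact Hm|]. now apply Cpow_nz, Nb. }
    assert (E := cauchy_formula G c x1 x2 y1 y2). 
    specialize (E ltac:(unfold x1, x2; lra) ltac:(unfold y1, y2; lra) HG).
    assert (B : Cmod (rint (fun w => G w * / (w - c))%C x1 x2 y1 y2) <=
      4 * (M * (8 / 17) ^ n) * ((x2 - x1) + (y2 - y1))).
    { apply rint_bound; try (unfold x1, x2, y1, y2; lra).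
      - intros w Hw. apply Ccont_mult.
        + destruct Hw as [Hw _]. destruct (HG w Hw) as [l Hl]. eapply Cder_Ccont, Hl.
        + apply Ccont_inv; [apply Ccont_minus; [apply Ccont_id | apply Ccont_const]|].
          apply (on_bd_neq x1 x2 y1 y2); try assumption; unfold x1, x2, y1, y2; lra.
      - intros w Hw. unfold G.
        assert (P17 : 0 <= M * (8 / 17) ^ n) by (apply Rmult_le_pos; [exact HM0 | apply pow_le; lra]).
        destruct (Rlt_dec (Im w) A) as [LA|LA].
        { rewrite H0; [rewrite !Cmult_0_l, Cmod_0; exact P17|].
          destruct Hw as [[_ Hw] _]. unfold y1 in Hw. lra. }
        assert (Wc : 1 <= Cmod (w - c)).
        { destruct Hw as [_ Hw]. generalize (re_le_Cmod (w - c)) (im_le_Cmod (w - c)).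
          change (Re (w - c)) with (Re w - Re c). change (Im (w - c)) with (Im w - Im c).
          unfold x1, x2, y1, y2 in *. intros R1 R2. apply Rabs_le_between in R1, R2.
          destruct Hw as [Q|[Q|[Q|Q]]]; lra. }
        (* Where Im w >= A, the point w lies at least 15/8 above b. On a vertical side it is also 1
           away horizontally, and 1 + (15/8)^2 = (17/8)^2; on the top side the height is 3, and the
           bottom side lies below A. Against |c - b| = 2 this yields the ratio 16/17. *)
        assert (Wb : 17 / 8 <= Cmod (w - b)).
        { apply Rsqr_incr_0; [|lra | apply Cmod_ge_0]. unfold Rsqr. rewrite Cmod_sqr.
          change (Re (w - b)) with (Re w - Re b). change (Im (w - b)) with (Im w - Im b).
          rewrite Rb, Ib. destruct Hw as [_ Hw]. unfold x1, x2, y1, y2 in Hw.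
          assert (15 / 8 <= Im w - (Im c - 2)) by lra.
          assert (15 / 8 * (15 / 8) <= (Im w - (Im c - 2)) * (Im w - (Im c - 2)))
            by (apply Rmult_le_compat; lra).
          destruct Hw as [Q|[Q|[Q|Q]]].
          - replace (Re w - Re c) with (-1) by lra. lra.
          - replace (Re w - Re c) with 1 by lra. lra.
          - lra.
          - replace (Im w - (Im c - 2)) with 3 by lra. generalize (Rle_0_sqr (Re w - Re c)). unfold Rsqr. lra. }
        assert (Iw := proj1 Hw).
        rewrite !Cmod_mult, !Cmod_inv, Cmod_pow.
        + rewrite <- (Rmult_1_r (M * _)).
          assert (0 < / Cmod (w - c) <= 1).
          { split; [apply Rinv_0_lt_compat; lra|]. rewrite <- Rinv_1. apply Rinv_le_contravar; lra. }
          assert (0 < / Cmod (w - b) ^ n <= (8 / 17) ^ n).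
          { split; [apply Rinv_0_lt_compat, pow_lt; lra|].
            rewrite <- pow_inv. apply pow_incr. split; [left; apply Rinv_0_lt_compat; lra|].
            replace (8 / 17) with (/ (17 / 8)) by field. apply Rinv_le_contravar; lra. }
          apply Rmult_le_compat; try lra; [apply Rmult_le_pos; [apply Cmod_ge_0 | lra]|].
          apply Rmult_le_compat; try lra; [apply Cmod_ge_0 | now apply HM].
        + apply Cmod_gt_0. lra.
        + now apply Cpow_nz, Nb. }
    rewrite E in B. unfold G in B. rewrite !Cmod_mult, Cmod_inv, Cmod_pow, Cb in B.
    2: { apply Cpow_nz. apply Cmod_gt_0. rewrite Cb. lra. }
    rewrite Cmod_2PI_imag in B.
    replace ((x2 - x1) + (y2 - y1)) with 4 in B by (unfold x1, x2, y1, y2; ring).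
    assert (P2 : 0 < 2 ^ n) by (apply pow_lt; lra).
    replace ((16 / 17) ^ n) with (2 ^ n * (8 / 17) ^ n) by (rewrite <- Rpow_mult_distr; f_equal; field).
    apply Rmult_le_compat_r with (r := 2 ^ n) in B; [|lra].
    replace (2 * PI * (Cmod (H c) * / 2 ^ n) * 2 ^ n) with (2 * PI * Cmod (H c)) in B by (field; lra).
    assert (1 <= 2 * PI) by (generalize PI2_1; lra). generalize (Cmod_ge_0 (H c)). nra. }
  destruct (Ceq_dec (H c) 0) as [E|N]; [exact E|]. apply Cmod_gt_0 in N. exfalso.
  destruct (pow_lt_1_zero (16 / 17)) with (y := Cmod (H c) / (16 * M + 1)) as [n Hn].
  { rewrite Rabs_pos_eq; lra. }
  { apply Rdiv_lt_0_compat; lra. }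
  specialize (Hn n (le_n n)). rewrite Rabs_pos_eq in Hn by (apply pow_le; lra).
  apply Rmult_lt_compat_l with (r := 16 * M + 1) in Hn; [|lra].
  replace ((16 * M + 1) * (Cmod (H c) / (16 * M + 1))) with (Cmod (H c)) in Hn by (field; lra).
  specialize (Key n). assert (0 < (16 / 17) ^ n) by (apply pow_lt; lra). nra.
Qed.

(** Each step widens the strip by 1/8 on both sides, the lower side through w -> -w. The half-width
    5/4 is less than pi/2, so cos (Im w) > 0 on the strip and 1 + Cexp w lands in the half-plane Re
    s > 1 when this is applied to zeta. *)
Lemma entire_zero_of_strip (H : C -> C) : (forall w, exists l, Cder H w l) ->
  (forall w, - (5 / 4) < Im w < 5 / 4 -> H w = RtoC 0) -> forall w, H w = RtoC 0.
Proof.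
  intros HH H0.
  assert (G : forall n w, - (5 / 4 + INR n / 8) < Im w < 5 / 4 + INR n / 8 -> H w = RtoC 0).
  { induction n as [|n IH]; intros w Hw.
    - apply H0. simpl in Hw. lra.
    - assert (P := pos_INR n). rewrite S_INR in Hw.
      destruct (Rlt_dec (Im w) (5 / 4 + INR n / 8)) as [L|L];
      [destruct (Rlt_dec (- (5 / 4 + INR n / 8)) (Im w)) as [L'|L']|].
      + apply IH. lra.
      + replace w with (- (- w))%C by ring.
        apply (strip_step (fun u => H (- u)%C) (5 / 4 + INR n / 8)); [|lra | |simpl; unfold Im in *; lra].
        * intro u. destruct (HH (- u)%C) as [l Hl]. eexists.
          apply (Cder_comp H (fun u => - u)%C); [apply Cder_opp, Cder_id | exact Hl].
        * intros u Hu. apply IH. unfold Im in *. simpl. lra.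
      + apply (strip_step H (5 / 4 + INR n / 8)); try assumption; lra. }
  intro w. destruct (INR_unbounded (8 * Rabs (Im w))) as [n Hn].
  apply (G n). assert (Q := Rle_abs (Im w)). assert (Q' := Rle_abs (- Im w)). rewrite Rabs_Ropp in Q'. lra.
Qed.

(** * Uniqueness of the zeta function *)

(** Quarter turns, that is multiplication by [Ci] = Cexp (i pi/2), reach every nonzero z from the
    right half-plane, where [Clog_pr] inverts [Cexp]. *)
Lemma Cexp_surj (z : C) : z <> RtoC 0 -> exists w, Cexp w = z.
Proof.
  intro N.
  assert (Ei : forall u, Cexp (u + (0, (PI / 2)%R)) = (Cexp u * Ci)%C).
  { intro u. rewrite Cexp_plus. f_equal. apply Ceq; unfold Cexp, Re, Im; simpl;
      rewrite exp_0, ?cos_PI2, ?sin_PI2; ring. }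
  assert (P : forall u, 0 < Re u -> exists w, Cexp w = u).
  { intros u Hu. exists (Clog_pr u). now apply Cexp_Clog_pr. }
  assert (Q : forall u, (exists w, Cexp w = u) -> exists w, Cexp w = (u * Ci)%C).
  { intros u [w Hw]. exists (w + (0, (PI / 2)%R))%C. now rewrite Ei, Hw. }
  destruct z as [x y].
  destruct (Rtotal_order x 0) as [L|[L|L]].
  - replace (x, y) with (((- x)%R, (- y)%R) * Ci * Ci)%C by (apply Ceq; simpl; ring).
    apply Q, Q, P. simpl. lra.
  - subst x. destruct (Rtotal_order y 0) as [L|[L|L]].
    + replace (0, y) with (((- y)%R, 0) * Ci * Ci * Ci)%C by (apply Ceq; simpl; ring).
      apply Q, Q, Q, P. simpl. lra.
    + subst y. now elim N.
    + replace (0, y) with ((y, 0) * Ci)%C by (apply Ceq; simpl; ring).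
      apply Q, P. simpl. lra.
  - now apply P.
Qed.

Lemma sum_n_C (u : nat -> C) (n : nat) :
  sum_n u n = (sum_n (fun k => Re (u k)) n, sum_n (fun k => Im (u k)) n).
Proof.
  induction n as [|n IH].
  - rewrite !sum_O. now destruct (u 0%nat).
  - rewrite !sum_Sn, IH. reflexivity.
Qed.

Lemma is_series_C (u : nat -> C) (l : C) :
  is_series (K := C_AbsRing) (V := C_NormedModule) u l <-> Clim (sum_n u) l.
Proof.
  split.
  - intros H e He. destruct (H (fun z => Cmod (z - l) < e)) as [n0 B].
    + apply (locally_le_locally_norm (V := C_NormedModule)). exists (mkposreal e He). intros z Hz. exact Hz.
    + exists n0. exact B.
  - intros H P HP.
    apply (locally_norm_le_locally (V := C_NormedModule)) in HP.
    destruct HP as [d B]. destruct (H d (cond_pos d)) as [n0 B'].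
    exists n0. intros n Hn. apply B. exact (B' n Hn).
Qed.

(* Composing with [1 + Cexp] removes the puncture at 1 from the domain. *)
Lemma is_riemann_zeta_unique (Z1 Z2 : C -> C) : is_riemann_zeta Z1 -> is_riemann_zeta Z2 ->
  forall s, s <> RtoC 1 -> Z1 s = Z2 s.
Proof.
  intros [D1 S1] [D2 S2] s Hs.
  set (H := fun w => (Z1 (1 + Cexp w) - Z2 (1 + Cexp w))%C).
  assert (Z : forall w, H w = RtoC 0).
  { apply entire_zero_of_strip.
    - intro w.
      assert (N : (1 + Cexp w)%C <> RtoC 1).
      { intro E. apply (Cexp_neq_0 w). replace (Cexp w) with (1 + Cexp w - 1)%C by ring.
        rewrite E. ring. }
      destruct (D1 _ N) as [l1 H1]. destruct (D2 _ N) as [l2 H2].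
      apply is_derive_Cder in H1, H2.
      assert (De : Cder (fun w => 1 + Cexp w)%C w (0 + Cexp w))
        by (apply Cder_plus; [apply Cder_const | apply Cder_Cexp]).
      eexists. apply Cder_minus.
      + apply (Cder_comp Z1 (fun w => 1 + Cexp w)%C); [exact De | exact H1].
      + apply (Cder_comp Z2 (fun w => 1 + Cexp w)%C); [exact De | exact H2].
    - intros w Hw.
      assert (R : 1 < Re (1 + Cexp w)).
      { change (Re (1 + Cexp w)) with (1 + exp (Re w) * cos (Im w)).
        assert (0 < cos (Im w)) by (apply cos_gt_0; generalize PI2_3_2; lra).
        generalize (exp_pos (Re w)). nra. }
      unfold H. specialize (S1 _ R). specialize (S2 _ R). apply is_series_C in S1, S2.
      rewrite (Clim_unique _ _ _ S1 S2). ring. }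
  destruct (Cexp_surj (s - 1)) as [w Hw].
  { intro E. apply Hs. now apply Ceq_minus. }
  specialize (Z w). unfold H in Z. rewrite Hw in Z.
  replace (1 + (s - 1))%C with s in Z by ring. now apply Ceq_minus.
Qed.

(** * Series of complex numbers *)

(** Convergence together with the value. [Cseries] alone yields a number for divergent series too,
    so it is evaluated through [Csum_Cseries]. *)
Definition Csum (u : nat -> C) (l : C) : Prop := Clim (sum_n u) l.

Lemma sum_n_Re (u : nat -> C) (n : nat) : Re (sum_n u n) = sum_n (fun k => Re (u k)) n.
Proof. now rewrite sum_n_C. Qed.

Lemma sum_n_Im (u : nat -> C) (n : nat) : Im (sum_n u n) = sum_n (fun k => Im (u k)) n.
Proof. now rewrite sum_n_C. Qed.

Lemma Csum_Re_Im (u : nat -> C) (l : C) : Csum u l <->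
  is_series (fun n => Re (u n)) (Re l) /\ is_series (fun n => Im (u n)) (Im l).
Proof.
  unfold Csum. rewrite Clim_is_lim_seq.
  assert (E1 : forall n, Re (sum_n u n) = sum_n (fun k => Re (u k)) n) by apply sum_n_Re.
  assert (E2 : forall n, Im (sum_n u n) = sum_n (fun k => Im (u k)) n) by apply sum_n_Im.
  split; intros [H1 H2]; split.
  - exact (is_lim_seq_ext _ _ _ E1 H1).
  - exact (is_lim_seq_ext _ _ _ E2 H2).
  - exact (is_lim_seq_ext (sum_n (fun k => Re (u k))) _ (Finite (Re l)) (fun n => eq_sym (E1 n)) H1).
  - exact (is_lim_seq_ext (sum_n (fun k => Im (u k))) _ (Finite (Im l)) (fun n => eq_sym (E2 n)) H2).
Qed.

Lemma Csum_Cseries (u : nat -> C) (l : C) : Csum u l -> Cseries u = l.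
Proof.
  intro H. apply Csum_Re_Im in H. destruct H as [H1 H2].
  apply Ceq; simpl; now apply is_series_unique.
Qed.

Lemma sum_n_Cmod_le (u : nat -> C) (b : nat -> R) (n : nat) :
  (forall k, (k <= n)%nat -> Cmod (u k) <= b k) -> Cmod (sum_n u n) <= sum_n b n.
Proof.
  induction n as [|n IH]; intro H.
  - rewrite !sum_O. apply H. lia.
  - rewrite !sum_Sn. eapply Rle_trans; [apply Cmod_triangle|].
    apply Rplus_le_compat; [apply IH; intros; apply H; lia | apply H; lia].
Qed.

Lemma sum_n_diff_Cmod_le (u : nat -> C) (b : nat -> R) (n m : nat) : (n <= m)%nat ->
  (forall k, Cmod (u k) <= b k) -> Cmod (sum_n u m - sum_n u n) <= sum_n b m - sum_n b n.
Proof.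
  intros L H. induction L as [|m L IH].
  - replace (sum_n u n - sum_n u n)%C with (RtoC 0) by ring. rewrite Cmod_0. lra.
  - rewrite !sum_Sn.
    change (plus (sum_n u m) (u (S m))) with (sum_n u m + u (S m))%C.
    change (plus (sum_n b m) (b (S m))) with (sum_n b m + b (S m)).
    replace (sum_n u m + u (S m) - sum_n u n)%C with ((sum_n u m - sum_n u n) + u (S m))%C by ring.
    eapply Rle_trans; [apply Cmod_triangle|]. specialize (H (S m)). lra.
Qed.

Lemma Series_partial_le (b : nat -> R) (n : nat) : (forall k, 0 <= b k) -> ex_series b ->
  sum_n b n <= Series b.
Proof.
  intros P H. apply Series_correct in H.
  apply (is_lim_seq_incr_compare _ _ H). intro k. rewrite sum_Sn.
  change (sum_n b k <= sum_n b k + b (S k)). specialize (P (S k)). lra.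
Qed.

(** The tail estimate depends on the majorant b alone; this gives the uniformity needed in [tannery]
    and [weierstrass_test]. *)
Lemma Csum_dominated (u : nat -> C) (b : nat -> R) : (forall k, Cmod (u k) <= b k) -> ex_series b ->
  Csum u (Cseries u) /\ (forall n, Cmod (sum_n u n - Cseries u) <= Series b - sum_n b n)
  /\ Cmod (Cseries u) <= Series b.
Proof.
  intros H E.
  assert (S0 : Csum u (Cseries u)).
  { apply Csum_Re_Im. split; apply Series_correct.
    - apply (ex_series_le (V := R_CompleteNormedModule) _ b); [|exact E].
      intro n. eapply Rle_trans; [apply re_le_Cmod | apply H].
    - apply (ex_series_le (V := R_CompleteNormedModule) _ b); [|exact E].
      intro n. eapply Rle_trans; [apply im_le_Cmod | apply H]. }
  assert (P : forall k, 0 <= b k) by (intro k; eapply Rle_trans; [apply Cmod_ge_0 | apply H]).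
  assert (T : forall n, Cmod (sum_n u n - Cseries u) <= Series b - sum_n b n).
  { intro n. rewrite Cmod_minus_sym.
    apply (Clim_le (fun m => sum_n u (n + m) - sum_n u n)%C).
    - apply Clim_minus; [|apply Clim_const].
      apply (Clim_subseq (sum_n u) _ (fun m => n + m)%nat); [intro; lia | exact S0].
    - intro m. eapply Rle_trans; [apply (sum_n_diff_Cmod_le u b); [lia | exact H]|].
      generalize (Series_partial_le b (n + m) P E). lra. }
  split; [exact S0 | split; [exact T|]].
  apply (Clim_le (sum_n u)); [exact S0|]. intro n.
  eapply Rle_trans; [apply sum_n_Cmod_le; intros; apply H | now apply Series_partial_le].
Qed.

Lemma Csum_plus (u v : nat -> C) (l m : C) : Csum u l -> Csum v m ->
  Csum (fun n => u n + v n)%C (l + m).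
Proof.
  intros H1 H2. eapply Clim_ext; [|apply (Clim_plus _ _ _ _ H1 H2)].
  intro n. symmetry. apply (sum_n_plus (G := C_AbelianMonoid)).
Qed.

Lemma Csum_scal (c : C) (u : nat -> C) (l : C) : Csum u l -> Csum (fun n => c * u n)%C (c * l).
Proof.
  intro H. eapply Clim_ext; [|apply (Clim_scal c _ _ H)].
  intro n. symmetry. apply (sum_n_mult_l (K := C_Ring)).
Qed.

Lemma Csum_ext (u v : nat -> C) (l : C) : (forall n, u n = v n) -> Csum u l -> Csum v l.
Proof. intros E H. eapply Clim_ext; [|exact H]. intro n. now apply sum_n_ext. Qed.

Lemma Csum_minus (u v : nat -> C) (l m : C) : Csum u l -> Csum v m ->
  Csum (fun n => u n - v n)%C (l - m).
Proof.
  intros H1 H2. apply (Csum_ext (fun n => u n + (- (1)) * v n)%C); [intro; ring|].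
  replace (l - m)%C with (l + (- (1)) * m)%C by ring.
  apply Csum_plus; [exact H1 | now apply Csum_scal].
Qed.

Lemma Csum_zero (u : nat -> C) : (forall n, u n = RtoC 0) -> Csum u 0.
Proof.
  intro H. apply (Clim_ext (fun _ => RtoC 0)); [|apply Clim_const].
  intro n. induction n as [|n IH]; [now rewrite sum_O, H|].
  rewrite sum_Sn, <- IH, H. change (plus ?x ?y) with (x + y)%C. ring.
Qed.

Lemma Clim_sum_n (U : nat -> nat -> C) (V : nat -> C) (n : nat) :
  (forall j, Clim (fun k => U k j) (V j)) -> Clim (fun k => sum_n (U k) n) (sum_n V n).
Proof.
  intro H. induction n as [|n IH].
  - rewrite sum_O. eapply Clim_ext; [|apply (H 0%nat)]. intro. now rewrite sum_O.
  - rewrite sum_Sn. eapply Clim_ext; [|apply Clim_plus; [exact IH | apply (H (S n))]].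
    intro. now rewrite sum_Sn.
Qed.

(** Dominated convergence for series: one index n0 makes the tails of U k, for all k, and of V
    smaller than e/3, and the finite heads converge. *)
Lemma tannery (U : nat -> nat -> C) (V : nat -> C) (b : nat -> R) :
  (forall k n, Cmod (U k n) <= b n) -> ex_series b -> (forall n, Clim (fun k => U k n) (V n)) ->
  Clim (fun k => Cseries (U k)) (Cseries V).
Proof.
  intros HU E HV e He.
  assert (HVb : forall n, Cmod (V n) <= b n) by (intro n; eapply Clim_le; [apply HV | intro; apply HU]).
  assert (L : is_lim_seq (sum_n b) (Finite (Series b))) by exact (Series_correct b E).
  apply is_lim_seq_spec in L.
  assert (P3 : 0 < e / 3) by lra. destruct (L (mkposreal _ P3)) as [n0 B]. specialize (B n0 (le_n n0)).
  simpl in B. apply Rabs_def2 in B.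
  destruct (Clim_sum_n U V n0 HV _ P3) as [k0 Bk]. exists k0. intros k Hk. specialize (Bk k Hk).
  destruct (Csum_dominated (U k) b (HU k) E) as (_ & T1 & _). specialize (T1 n0).
  destruct (Csum_dominated V b HVb E) as (_ & T2 & _). specialize (T2 n0).
  replace (Cseries (U k) - Cseries V)%C with
    ((sum_n (U k) n0 - sum_n V n0) - (sum_n (U k) n0 - Cseries (U k)) + (sum_n V n0 - Cseries V))%C by ring.
  eapply Rle_lt_trans; [apply Cmod_triangle|].
  eapply Rle_lt_trans; [apply Rplus_le_compat_r, Cmod_triangle_minus|]. lra.
Qed.

Lemma weierstrass_test (P : C -> Prop) (a : nat -> C -> C) (b : nat -> R) :
  (forall n s, P s -> Cmod (a n s) <= b n) -> ex_series b -> unif_conv_series_on P a.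
Proof.
  intros H E. exists (fun s => Cseries (fun n => a n s)). intros e He.
  assert (L : is_lim_seq (sum_n b) (Finite (Series b))) by exact (Series_correct b E).
  apply is_lim_seq_spec in L.
  destruct (L (mkposreal e He)) as [n0 B]. exists n0. intros n Hn s Hs.
  specialize (B n Hn). simpl in B. apply Rabs_def2 in B.
  destruct (Csum_dominated (fun n => a n s) b) as (_ & T & _); [intro; now apply H | exact E|].
  specialize (T n). cbv beta in T. lra.
Qed.

Lemma ex_series_Cmod_dominated (u : nat -> C) (b : nat -> R) :
  (forall k, Cmod (u k) <= b k) -> ex_series b -> ex_series (fun k => Cmod (u k)).
Proof.
  intros H E. apply (ex_series_le (V := R_CompleteNormedModule) _ b); [|exact E].
  intro n. unfold norm; simpl. unfold abs; simpl. rewrite Rabs_pos_eq by apply Cmod_ge_0. apply H.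
Qed.

Lemma Cder_sum_n (F : nat -> C -> C) (z : C) (n : nat) : (forall k, exists l, Cder (F k) z l) ->
  exists l, Cder (fun w => sum_n (fun k => F k w) n) z l.
Proof.
  intro H. induction n as [|n [l IH]].
  - destruct (H 0%nat) as [l Hl]. exists l.
    apply (Cder_ext (F 0%nat) _ z _ 1); [lra | intros; now rewrite sum_O | exact Hl].
  - destruct (H (S n)) as [m Hm]. exists (l + m)%C.
    apply (Cder_ext (fun w => sum_n (fun k => F k w) n + F (S n) w)%C _ z _ 1);
      [lra | intros; now rewrite sum_Sn | now apply Cder_plus].
Qed.

(* Term by term complex differentiability needs no bound on the derivatives, by Vitali's theorem. *)
Lemma Cder_Cseries (F : nat -> C -> C) (b : nat -> R) (c : C) (r : R) : 0 < r ->
  (forall k w, Cmod (w - c) < r -> exists l, Cder (F k) w l) ->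
  (forall k w, Cmod (w - c) < r -> Cmod (F k w) <= b k) -> ex_series b ->
  exists l, Cder (fun w => Cseries (fun k => F k w)) c l.
Proof.
  intros Hr HF Hb E.
  assert (P : forall k, 0 <= b k).
  { intro k. eapply Rle_trans; [apply Cmod_ge_0 | apply (Hb k c)].
    replace (c - c)%C with (RtoC 0) by ring. now rewrite Cmod_0. }
  destruct (vitali (fun n w => sum_n (fun k => F k w) n) (fun w => Cseries (fun k => F k w)) c r (Series b))
    as (l & Hl & _); [exact Hr | | | | now exists l].
  - intros n w Hw. apply Cder_sum_n. intro k. now apply HF.
  - intros n w Hw. eapply Rle_trans; [|apply (Series_partial_le b n P E)].
    apply sum_n_Cmod_le. intros k _. now apply Hb.
  - intros w Hw. destruct (Csum_dominated (fun k => F k w) b) as (S0 & _ & _);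
      [intro; now apply Hb | exact E | exact S0].
Qed.

(** * The binomial series *)

(* [bc a k] is [a (a+1) ... (a+k-1) / k!]. *)
Fixpoint bc (a : C) (k : nat) : C :=
  match k with
  | O => RtoC 1
  | S j => (bc a j * (a + RtoC (INR j)) / RtoC (INR (S j)))%C
  end.

Fixpoint bcR (a : R) (k : nat) : R :=
  match k with
  | O => 1
  | S j => bcR a j * (a + INR j) / INR (S j)
  end.

Lemma INR_S_pos (n : nat) : 0 < INR (S n).
Proof. apply lt_0_INR. lia. Qed.

Lemma RtoC_INR_S_neq (n : nat) : RtoC (INR (S n)) <> RtoC 0.
Proof. apply RtoC_neq. apply not_0_INR. lia. Qed.

Lemma RtoC_INR_plus1_neq (n : nat) : (RtoC (INR n) + 1)%C <> RtoC 0.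
Proof. rewrite <- RtoC_plus, <- S_INR. apply RtoC_INR_S_neq. Qed.

Lemma bcR_pos (A : R) (k : nat) : 0 < A -> 0 < bcR A k.
Proof.
  intro H. induction k as [|k IH]; [simpl; lra|]. cbn [bcR].
  apply Rdiv_lt_0_compat; [|apply INR_S_pos].
  apply Rmult_lt_0_compat; [exact IH|]. generalize (pos_INR k). lra.
Qed.

Lemma bc_Cmod_le (a : C) (A : R) (k : nat) : 0 < A -> Cmod a <= A -> Cmod (bc a k) <= bcR A k.
Proof.
  intros P H. induction k as [|k IH]; [simpl; rewrite Cmod_1; lra|]. cbn [bc bcR].
  rewrite Cmod_div, Cmod_mult, Cmod_R, (Rabs_pos_eq (INR (S k))); [|left; apply INR_S_pos | apply RtoC_INR_S_neq].
  apply Rmult_le_compat_r; [left; apply Rinv_0_lt_compat, INR_S_pos|].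
  apply Rmult_le_compat; try apply Cmod_ge_0; [exact IH|].
  eapply Rle_trans; [apply Cmod_triangle|]. rewrite Cmod_R, Rabs_pos_eq by apply pos_INR. lra.
Qed.

Lemma is_lim_seq_INR_inv : is_lim_seq (fun n => / INR (S n)) 0.
Proof.
  apply (is_lim_seq_incr_1 (fun n => / INR n)).
  replace (Finite 0) with (Rbar_inv p_infty) by reflexivity.
  apply is_lim_seq_inv; [apply is_lim_seq_INR | discriminate].
Qed.

Lemma ex_series_bcR_pos (A p : R) : 0 < A -> 0 < p < 1 -> ex_series (fun k => bcR A k * p ^ k).
Proof.
  intros HA Hp. apply ex_series_Rabs, ex_series_DAlembert with p; [apply Hp | |].
  - intro n. apply Rgt_not_eq, Rmult_lt_0_compat; [now apply bcR_pos | apply pow_lt; lra].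
  - apply (is_lim_seq_ext (fun n => p + p * (A - 1) * / INR (S n))).
    + intro n. assert (Q := INR_S_pos n). assert (B := bcR_pos A n HA).
      assert (0 < p ^ n) by (apply pow_lt; lra). assert (I := pos_INR n).
      cbn [bcR pow].
      replace (bcR A n * (A + INR n) / INR (S n) * (p * p ^ n) / (bcR A n * p ^ n))
        with (p * (A + INR n) / INR (S n)) by (field; repeat split; lra).
      rewrite Rabs_pos_eq.
      * rewrite S_INR in *. field. lra.
      * apply Rmult_le_pos; [apply Rmult_le_pos; lra | left; now apply Rinv_0_lt_compat].
    + replace (Finite p) with (Finite (p + p * (A - 1) * 0)) by (f_equal; ring).
      apply is_lim_seq_plus'; [apply is_lim_seq_const|].
      apply (is_lim_seq_mult' (fun _ => p * (A - 1))); [apply is_lim_seq_const | apply is_lim_seq_INR_inv].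
Qed.

(** The ratio test asks for nonzero terms, so p = 0 is reached by comparison with (1 + p) / 2 >
    0. *)
Lemma ex_series_bcR (A p : R) : 0 < A -> 0 <= p < 1 -> ex_series (fun k => bcR A k * p ^ k).
Proof.
  intros HA Hp. apply (ex_series_le (V := R_CompleteNormedModule) _ (fun k => bcR A k * ((1 + p) / 2) ^ k)).
  - intro n. unfold norm; simpl. unfold abs; simpl. assert (B := bcR_pos A n HA).
    rewrite Rabs_pos_eq by (apply Rmult_le_pos; [lra | apply pow_le; lra]).
    apply Rmult_le_compat_l; [lra | apply pow_incr; lra].
  - apply ex_series_bcR_pos; lra.
Qed.

(** Both sides are a (a+1) ... (a+k) / k!, with the last or the first factor split off. *)
Lemma bc_shift (a : C) (k : nat) : ((a + RtoC (INR k)) * bc a k = a * bc (a + 1) k)%C.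
Proof.
  induction k as [|k IH]; [simpl; ring|]. cbn [bc].
  transitivity ((a + RtoC (INR (S k))) * ((a + RtoC (INR k)) * bc a k) / RtoC (INR (S k)))%C;
    [field; apply RtoC_INR_S_neq|].
  rewrite IH, S_INR, RtoC_plus. field. exact (RtoC_INR_plus1_neq k).
Qed.

Lemma Cder_pow_id (z : C) (n : nat) : Cder (fun w => w ^ S n)%C z (RtoC (INR (S n)) * z ^ n)%C.
Proof.
  induction n as [|n IH].
  - apply (Cder_ext (fun w => w) _ z _ 1); [lra | intros; simpl; ring|].
    eapply Cder_eq; [|apply Cder_id]. simpl. ring.
  - apply (Cder_ext (fun w => w * w ^ S n)%C _ z _ 1); [lra | intros; symmetry; apply Cpow_S|].
    eapply Cder_eq; [|apply Cder_mult; [apply Cder_id | exact IH]].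
    rewrite (S_INR (S n)), RtoC_plus, Cpow_S. ring.
Qed.

(** The partial sums satisfy the differential equation (1 - z) f' = a f of the power (1 - z)^(-a) up
    to a single boundary term, which vanishes in the limit inside the unit disc. *)
Lemma Cder_binomial_partial (a z : C) (n : nat) : (1 - z)%C <> RtoC 0 ->
  Cder (fun q => sum_n (fun k => bc a k * q ^ k)%C n) z
    ((a * sum_n (fun k => bc a k * z ^ k)%C n - (a + RtoC (INR n)) * bc a n * z ^ n) / (1 - z)).
Proof.
  intro N. induction n as [|n IH].
  - apply (Cder_ext (fun _ => RtoC 1) _ z _ 1); [lra | intros; rewrite sum_O; simpl; ring|].
    eapply Cder_eq; [|apply Cder_const]. rewrite sum_O. simpl. field. exact N.
  - apply (Cder_ext (fun q => sum_n (fun k => bc a k * q ^ k) n + bc a (S n) * q ^ S n)%C _ z _ 1);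
      [lra | intros; now rewrite sum_Sn|].
    eapply Cder_eq; [|apply Cder_plus; [exact IH | apply Cder_scal, Cder_pow_id]].
    rewrite sum_Sn. set (Sn := sum_n _ n). change (plus Sn ?x) with (Sn + x)%C.
    cbn [bc]. rewrite Cpow_S. rewrite S_INR, RtoC_plus.
    field. split; [exact (RtoC_INR_plus1_neq n) | exact N].
Qed.

Lemma binomial_series_dominated (a q : C) (A p : R) : 0 < A -> Cmod a <= A -> Cmod q <= p ->
  forall k, Cmod (bc a k * q ^ k) <= bcR A k * p ^ k.
Proof.
  intros HA Ha Hq k. rewrite Cmod_mult, Cmod_pow.
  apply Rmult_le_compat; try apply Cmod_ge_0; [apply pow_le, Cmod_ge_0 | now apply bc_Cmod_le|].
  apply pow_incr. split; [apply Cmod_ge_0 | exact Hq].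
Qed.

Lemma Csum_lim_0 (u : nat -> C) (l : C) : Csum u l -> Clim u 0.
Proof.
  intro H. apply Csum_Re_Im in H. destruct H as [H1 H2]. apply Clim_is_lim_seq.
  split; apply ex_series_lim_0; eexists; eassumption.
Qed.

(** The sum f satisfies f' = a f / (1 - z) on the unit disc, so f(z) (1 - z)^a has derivative 0; it
    equals 1 at 0 and is constant on the segment from 0 to q. *)
Lemma binomial_series (a q : C) : Cmod q < 1 ->
  Csum (fun k => bc a k * q ^ k)%C (Ccpow (1 - q) (- a)).
Proof.
  intro Hq. set (A := Cmod a + 1).
  assert (HA : 0 < A) by (unfold A; generalize (Cmod_ge_0 a); lra).
  assert (HaA : Cmod a <= A) by (unfold A; lra).
  set (f := fun z => Cseries (fun k => bc a k * z ^ k)%C).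
  assert (Sf : forall b z, Cmod z < 1 -> Csum (fun k => bc b k * z ^ k)%C (Cseries (fun k => bc b k * z ^ k)%C)).
  { intros b z Hz. assert (Hb : 0 < Cmod b + 1) by (generalize (Cmod_ge_0 b); lra).
    apply (Csum_dominated _ (fun k => bcR (Cmod b + 1) k * Cmod z ^ k)).
    - apply binomial_series_dominated; lra.
    - apply ex_series_bcR; [lra | split; [apply Cmod_ge_0 | exact Hz]]. }
  assert (R1 : forall z, Cmod z < 1 -> 0 < Re (1 - z)).
  { intros z Hz. change (Re (1 - z)) with (1 - Re z). generalize (re_le_Cmod z).
    intro X. apply Rabs_le_between in X. lra. }
  assert (Df : forall z, Cmod z < 1 -> Cder f z (a * f z / (1 - z))).
  { intros z Hz. assert (N := Re_pos_neq _ (R1 z Hz)).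
    set (p := (1 + Cmod z) / 2). assert (Hp : 0 <= p < 1) by (unfold p; generalize (Cmod_ge_0 z); lra).
    assert (E := ex_series_bcR A p HA Hp).
    assert (Near : forall w, Cmod (w - z) < (1 - Cmod z) / 2 -> Cmod w <= p).
    { intros w Hw. generalize (Cmod_triangle_rev w z). unfold p. lra. }
    destruct (vitali (fun n q => sum_n (fun k => bc a k * q ^ k)%C n) f z ((1 - Cmod z) / 2)
      (Series (fun k => bcR A k * p ^ k))) as (l & Hl & Lim); [lra | | | |].
    - intros n w Hw. eexists. apply Cder_binomial_partial. apply Re_pos_neq, R1.
      generalize (Near w Hw). lra.
    - intros n w Hw. eapply Rle_trans; [apply sum_n_Cmod_le; intros k _;
        apply (binomial_series_dominated a w A p); [exact HA | exact HaA | now apply Near]|].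
      apply Series_partial_le; [|exact E]. intro k. apply Rmult_le_pos; [left; now apply bcR_pos | now apply pow_le].
    - intros w Hw. apply Sf. generalize (Near w Hw). lra.
    - replace (a * f z / (1 - z))%C with l; [exact Hl|].
      apply (Clim_unique _ _ _ (Lim _ (fun n => Cder_binomial_partial a z n N))).
      replace (a * f z / (1 - z))%C with ((a * f z - a * 0) * / (1 - z))%C by (field; exact N).
      apply Clim_mult; [|apply Clim_const]. apply Clim_minus.
      + apply Clim_scal, Sf, Hz.
      (* By [bc_shift] the boundary term is a times the general term of the convergent series with
         parameter a + 1, hence tends to 0. *)
      + eapply Clim_ext; [|apply Clim_scal, (Csum_lim_0 _ _ (Sf (a + 1)%C z Hz))].
        intro n. cbv beta. rewrite bc_shift. ring. }
  assert (C1 : f q = Ccpow (1 - q) (- a)).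
  { assert (G : forall z, Cmod z < 1 -> Cder (fun z => f z * Ccpow (1 - z) a)%C z 0).
    { intros z Hz. assert (N := Re_pos_neq _ (R1 z Hz)).
      eapply Cder_eq; [|apply Cder_mult; [now apply Df |
        apply (Cder_Ccpow_l a (fun z => 1 - z)%C); [now apply R1 |
          apply Cder_minus; [apply Cder_const | apply Cder_id]]]].
      cbv beta. field. exact N. }
    assert (K := Cder_0_segment (fun z => f z * Ccpow (1 - z) a)%C 0 q).
    cbv beta in K.
    replace (0 + q)%C with q in K by ring. replace (1 - 0)%C with (RtoC 1) in K by ring.
    rewrite Ccpow_1_l in K.
    assert (F0 : f 0 = RtoC 1).
    { apply Csum_Cseries. apply (Clim_ext (fun _ => RtoC 1)); [|apply Clim_const].
      intro n. induction n as [|n IH]; [rewrite sum_O; simpl; ring|].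
      rewrite sum_Sn, <- IH. change (plus ?x ?y) with (x + y)%C. rewrite Cpow_S. ring. }
    rewrite F0 in K. rewrite Ccpow_opp.
    assert (K' : (f q * Ccpow (1 - q) a)%C = RtoC 1).
    { rewrite K; [ring|]. intros t Ht. apply G.
      replace (0 + RtoC t * q)%C with (RtoC t * q)%C by ring.
      rewrite Cmod_mult, Cmod_R, Rabs_pos_eq by lra. generalize (Cmod_ge_0 q). nra. }
    transitivity (f q * Ccpow (1 - q) a * / Ccpow (1 - q) a)%C; [|rewrite K'; ring].
    field. apply Ccpow_neq_0. }
  rewrite <- C1. apply Sf, Hq.
Qed.

(** * The Gamma function *)

Lemma Cmod_Cexp_le (z : C) : Cmod (Cexp z) <= exp (Cmod z).
Proof.
  rewrite Cmod_Cexp. apply exp_monotone. eapply Rle_trans; [apply Rle_abs | apply re_le_Cmod].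
Qed.

(** A version without restriction on |z|: beyond 1/2 the three terms together are at most 2 exp |z|,
    and there 8 |z|^2 >= 2. *)
Lemma Cexp_taylor2_exp (z : C) :
  Cmod (Cexp z - 1 - z) <= 8 * (Cmod z * Cmod z) * exp (Cmod z).
Proof.
  assert (P := Cmod_ge_0 z). assert (E := exp_ineq1_le (Cmod z)).
  destruct (Rle_dec (Cmod z) (/ 2)) as [L|L].
  - eapply Rle_trans; [now apply Cexp_taylor2|]. nra.
  - eapply Rle_trans; [apply Cmod_triangle_minus|].
    eapply Rle_trans; [apply Rplus_le_compat_r, Cmod_triangle_minus|].
    rewrite Cmod_1. generalize (Cmod_Cexp_le z). intro Q.
    assert (/ 4 <= Cmod z * Cmod z) by nra.
    assert (2 * exp (Cmod z) <= 8 * (Cmod z * Cmod z) * exp (Cmod z)) by nra. lra.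
Qed.

(** A telescoping majorant of 1/n^2, which controls the infinite products for Gamma. *)
Lemma inv_sqr_telescope (n : nat) : (1 <= n)%nat ->
  0 < / (INR n * INR n) <= 2 * (/ INR n - / INR (S n)).
Proof.
  intro L. assert (P : 1 <= INR n) by (apply (le_INR 1); lia).
  split; [apply Rinv_0_lt_compat; nra|].
  rewrite S_INR. apply Rmult_le_reg_r with (INR n * INR n * (INR n + 1)); [nra|].
  replace (/ (INR n * INR n) * (INR n * INR n * (INR n + 1))) with (INR n + 1) by (field; lra).
  replace (2 * (/ INR n - / (INR n + 1)) * (INR n * INR n * (INR n + 1))) with (2 * INR n) by (field; lra).
  lra.
Qed.

(** Each factor is at most exp (2 K (1/n - 1/(n+1))), and the exponents telescope to at most 2 K.
    The sequence is real because the lemma serves both for the moduli of a product and, in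
    [rGamma_neq_0], for their inverses. *)
Lemma product_bound (W : nat -> R) (K : R) (n0 : nat) : (1 <= n0)%nat -> 0 <= K ->
  (forall n, 0 <= W n) ->
  (forall n, (n0 <= n)%nat -> W (S n) <= W n * (1 + K / (INR n * INR n))) ->
  forall n, (n0 <= n)%nat -> W n <= W n0 * exp (2 * K).
Proof.
  intros Hn0 HK HW H.
  assert (G : forall n, (n0 <= n)%nat -> W n <= W n0 * exp (2 * K * (/ INR n0 - / INR n))).
  { intros n L. induction L as [|n L IH].
    - rewrite Rminus_diag_eq, Rmult_0_r, exp_0 by reflexivity. lra.
    - assert (Pn : 1 <= INR n) by (apply (le_INR 1); lia).
      eapply Rle_trans; [apply H; lia|].
      destruct (inv_sqr_telescope n ltac:(lia)) as [I0 I1].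
      assert (E : 1 + K / (INR n * INR n) <= exp (2 * K * (/ INR n - / INR (S n)))).
      { eapply Rle_trans; [|apply exp_ineq1_le]. unfold Rdiv. nra. }
      replace (2 * K * (/ INR n0 - / INR (S n))) with
        (2 * K * (/ INR n0 - / INR n) + 2 * K * (/ INR n - / INR (S n))) by ring.
      rewrite exp_plus, <- Rmult_assoc.
      apply Rmult_le_compat; [apply HW | | exact IH | exact E].
      unfold Rdiv. nra. }
  intros n L. eapply Rle_trans; [now apply G|]. apply Rmult_le_compat_l; [apply HW|].
  apply exp_monotone.
  assert (P0 : 1 <= INR n0) by (apply (le_INR 1); lia).
  assert (Pn : 1 <= INR n) by (apply (le_INR 1); lia).
  assert (0 < / INR n) by (apply Rinv_0_lt_compat; lra).
  assert (/ INR n0 <= 1) by (rewrite <- Rinv_1; apply Rinv_le_contravar; lra). nra.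
Qed.

Lemma product_converges (W : nat -> C) (K : R) : 0 <= K ->
  (forall n, (1 <= n)%nat -> Cmod (W (S n) - W n) <= Cmod (W n) * (K / (INR n * INR n))) ->
  (forall n, (1 <= n)%nat -> Cmod (W n) <= Cmod (W 1%nat) * exp (2 * K)) /\ exists l, Clim W l.
Proof.
  intros HK H.
  assert (B : forall n, (1 <= n)%nat -> Cmod (W n) <= Cmod (W 1%nat) * exp (2 * K)).
  { apply (product_bound (fun n => Cmod (W n)) K 1); [lia | exact HK | intro; apply Cmod_ge_0|].
    intros n L. specialize (H n L). generalize (Cmod_triangle_rev (W (S n)) (W n)). lra. }
  split; [exact B|].
  set (M := Cmod (W 1%nat) * exp (2 * K)) in *.
  assert (HM : 0 <= M) by (eapply Rle_trans; [apply Cmod_ge_0 | apply (B 1%nat); lia]).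
  assert (T : forall n m, (1 <= n)%nat -> (n <= m)%nat ->
    Cmod (W m - W n) <= 2 * (M * K) * (/ INR n - / INR m)).
  { intros n m Ln L. induction L as [|m L IH].
    - replace (W n - W n)%C with (RtoC 0) by ring. rewrite Cmod_0. lra.
    - assert (Pn : 1 <= INR m) by (apply (le_INR 1); lia).
      destruct (inv_sqr_telescope m ltac:(lia)) as [I0 I1].
      replace (W (S m) - W n)%C with ((W (S m) - W m) + (W m - W n))%C by ring.
      eapply Rle_trans; [apply Cmod_triangle|].
      assert (Q := H m ltac:(lia)). assert (Bm := B m ltac:(lia)).
      assert (Cmod (W m) * (K / (INR m * INR m)) <= M * K * (2 * (/ INR m - / INR (S m)))).
      { unfold Rdiv. rewrite <- Rmult_assoc. apply Rmult_le_compat; [| lra | | exact I1].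
        - apply Rmult_le_pos; [apply Cmod_ge_0 | exact HK].
        - apply Rmult_le_compat_r; assumption. }
      lra. }
  apply Clim_cauchy. intros e He.
  set (X := 4 * (M * K) / e). destruct (INR_unbounded X) as [n0 Hn0].
  assert (MK : 0 <= M * K) by now apply Rmult_le_pos.
  exists (S n0).
  assert (S1 : forall n, (S n0 <= n)%nat -> Cmod (W n - W (S n0)) < e / 2).
  { intros n L. eapply Rle_lt_trans; [apply T; lia|].
    assert (P0 := INR_S_pos n0).
    assert (Pn : 0 < INR n) by (apply lt_0_INR; lia).
    assert (0 < / INR n) by (now apply Rinv_0_lt_compat).
    assert (X < INR (S n0)) by (rewrite S_INR; lra).
    assert (4 * (M * K) < e * INR (S n0)).
    { unfold X in *. apply Rmult_lt_compat_l with (r := e) in H1; [|exact He].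
      replace (e * (4 * (M * K) / e)) with (4 * (M * K)) in H1 by (field; lra). exact H1. }
    assert (2 * (M * K) * / INR (S n0) < e / 2).
    { apply Rmult_lt_reg_r with (INR (S n0)); [exact P0|].
      replace (2 * (M * K) * / INR (S n0) * INR (S n0)) with (2 * (M * K)) by (field; lra). lra. }
    nra. }
  intros n m Ln Lm. replace (W n - W m)%C with ((W n - W (S n0)) - (W m - W (S n0)))%C by ring.
  eapply Rle_lt_trans; [apply Cmod_triangle_minus|].
  generalize (S1 n Ln) (S1 m Lm). lra.
Qed.

(* The reciprocal of Gauss's sequence, up to the factor [1 + s / n]; unlike [gauss_seq] it has no
   poles, so its limit [rGamma] is entire. *)
Definition wg (s : C) (n : nat) : C := (bc s n * Ccpow (RtoC (INR n)) (1 - s))%C.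

(** The ratio of consecutive terms of [wg], namely (1 + s/n) (1 + 1/n)^(-s). Its terms of order 1/n
    cancel, which is why the product converges for every s. *)
Definition wfactor (s : C) (n : nat) : C :=
  ((1 + s / RtoC (INR n)) * Cexp (- s * RtoC (ln (1 + / INR n))))%C.

Lemma wg_S (s : C) (n : nat) : (1 <= n)%nat -> wg s (S n) = (wg s n * wfactor s n)%C.
Proof.
  intro L. assert (P : 0 < INR n) by (apply lt_0_INR; lia).
  assert (I : 0 < / INR n) by now apply Rinv_0_lt_compat.
  assert (E : RtoC (INR (S n)) = (RtoC (INR n) * RtoC (1 + / INR n))%C).
  { rewrite <- RtoC_mult. f_equal. rewrite S_INR. field. lra. }
  unfold wg, wfactor. cbn [bc]. rewrite E.
  rewrite (Ccpow_scal (INR n) (RtoC (1 + / INR n))) by (simpl; lra).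
  replace (Ccpow (RtoC (1 + / INR n)) (1 - s)) with
    (RtoC (1 + / INR n) * Cexp (- s * RtoC (ln (1 + / INR n))))%C.
  - rewrite <- E. assert (N := RtoC_INR_S_neq n).
    assert (N1 : RtoC (INR n) <> RtoC 0) by (apply RtoC_neq; lra).
    replace (RtoC (1 + / INR n)) with (RtoC (INR (S n)) / RtoC (INR n))%C by (rewrite E; field; exact N1).
    field. split; assumption.
  - unfold Ccpow. rewrite Clog_pr_RtoC by lra.
    replace ((1 - s) * RtoC (ln (1 + / INR n)))%C with
      (RtoC (ln (1 + / INR n)) + - s * RtoC (ln (1 + / INR n)))%C by ring.
    rewrite Cexp_plus, Cexp_RtoC, exp_ln by lra. reflexivity.
Qed.

Lemma ln_1p_bounds (n : nat) : (1 <= n)%nat -> / (INR n + 1) <= ln (1 + / INR n) <= / INR n.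
Proof.
  intro L. assert (P : 1 <= INR n) by (apply (le_INR 1); lia).
  assert (I : 0 < / INR n) by (apply Rinv_0_lt_compat; lra).
  split.
  - replace (1 + / INR n) with (/ (1 - / (INR n + 1))) by (field; lra).
    assert (Q : / (INR n + 1) <= / 2) by (apply Rinv_le_contravar; lra).
    assert (Q' : 0 < / (INR n + 1)) by (apply Rinv_0_lt_compat; lra).
    rewrite ln_Rinv by lra.
    assert (ln (1 - / (INR n + 1)) <= - / (INR n + 1)); [|lra].
    rewrite <- (ln_exp (- / (INR n + 1))). apply ln_le; [lra | apply exp_ineq1_le].
  - rewrite <- (ln_exp (/ INR n)) at 2. apply ln_le; [lra | apply exp_ineq1_le].
Qed.

Lemma ln_1p_second_order (n : nat) : (1 <= n)%nat ->
  0 <= ln (1 + / INR n) <= / INR n /\ Rabs (/ INR n - ln (1 + / INR n)) <= / (INR n * INR n).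
Proof.
  intro L. assert (P : 1 <= INR n) by (apply (le_INR 1); lia).
  destruct (ln_1p_bounds n L) as [Lo U].
  assert (0 < / (INR n + 1)) by (apply Rinv_0_lt_compat; lra).
  split; [lra|]. rewrite Rabs_pos_eq by lra.
  assert (/ INR n - / (INR n + 1) <= / (INR n * INR n)); [|lra].
  apply Rmult_le_reg_r with (INR n * INR n * (INR n + 1)); [nra|].
  replace ((/ INR n - / (INR n + 1)) * (INR n * INR n * (INR n + 1))) with (INR n) by (field; lra).
  replace (/ (INR n * INR n) * (INR n * INR n * (INR n + 1))) with (INR n + 1) by (field; lra). lra.
Qed.

(** Collects three errors of [wfactor_bound] for |s| <= B, in units of 1/n^2: B from replacing ln (1
    + 1/n) by 1/n, B^2 from the product of the linear terms, and the rest from the second-order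
    remainder of the exponential. *)
Definition wK (B : R) : R := B + B * B + 8 * (1 + B) * (B * B) * exp B.

Lemma wK_pos (B : R) : 0 <= B -> 0 <= wK B.
Proof.
  intro H. unfold wK. assert (E := exp_pos B).
  assert (0 <= (1 + B) * (B * B) * exp B) by (apply Rmult_le_pos; [apply Rmult_le_pos; nra | lra]). nra.
Qed.

Lemma wfactor_bound (s : C) (B : R) (n : nat) : (1 <= n)%nat -> Cmod s <= B ->
  Cmod (wfactor s n - 1) <= wK B / (INR n * INR n).
Proof.
  intros L HB. assert (P : 1 <= INR n) by (apply (le_INR 1); lia).
  assert (I : 0 < / INR n <= 1).
  { split; [apply Rinv_0_lt_compat; lra|]. rewrite <- Rinv_1. apply Rinv_le_contravar; lra. }
  destruct (ln_1p_second_order n L) as [[L0 L1] L2]. unfold wfactor.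
  set (l := ln (1 + / INR n)) in *. set (i := / INR n) in *.
  assert (S0 := Cmod_ge_0 s).
  replace (s / RtoC (INR n))%C with (s * RtoC i)%C.
  2: { unfold i. rewrite RtoC_inv by lra. reflexivity. }
  replace (/ (INR n * INR n)) with (i * i) in L2 by (unfold i; field; lra).
  replace (wK B / (INR n * INR n)) with (wK B * (i * i)) by (unfold i; field; lra).
  set (r := (Cexp (- s * RtoC l) - 1 - (- s * RtoC l))%C).
  assert (Ms : Cmod (- s * RtoC l) = Cmod s * l) by (rewrite Cmod_mult, Cmod_opp, Cmod_R, Rabs_pos_eq; lra).
  assert (Ml : 0 <= Cmod s * l <= B * i) by (split; [nra | apply Rmult_le_compat; lra]).
  assert (Hr : Cmod r <= 8 * (B * B) * exp B * (i * i)).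
  { unfold r. eapply Rle_trans; [apply Cexp_taylor2_exp|]. rewrite Ms.
    assert (exp (Cmod s * l) <= exp B) by (apply exp_monotone; nra).
    assert (Cmod s * l * (Cmod s * l) <= B * i * (B * i)) by (apply Rmult_le_compat; lra).
    replace (8 * (B * B) * exp B * (i * i)) with (8 * (B * i * (B * i)) * exp B) by ring.
    apply Rmult_le_compat; [nra | left; apply exp_pos | lra | assumption]. }
  replace ((1 + s * RtoC i) * Cexp (- s * RtoC l) - 1)%C with
    (s * RtoC (i - l) - s * s * RtoC (l * i) + (1 + s * RtoC i) * r)%C
    by (unfold r; rewrite RtoC_minus, RtoC_mult; ring).
  eapply Rle_trans; [apply Cmod_triangle|].
  eapply Rle_trans; [apply Rplus_le_compat_r, Cmod_triangle_minus|].
  rewrite !Cmod_mult, !Cmod_R.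
  assert (T1 : Cmod s * Rabs (i - l) <= B * (i * i)) by (apply Rmult_le_compat; auto using Rabs_pos; lra).
  assert (T2 : Cmod s * Cmod s * Rabs (l * i) <= B * B * (i * i)).
  { rewrite Rabs_pos_eq by nra. apply Rmult_le_compat; nra. }
  assert (T3 : Cmod (1 + s * RtoC i) * Cmod r <= (1 + B) * (8 * (B * B) * exp B * (i * i))).
  { apply Rmult_le_compat; try apply Cmod_ge_0; [|exact Hr].
    eapply Rle_trans; [apply Cmod_triangle|]. rewrite Cmod_1, Cmod_mult, Cmod_R, Rabs_pos_eq by lra. nra. }
  unfold wK. lra.
Qed.

Definition rGamma (s : C) : C :=
  (real (Lim_seq (fun n => Re (wg s n))), real (Lim_seq (fun n => Im (wg s n)))).

Lemma wg_1 (s : C) : wg s 1 = s.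
Proof.
  unfold wg. cbn [bc]. change (INR 1) with 1. change (INR 0) with 0. rewrite Ccpow_1_l. field.
Qed.

Lemma wg_converges (s : C) (B : R) : Cmod s <= B ->
  (forall n, (1 <= n)%nat -> Cmod (wg s n) <= B * exp (2 * wK B)) /\ Clim (wg s) (rGamma s).
Proof.
  intro HB. assert (B0 : 0 <= B) by (eapply Rle_trans; [apply Cmod_ge_0 | exact HB]).
  destruct (product_converges (wg s) (wK B)) as [H1 [l H2]].
  - now apply wK_pos.
  - intros n L. rewrite wg_S by exact L.
    replace (wg s n * wfactor s n - wg s n)%C with (wg s n * (wfactor s n - 1))%C by ring.
    rewrite Cmod_mult. apply Rmult_le_compat_l; [apply Cmod_ge_0 | now apply wfactor_bound].
  - split.
    + intros n L. eapply Rle_trans; [now apply H1|]. rewrite wg_1.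
      apply Rmult_le_compat_r; [left; apply exp_pos | exact HB].
    + replace (rGamma s) with l; [exact H2|].
      apply Clim_is_lim_seq in H2. destruct H2 as [R1 R2].
      apply is_lim_seq_unique in R1, R2. unfold rGamma. rewrite R1, R2.
      destruct l; reflexivity.
Qed.

Lemma wg_Clim (s : C) : Clim (wg s) (rGamma s).
Proof. apply (wg_converges s (Cmod s)). lra. Qed.

Lemma Cder_bc (f : C -> C) (z l : C) (n : nat) : Cder f z l -> exists m, Cder (fun w => bc (f w) n) z m.
Proof.
  intro H. induction n as [|n [m IH]].
  - exists (RtoC 0). exact (Cder_const 1 z).
  - eexists. cbn [bc]. apply Cder_div; [apply Cder_mult; [exact IH | apply Cder_plus; [exact H | apply Cder_const]]
      | apply Cder_const | apply RtoC_INR_S_neq].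
Qed.

Lemma Cder_rGamma (s : C) : exists l, Cder rGamma s l.
Proof.
  set (B := Cmod s + 1).
  (* The index is shifted because the uniform bound of [wg_converges] starts at n = 1. *)
  destruct (vitali (fun n z => wg z (S n)) rGamma s 1 (B * exp (2 * wK B))) as (l & Hl & _);
    [lra | | | | now exists l].
  - intros n w _. destruct (Cder_bc (fun z => z) w 1 (S n) (Cder_id w)) as [m Hm].
    eexists. apply Cder_mult; [exact Hm|]. apply Cder_Ccpow_r, Cder_minus; [apply Cder_const | apply Cder_id].
  - intros n w Hw. apply wg_converges; [|lia].
    generalize (Cmod_triangle_rev w s). unfold B. lra.
  - intros w _. apply (Clim_subseq (wg w) _ S); [intro; lia | apply wg_Clim].
Qed.

(** No factor vanishes, so it remains to bound 1/|wg s n|. From n0 > 2 K + 1 on, each factor has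
    modulus at least 1 - x with x = K/n^2 <= 1/2, and 1/(1 - x) <= 1 + 2 x; [product_bound] then
    keeps the inverses bounded. *)
Lemma rGamma_neq_0 (s : C) : (forall n : nat, (s + RtoC (INR n))%C <> RtoC 0) -> rGamma s <> RtoC 0.
Proof.
  intro Hs. set (K := wK (Cmod s)). assert (HK : 0 <= K) by (apply wK_pos, Cmod_ge_0).
  destruct (INR_unbounded (2 * K + 1)) as [n0 Hn0].
  assert (L0 : (1 <= n0)%nat).
  { destruct n0 as [|n0]; [simpl in Hn0; lra | lia]. }
  assert (W0 : forall n, (1 <= n)%nat -> wg s n <> RtoC 0).
  { intros n L. induction L as [|n L IH].
    - rewrite wg_1. specialize (Hs 0%nat). rewrite Cplus_0_r in Hs. exact Hs.
    - assert (P : 0 < INR n) by (apply lt_0_INR; lia). assert (RtoC (INR n) <> RtoC 0) by (apply RtoC_neq; lra).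
      rewrite wg_S by lia. apply Cmult_neq_0; [exact IH|].
      apply Cmult_neq_0; [|apply Cexp_neq_0].
      replace (1 + s / RtoC (INR n))%C with ((s + RtoC (INR n)) / RtoC (INR n))%C by (field; assumption).
      intro E. apply (Hs n). replace (s + RtoC (INR n))%C with ((s + RtoC (INR n)) / RtoC (INR n) * RtoC (INR n))%C
        by (field; assumption). rewrite E. ring. }
  assert (B : forall n, (n0 <= n)%nat -> / Cmod (wg s n) <= / Cmod (wg s n0) * exp (2 * (2 * K))).
  { apply (product_bound (fun n => / Cmod (wg s n)) (2 * K) n0); [exact L0 | lra | |].
    - intro n. destruct (Rle_lt_or_eq_dec 0 (Cmod (wg s n)) (Cmod_ge_0 _)) as [P|P].
      + left. now apply Rinv_0_lt_compat.
      + rewrite <- P, Rinv_0. lra.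
    - intros n L. assert (Pn : 2 * K + 1 < INR n) by (apply (Rlt_le_trans _ (INR n0)); [exact Hn0 | now apply le_INR]).
      rewrite wg_S by lia. rewrite Cmod_mult, Rinv_mult.
      apply Rmult_le_compat_l.
      { left. apply Rinv_0_lt_compat, Cmod_gt_0, W0. lia. }
      assert (F := wfactor_bound s (Cmod s) n ltac:(lia) (Rle_refl _)). fold K in F.
      assert (X : 0 < / (INR n * INR n)) by (apply Rinv_0_lt_compat; nra).
      unfold Rdiv in *. set (x := K * / (INR n * INR n)) in *.
      assert (X0 : 0 <= x) by (unfold x; nra).
      assert (X2 : x <= / 2).
      { unfold x. apply Rmult_le_reg_r with (INR n * INR n); [nra|].
        replace (K * / (INR n * INR n) * (INR n * INR n)) with K by (field; lra). nra. }
      assert (1 - x <= Cmod (wfactor s n)).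
      { generalize (Cmod_triangle_rev 1 (wfactor s n)). rewrite Cmod_minus_sym in F. rewrite Cmod_1. lra. }
      apply Rle_trans with (/ (1 - x)); [apply Rinv_le_contravar; lra|].
      replace (1 + 2 * K * / (INR n * INR n)) with (1 + 2 * x) by (unfold x; ring).
      apply Rmult_le_reg_r with (1 - x); [lra|]. rewrite Rinv_l by lra. nra. }
  set (M := / Cmod (wg s n0) * exp (2 * (2 * K))) in *.
  assert (HM : 0 < M).
  { unfold M. apply Rmult_lt_0_compat; [apply Rinv_0_lt_compat, Cmod_gt_0, W0; lia | apply exp_pos]. }
  intro E. assert (Lim := wg_Clim s). rewrite E in Lim.
  destruct (Lim (/ M)) as [n1 B1]; [now apply Rinv_0_lt_compat|].
  specialize (B1 (max n0 n1) ltac:(lia)). specialize (B (max n0 n1) ltac:(lia)).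
  set (n := max n0 n1) in *. replace (wg s n - 0)%C with (wg s n) in B1 by ring.
  assert (Pw : 0 < Cmod (wg s n)) by (apply Cmod_gt_0, W0; lia).
  apply Rinv_lt_contravar in B1; [|apply Rmult_lt_0_compat; [exact Pw | now apply Rinv_0_lt_compat]].
  rewrite Rinv_inv in B1. lra.
Qed.

Lemma Cprod_shift_bc (s : C) (n : nat) :
  Cprod_shift s n = (RtoC (INR (fact n)) * (s + RtoC (INR n)) * bc s n)%C.
Proof.
  induction n as [|n IH]; [simpl; ring|].
  cbn [Cprod_shift bc]. rewrite IH.
  replace (RtoC (INR (fact (S n)))) with (RtoC (INR (S n)) * RtoC (INR (fact n)))%C.
  - field. apply RtoC_INR_S_neq.
  - rewrite <- RtoC_mult, <- mult_INR. reflexivity.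
Qed.

Lemma Clim_INR_inv : Clim (fun n => / RtoC (INR (S n)))%C 0.
Proof.
  apply (Clim_ext (fun n => RtoC (/ INR (S n)))).
  - intro n. apply RtoC_inv. apply not_0_INR. lia.
  - apply Clim_RtoC, is_lim_seq_INR_inv.
Qed.

Lemma Clim_1_plus_div (s : C) : Clim (fun n => 1 + s / RtoC (INR n))%C 1.
Proof.
  apply Clim_shift. assert (G := Clim_plus _ _ _ _ (Clim_const 1) (Clim_scal s _ _ Clim_INR_inv)).
  replace (1 + s * 0)%C with (RtoC 1) in G by ring. exact G.
Qed.

(** [gauss_seq s n] is the inverse of (1 + s/n) [wg s n] as soon as the latter is nonzero, which the
    nonzero limit guarantees for large n. *)
Lemma Gamma_eq_inv_rGamma (s : C) : rGamma s <> RtoC 0 -> Gamma s = (/ rGamma s)%C.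
Proof.
  intro N.
  assert (Lim : Clim (gauss_seq s) (/ rGamma s)%C).
  { assert (L1 : Clim (fun n => (1 + s / RtoC (INR n)) * wg s n)%C (rGamma s)).
    { rewrite <- (Cmult_1_l (rGamma s)). apply Clim_mult; [apply Clim_1_plus_div | apply wg_Clim]. }
    assert (P := N). apply Cmod_gt_0 in P.
    destruct (L1 _ P) as [n0 B].
    apply (Clim_ext_loc (fun n => / ((1 + s / RtoC (INR n)) * wg s n))%C _ _ (S n0)).
    - intros n L. specialize (B n ltac:(lia)).
      assert (Nz : ((1 + s / RtoC (INR n)) * wg s n)%C <> RtoC 0).
      { intro E. rewrite E in B. replace (0 - rGamma s)%C with (- rGamma s)%C in B by ring.
        rewrite Cmod_opp in B. lra. }
      assert (Pn : 0 < INR n) by (apply lt_0_INR; lia).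
      assert (Nn : RtoC (INR n) <> RtoC 0) by (apply RtoC_neq; lra).
      assert (N1 : (s + RtoC (INR n))%C <> RtoC 0).
      { intro E. apply Nz. replace (1 + s / RtoC (INR n))%C with ((s + RtoC (INR n)) / RtoC (INR n))%C
        by (field; exact Nn).
        rewrite E. unfold Cdiv. ring. }
      assert (N2 : bc s n <> RtoC 0) by (intro E; apply Nz; unfold wg; rewrite E; ring).
      assert (N3 := Ccpow_neq_0 (RtoC (INR n)) s).
      assert (N4 : RtoC (INR (fact n)) <> RtoC 0) by (apply RtoC_neq, INR_fact_neq_0).
      unfold gauss_seq, wg. rewrite Cprod_shift_bc.
      replace (Ccpow (RtoC (INR n)) (1 - s)) with (RtoC (INR n) / Ccpow (RtoC (INR n)) s)%C.
      + field. repeat split; assumption.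
      + unfold Cminus. rewrite Ccpow_plus, Ccpow_opp, Ccpow_1_r by (simpl; exact Pn). reflexivity.
    - apply Clim_inv; assumption. }
  apply Clim_is_lim_seq in Lim. destruct Lim as [R1 R2].
  apply is_lim_seq_unique in R1, R2. unfold Gamma. rewrite R1, R2.
  destruct (/ rGamma s)%C; reflexivity.
Qed.

(** The functional equation holds before the limit in the form (1 + s/n) wg s n = s wg (s+1) n, by
    [bc_shift]. *)
Lemma rGamma_S (s : C) : rGamma s = (s * rGamma (s + 1))%C.
Proof.
  apply (Clim_unique (fun n => (1 + s / RtoC (INR n)) * wg s n)%C).
  - rewrite <- (Cmult_1_l (rGamma s)). apply Clim_mult; [apply Clim_1_plus_div | apply wg_Clim].
  - apply (Clim_ext_loc (fun n => s * wg (s + 1) n)%C _ _ 1).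
    + intros n L. assert (Pn : 0 < INR n) by (apply lt_0_INR; lia).
      assert (Nn : RtoC (INR n) <> RtoC 0) by (apply RtoC_neq; lra).
      unfold wg. rewrite Cmult_assoc, <- bc_shift.
      replace (1 - s)%C with ((1 - (s + 1)) + 1)%C by ring.
      rewrite Ccpow_plus, Ccpow_1_r by (simpl; exact Pn). field. exact Nn.
    + apply Clim_scal, wg_Clim.
Qed.

Lemma rGamma_shift (s : C) (v : nat) :
  rGamma s = (RtoC (INR (fact v)) * bc s v * rGamma (s + RtoC (INR v)))%C.
Proof.
  induction v as [|v IH].
  - change (INR 0) with 0. simpl. rewrite Cplus_0_r. ring.
  - rewrite IH, rGamma_S. cbn [bc].
    replace (s + RtoC (INR v) + 1)%C with (s + RtoC (INR (S v)))%C by (rewrite S_INR, RtoC_plus; ring).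
    replace (RtoC (INR (fact (S v)))) with (RtoC (INR (S v)) * RtoC (INR (fact v)))%C
      by (rewrite <- RtoC_mult, <- mult_INR; reflexivity).
    field. apply RtoC_INR_S_neq.
Qed.

Lemma bc_1 (n : nat) : bc 1 n = RtoC 1.
Proof.
  induction n as [|n IH]; [reflexivity|]. cbn [bc]. rewrite IH, S_INR, RtoC_plus.
  field. exact (RtoC_INR_plus1_neq n).
Qed.

Lemma rGamma_1 : rGamma 1 = RtoC 1.
Proof.
  apply (Clim_unique _ _ _ (wg_Clim 1)).
  apply (Clim_ext (fun _ => RtoC 1)); [|apply Clim_const].
  intro n. unfold wg. rewrite bc_1. replace (1 - 1)%C with (RtoC 0) by ring.
  rewrite Ccpow_0_r. ring.
Qed.

Lemma rGamma_Re_pos (s : C) : 0 < Re s -> rGamma s <> RtoC 0.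
Proof.
  intro H. apply rGamma_neq_0. intros n. apply Re_pos_neq.
  change (0 < Re s + INR n). generalize (pos_INR n). lra.
Qed.

Lemma Gamma_INR (v : nat) : Gamma (RtoC (INR (S v))) = RtoC (INR (fact v)).
Proof.
  assert (E := rGamma_shift 1 v). rewrite rGamma_1, bc_1 in E.
  replace (1 + RtoC (INR v))%C with (RtoC (INR (S v))) in E by (rewrite S_INR, RtoC_plus; ring).
  assert (N : rGamma (RtoC (INR (S v))) <> RtoC 0) by (apply rGamma_Re_pos, INR_S_pos).
  rewrite Gamma_eq_inv_rGamma by exact N.
  transitivity ((RtoC (INR (fact v)) * 1 * rGamma (RtoC (INR (S v)))) * / rGamma (RtoC (INR (S v))))%C.
  - rewrite <- E. ring.
  - field. exact N.
Qed.

(** * Lipschitz's summation formula *)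

Lemma INR_S_ge_1 (n : nat) : 1 <= INR (S n).
Proof. apply (le_INR 1). lia. Qed.

Lemma ln_INR_S_pos (n : nat) : 0 <= ln (INR (S n)).
Proof. rewrite <- ln_1. apply ln_le; [lra | apply INR_S_ge_1]. Qed.

(** With e = p - 1, the estimate (m+1)^(-p) <= (m^(-e) - (m+1)^(-e)) / e telescopes; it follows from
    ln (1 + 1/m) >= 1/(m+1). *)
Lemma ex_series_riemann (p : R) : 1 < p -> ex_series (fun n => exp (- p * ln (INR (S n)))).
Proof.
  intro Hp. set (e := p - 1). assert (He : 0 < e) by (unfold e; lra).
  set (b := fun n => exp (- p * ln (INR (S n)))).
  set (f := fun n => exp (- e * ln (INR (S n)))).
  assert (Step : forall n, b (S n) <= / e * (f n - f (S n))).
  { intro n. unfold b, f.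
    destruct (ln_1p_bounds (S n)) as [Lo _]; [lia|].
    set (m := INR (S n)) in *. assert (Hm : 1 <= m) by apply INR_S_ge_1.
    set (l := ln (1 + / m)) in *.
    assert (El : ln (INR (S (S n))) = ln m + l).
    { assert (0 < / m) by (apply Rinv_0_lt_compat; lra).
      unfold l. rewrite <- ln_mult by lra. f_equal. rewrite (S_INR (S n)). fold m. field. lra. }
    set (t := exp (- e * (ln m + l))).
    assert (Ht : 0 < t) by apply exp_pos.
    assert (E1 : exp (- p * ln (INR (S (S n)))) = t * / (m + 1)).
    { rewrite El. unfold t. replace (- p * (ln m + l)) with (- e * (ln m + l) + - (ln m + l)) by (unfold e; ring).
      rewrite exp_plus. f_equal. rewrite <- El, exp_Ropp, exp_ln by apply INR_S_pos.
      reflexivity. }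
    assert (E2 : exp (- e * ln m) = t * exp (e * l)).
    { unfold t. rewrite <- exp_plus. f_equal. ring. }
    rewrite E1, E2, El. fold t.
    assert (X := exp_ineq1_le (e * l)).
    apply Rmult_le_reg_l with e; [exact He|].
    replace (e * (/ e * (t * exp (e * l) - t))) with (t * (exp (e * l) - 1)) by (field; lra).
    replace (e * (t * / (m + 1))) with (t * (e * / (m + 1))) by ring.
    apply Rmult_le_compat_l; [lra|].
    assert (e * / (m + 1) <= e * l) by (apply Rmult_le_compat_l; lra). lra. }
  assert (Bd : forall n, sum_n b n <= 1 + / e * (1 - f n)).
  { assert (Z : f 0%nat = 1) by (unfold f; simpl; rewrite ln_1, Rmult_0_r; apply exp_0).
    induction n as [|n IH].
    - rewrite sum_O, Z. unfold b. simpl. rewrite ln_1, Rmult_0_r, exp_0. lra.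
    - rewrite sum_Sn. change (sum_n b n + b (S n) <= 1 + / e * (1 - f (S n))).
      specialize (Step n). lra. }
  assert (Ie : 0 < / e) by now apply Rinv_0_lt_compat.
  assert (L : ex_finite_lim_seq (sum_n b)).
  { apply ex_finite_lim_seq_incr with (1 + / e).
    - intro n. rewrite sum_Sn. change (sum_n b n <= sum_n b n + b (S n)).
      generalize (exp_pos (- p * ln (INR (S (S n))))). unfold b. lra.
    - intro n. specialize (Bd n). assert (0 < f n) by apply exp_pos. nra. }
  destruct L as [l Hl]. exists l. exact Hl.
Qed.

(** From ln (c n) <= c n - 1 with c = x / (2 B), the power n^B is at most a constant times exp (n x
    / 2). Half of the exponential decay is left, a geometric series of ratio exp (-x/2). *)
Lemma ex_series_pow_exp (A x : R) : 0 < x ->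
  ex_series (fun n => exp (A * ln (INR (S n))) * exp (- INR (S n) * x)).
Proof.
  intro Hx. set (B := Rabs A + 1). assert (HB : 0 < B) by (unfold B; generalize (Rabs_pos A); lra).
  set (c := x / (2 * B)). assert (Hc : 0 < c) by (unfold c; apply Rdiv_lt_0_compat; lra).
  set (q := exp (- (x / 2))).
  assert (Hq : Rabs q < 1).
  { unfold q. rewrite Rabs_pos_eq by (left; apply exp_pos). rewrite <- exp_0. apply exp_increasing. lra. }
  apply (ex_series_le (V := R_CompleteNormedModule) _ (fun n => exp (B * (- 1 - ln c)) * q * q ^ n)).
  - intro n. unfold norm; simpl norm. unfold abs; simpl abs.
    rewrite Rabs_pos_eq by (left; apply Rmult_lt_0_compat; apply exp_pos).
    assert (Eq : q * q ^ n = exp (- (x / 2) * INR (S n))).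
    { change (q * q ^ n) with (q ^ S n). unfold q. induction (S n) as [|k IH].
      - simpl. rewrite Rmult_0_r, exp_0. reflexivity.
      - rewrite S_INR. replace (- (x / 2) * (INR k + 1)) with (- (x / 2) + - (x / 2) * INR k) by ring.
        rewrite exp_plus, <- IH. reflexivity. }
    rewrite Rmult_assoc, Eq, <- !exp_plus. apply exp_monotone.
    assert (P := INR_S_pos n). assert (Q := ln_INR_S_pos n).
    assert (A * ln (INR (S n)) <= B * ln (INR (S n))).
    { apply Rmult_le_compat_r; [exact Q|]. unfold B. generalize (Rle_abs A). lra. }
    assert (ln c + ln (INR (S n)) <= c * INR (S n) - 1).
    { rewrite <- ln_mult by lra. rewrite <- (ln_exp (c * INR (S n) - 1)).
      apply ln_le; [now apply Rmult_lt_0_compat|]. generalize (exp_ineq1_le (c * INR (S n) - 1)). lra. }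
    assert (B * ln (INR (S n)) <= B * (c * INR (S n) - 1 - ln c)) by (apply Rmult_le_compat_l; lra).
    replace (B * (c * INR (S n) - 1 - ln c)) with (x / 2 * INR (S n) + B * (-1 - ln c)) in H1
      by (unfold c; field; lra).
    lra.
  - apply (ex_series_scal (V := R_NormedModule)). exists (/ (1 - q)). now apply is_series_geom.
Qed.

(** * Averaging over roots of unity *)

Lemma sin_ge_half (t : R) : 0 <= t <= PI / 4 -> t / 2 <= sin t.
Proof.
  intro H. assert (P := PI_RGT_0).
  destruct (MVT_gen sin 0 t cos) as (c & Hc & E).
  - intros u _. auto_derive; [exact I | ring].
  - intros u _. apply continuity_sin.
  - rewrite Rmin_left, Rmax_right in Hc by lra. rewrite sin_0, !Rminus_0_r in E. rewrite E.
    assert (1 / 2 <= cos c) by (rewrite <- cos_PI3; apply cos_decr_1; lra).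
    nra.
Qed.

(** A lower bound for the distance from 1 to the ray of angle t or -t. It is linear in t and uniform
    in the radius r, which is what turns into a summable majorant for [lipschitz_formula]. *)
Lemma one_minus_polar_bound (r t : R) : 0 <= r -> 0 <= t <= PI -> 
  t / 4 <= Cmod (1 - RtoC r * (cos t, sin t)) /\ t / 4 <= Cmod (1 - RtoC r * (cos t, - sin t)).
Proof.
  intros Hr Ht. assert (P4 := PI_4). assert (P0 := PI_RGT_0).
  assert (K : forall s, Rabs s = Rabs (sin t) -> t / 4 <= Cmod (1 - RtoC r * (cos t, s))).
  { intros s Hs.
    assert (S2 : s * s = sin t * sin t).
    { assert (X : Rsqr s = Rsqr (sin t)) by now apply Rsqr_eq_asb_1. exact X. }
    assert (CS : sin t * sin t + cos t * cos t = 1) by apply sin2_cos2.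
    apply Rsqr_incr_0; [|lra | apply Cmod_ge_0]. unfold Rsqr. rewrite Cmod_sqr.
    unfold Re, Im. simpl.
    replace ((1 + - (r * cos t - 0 * s)) * (1 + - (r * cos t - 0 * s)) +
      (0 + - (r * s + 0 * cos t)) * (0 + - (r * s + 0 * cos t))) with
      (1 - 2 * r * cos t + r * r * (cos t * cos t + s * s)) by ring.
    rewrite S2. replace (cos t * cos t + sin t * sin t) with 1 by lra.
    destruct (Rle_dec (PI / 2) t) as [L|L].
    - assert (cos t <= 0) by (apply cos_le_0; lra). assert (t / 4 <= 1) by lra. nra.
    - assert (C0 : 0 <= cos t) by (apply cos_ge_0; lra).
      assert (C1 : cos t = 1 - 2 * sin (t / 2) * sin (t / 2)).
      { rewrite <- cos_2a_sin. f_equal. field. }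
      assert (SH := sin_ge_half (t / 2) ltac:(lra)).
      (* From (r - cos t)^2 >= 0 the squared distance is at least sin(t)^2, which for cos t >= 0 is
         at least 1 - cos t = 2 sin(t/2)^2 >= 2 (t/4)^2. *)
      assert (sin t * sin t <= 1 - 2 * r * cos t + r * r * 1) by (generalize (Rle_0_sqr (r - cos t)); unfold Rsqr; nra).
      assert (1 - cos t <= sin t * sin t) by (generalize (COS_bound t); nra).
      nra. }
  split; apply K; [reflexivity | apply Rabs_Ropp].
Qed.

(** With z' = 1/z this is the sum of z^j over |j| <= L + 1. The number 2 L + 3 of terms is odd, so j
    and -j pair up as in the two-sided sum of Lipschitz's formula. *)
Definition omega_sum (z z' : C) (L : nat) : C := (1 + sum_n (fun j => z ^ S j + z' ^ S j)%C L)%C.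

Lemma omega_sum_telescope (z z' : C) (L : nat) : (z * z')%C = RtoC 1 ->
  ((z - 1) * omega_sum z z' L = z ^ S (S L) - z' ^ S L)%C.
Proof.
  intro E. unfold omega_sum. induction L as [|L IH].
  - rewrite sum_O. simpl. 
    replace ((z - 1) * (1 + (z * 1 + z' * 1)))%C with (z * z + (z * z') - z' - 1)%C by ring.
    rewrite E. ring.
  - rewrite sum_Sn. set (Sg := sum_n _ L) in *. change (plus Sg ?x) with (Sg + x)%C.
    replace ((z - 1) * (1 + (Sg + (z ^ S (S L) + z' ^ S (S L)))))%C with
      ((z - 1) * (1 + Sg) + z * z ^ S (S L) + (z * z') * z' ^ S L - z ^ S (S L) - z' ^ S (S L))%C
      by (rewrite !Cpow_S; ring).
    rewrite IH, E. rewrite !Cpow_S. ring.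
Qed.

Lemma omega_sum_1 (L : nat) : omega_sum 1 1 L = RtoC (INR (2 * L + 3)).
Proof.
  unfold omega_sum. induction L as [|L IH].
  - rewrite sum_O. simpl. rewrite <- !RtoC_mult, <- !RtoC_plus. f_equal. ring.
  - rewrite sum_Sn. set (Sg := sum_n _ L) in *. change (plus Sg ?x) with (Sg + x)%C.
    rewrite !Cpow_1_l. replace (2 * S L + 3)%nat with (S (S (2 * L + 3))) by lia.
    rewrite !S_INR, !RtoC_plus, <- IH. ring.
Qed.

Lemma Cexp_2PI_INR (t : R) (k : nat) :
  Cexp (0, t + 2 * INR k * PI) = Cexp (0, t).
Proof. unfold Cexp, Re, Im. simpl. rewrite cos_period, sin_period. reflexivity. Qed.

Lemma Cexp_imag_opp (t : R) : (Cexp (0, t) * Cexp (0, (- t)%R))%C = RtoC 1.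
Proof.
  rewrite <- Cexp_plus. replace ((0, t) + (0, (- t)%R))%C with (RtoC 0) by (apply Ceq; simpl; ring).
  apply Cexp_0.
Qed.

(** For M not dividing k the telescoped ends z^(L+2) and z^(-(L+1)) coincide, since (L+2) + (L+1) =
    M and z^M = 1, while z - 1 is nonzero. *)
Lemma root_of_unity_filter (L k : nat) :
  let M := (2 * L + 3)%nat in
  let t := 2 * PI * INR k / INR M in
  omega_sum (Cexp (0, t)) (Cexp (0, - t)) L =
    if Nat.eqb (k mod M) 0 then RtoC (INR M) else RtoC 0.
Proof.
  intros M t. assert (PM : 0 < INR M) by (apply lt_0_INR; unfold M; lia).
  assert (P := PI_RGT_0).
  assert (Hd := Nat.div_mod_eq k M). set (d := (k / M)%nat) in *. set (r := (k mod M)%nat) in *.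
  assert (Hr : (r < M)%nat) by (apply Nat.mod_upper_bound; unfold M; lia).
  assert (Et : t = 2 * PI * INR r / INR M + 2 * INR d * PI).
  { unfold t. rewrite Hd, plus_INR, mult_INR. field. lra. }
  assert (Ez : Cexp (0, t) = Cexp (0, 2 * PI * INR r / INR M)) by (rewrite Et; apply Cexp_2PI_INR).
  assert (Inv := Cexp_imag_opp t).
  destruct (Nat.eqb_spec r 0) as [E0|N0].
  - assert (E1 : Cexp (0, t) = RtoC 1).
    { rewrite Ez, E0. replace (2 * PI * INR 0 / INR M) with 0 by (simpl; field; lra). apply Cexp_0. }
    rewrite E1 in *. rewrite Cmult_1_l in Inv. rewrite Inv. apply omega_sum_1.
  - assert (N1 : (Cexp (0, t) - 1)%C <> RtoC 0).
    { intro E. apply Ceq_minus in E. rewrite Ez in E. apply (f_equal Re) in E.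
      unfold Cexp, Re, Im in E. simpl in E. rewrite exp_0, Rmult_1_l in E.
      set (u := 2 * PI * INR r / INR M) in *.
      assert (Ir : 0 < INR r < INR M) by (split; [apply lt_0_INR; lia | now apply lt_INR]).
      assert (Hu : 0 < u / 2 < PI).
      { unfold u. replace (2 * PI * INR r / INR M / 2) with (PI * (INR r / INR M)) by (field; lra).
        assert (0 < INR r / INR M < 1).
        { split; [apply Rdiv_lt_0_compat; lra|]. apply Rmult_lt_reg_r with (INR M); [lra|].
          unfold Rdiv. rewrite Rmult_assoc, Rinv_l; lra. }
        nra. }
      assert (0 < sin (u / 2)) by (apply sin_gt_0; lra).
      replace u with (2 * (u / 2)) in E by field. rewrite cos_2a_sin in E. nra. }
    assert (T := omega_sum_telescope _ _ L Inv).
    assert (Z : (Cexp (0, t) ^ S (S L) - Cexp (0, (- t)%R) ^ S L)%C = RtoC 0).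
    { rewrite !Cexp_pow. apply (proj1 (Ceq_minus _ _)).
      replace (RtoC (INR (S (S L))) * (0, t))%C with (0, - t * INR (S L) + 2 * INR k * PI).
      - rewrite Cexp_2PI_INR. f_equal. apply Ceq; unfold Re, Im; cbn [fst snd Cmult RtoC]; ring.
      - apply Ceq; unfold Re, Im; cbn [fst snd Cmult RtoC]; [ring|].
        replace (2 * INR k * PI) with (t * INR M) by (unfold t; field; lra).
        replace (INR M) with (INR (S (S L)) + INR (S L)); [ring|].
        rewrite <- plus_INR. f_equal. unfold M. lia. }
    rewrite Z in T. 
    transitivity (/ (Cexp (0, t) - 1) * ((Cexp (0, t) - 1) * omega_sum (Cexp (0, t)) (Cexp (0, (- t)%R)) L))%C.
    + field. exact N1.
    + rewrite T. ring.
Qed.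

Lemma sum_n_zero_tail (u : nat -> C) (n r : nat) :
  (forall k, (n < k <= n + r)%nat -> u k = RtoC 0) -> sum_n u (n + r) = sum_n u n.
Proof.
  intro H. induction r as [|r IH]; [f_equal; lia|].
  replace (n + S r)%nat with (S (n + r)) by lia. rewrite sum_Sn, IH, H by (intros; try apply H; lia).
  change (plus ?x (RtoC 0)) with (x + 0)%C. apply Cplus_0_r.
Qed.

Lemma Csum_sieve (u : nat -> C) (M : nat) (l : C) : (1 <= M)%nat ->
  (forall k, (k mod M <> 0)%nat -> u k = RtoC 0) -> Csum u l -> Csum (fun p => u (M * p)%nat) l.
Proof.
  intros HM H Hs.
  apply (Clim_ext (fun p => sum_n u (M * p))).
  - intro p. induction p as [|p IH].
    + rewrite Nat.mul_0_r, !sum_O. now rewrite Nat.mul_0_r.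
    + rewrite sum_Sn, <- IH. replace (M * S p)%nat with (S (M * p + (M - 1))) by lia.
      rewrite sum_Sn, sum_n_zero_tail; [reflexivity|].
      intros k Hk. apply H. intro E. apply Nat.Div0.mod_divides in E. destruct E as
        [c Ec]. subst k. destruct (Nat.le_gt_cases c p); nia.
  - apply (Clim_subseq (sum_n u) l (fun p => (M * p)%nat)); [intro; nia | exact Hs].
Qed.

Lemma Csum_finite (u : nat -> C) (L : nat) : (forall k, (L < k)%nat -> u k = RtoC 0) ->
  Csum u (sum_n u L).
Proof.
  intro H. apply (Clim_ext_loc (fun _ => sum_n u L) _ _ L); [|apply Clim_const].
  intros n Hn. replace n with (L + (n - L))%nat by lia. symmetry. apply sum_n_zero_tail.
  intros. apply H. lia.
Qed.

Lemma Csum_sum_n (U : nat -> nat -> C) (l : nat -> C) (L : nat) : (forall j, Csum (U j) (l j)) ->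
  Csum (fun k => sum_n (fun j => U j k) L) (sum_n l L).
Proof.
  intro H. induction L as [|L IH].
  - rewrite sum_O. apply (Csum_ext (U 0%nat)); [intro; now rewrite sum_O | apply H].
  - rewrite sum_Sn. apply (Csum_ext (fun k => sum_n (fun j => U j k) L + U (S L) k)%C).
    + intro. now rewrite sum_Sn.
    + now apply Csum_plus.
Qed.

Lemma Cmod_Cexp_lt_1 (z : C) : Re z < 0 -> Cmod (Cexp z) < 1.
Proof. intro H. rewrite Cmod_Cexp, <- exp_0. now apply exp_increasing. Qed.

Lemma Re_one_minus_Cexp_pos (z : C) : Re z < 0 -> 0 < Re (1 - Cexp z).
Proof.
  intro H. assert (Q := Cmod_Cexp_lt_1 z H). assert (X := re_le_Cmod (Cexp z)).
  apply Rabs_le_between in X. change (Re (1 - Cexp z)) with (1 - Re (Cexp z)). lra.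
Qed.

(* [lz x M t] is [- (x + i t) / M]. *)
Definition lz (x M t : R) : C := ((- x / M)%R, (- t / M)%R).

(** Adding the binomial series at the points exp (-(x + 2 pi i j) / M), |j| <= L + 1, keeps only the
    exponents k = M p, each with weight M; there the common factor is exp (-p x). *)
Lemma lipschitz_finite (a : C) (x : R) (L : nat) : 0 < x ->
  let M := (2 * L + 3)%nat in
  Csum (fun p => RtoC (INR M) * bc a (M * p) * RtoC (exp (- INR p * x)))%C
   (Ccpow (1 - Cexp (lz x (INR M) 0)) (- a) +
    sum_n (fun j => Ccpow (1 - Cexp (lz x (INR M) (2 * PI * INR (S j))%R)) (- a) +
                    Ccpow (1 - Cexp (lz x (INR M) (- (2 * PI * INR (S j)))%R)) (- a))%C L).
Proof.
  intros Hx M. assert (PM : 0 < INR M) by (apply lt_0_INR; unfold M; lia).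
  assert (Rz : forall t, Re (lz x (INR M) t) < 0).
  { intro t. unfold lz, Re. simpl. replace (- x / INR M) with (- (x / INR M)) by (field; lra).
    assert (0 < x / INR M) by (apply Rdiv_lt_0_compat; lra). lra. }
  assert (S1 : forall t, Csum (fun k => bc a k
    * Cexp (lz x (INR M) t) ^ k)%C (Ccpow (1 - Cexp (lz x (INR M) t)) (- a))).
  { intro t. apply binomial_series, Cmod_Cexp_lt_1, Rz. }
  set (w := fun k => 2 * PI * INR k / INR M).
  assert (Eq : forall j k, (Cexp (lz x (INR M) (2 * PI * INR (S j))%R) ^ k)%C =
    (Cexp (lz x (INR M) 0) ^ k * Cexp (0, (- w k)%R) ^ S j)%C).
  { intros j k. rewrite !Cexp_pow, <- Cexp_plus. f_equal. unfold w, lz.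
    apply Ceq; unfold Re, Im; cbn [fst snd Cmult Cplus RtoC]; field; lra. }
  assert (Eq' : forall j k, (Cexp (lz x (INR M) (- (2 * PI * INR (S j)))%R) ^ k)%C =
    (Cexp (lz x (INR M) 0) ^ k * Cexp (0, w k) ^ S j)%C).
  { intros j k. rewrite !Cexp_pow, <- Cexp_plus. f_equal. unfold w, lz.
    apply Ceq; unfold Re, Im; cbn [fst snd Cmult Cplus RtoC]; field; lra. }
  assert (S2 := Csum_plus _ _ _ _ (S1 0) (Csum_sum_n _ _ L (fun j => Csum_plus _ _ _ _ (S1 (2 * PI
    * INR (S j))) (S1 (- (2 * PI * INR (S j))))))).
  cbv beta in S2.
  set (T := fun k => (bc a k * Cexp (lz x (INR M) 0) ^ k * (if Nat.eqb (k mod M) 0 then RtoC (INR M) else RtoC 0))%C).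
  match type of S2 with Csum ?u ?l => assert (S3 : Csum T l); [apply (Csum_ext u T l); [intro k | exact S2] |] end.
  { unfold T, M. rewrite <- root_of_unity_filter. fold M. fold (w k). unfold omega_sum.
    rewrite Cmult_plus_distr_l, Cmult_1_r. f_equal.
    rewrite <- (sum_n_mult_l (K := C_Ring)). apply sum_n_ext. intro j. rewrite Eq, Eq'.
    match goal with |- @eq _ ?p ?q => change (@eq C p q) end.
    change (mult ?x ?y) with (x * y)%C. ring. }
  apply (Csum_sieve _ M) in S3; [|unfold M; lia |].
  - eapply Csum_ext; [|exact S3]. intro p. unfold T. cbv beta.
    replace ((M * p) mod M)%nat with 0%nat by (rewrite Nat.mul_comm; symmetry; apply Nat.Div0.mod_mul).
    simpl Nat.eqb. cbv iota. rewrite Cexp_pow, <- Cexp_RtoC.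
    replace (RtoC (INR (M * p)) * lz x (INR M) 0)%C with (RtoC (- INR p * x)); [ring|].
    unfold lz. rewrite mult_INR. apply Ceq; unfold Re, Im; cbn [fst snd Cmult RtoC]; field; lra.
  - intros k Hk. unfold T. destruct (Nat.eqb_spec (k mod M) 0) as [E|_]; [contradiction|]. ring.
Qed.

Lemma Cmod_Ccpow_decay (z b : C) (m : R) : 0 <= Re b -> 0 < m <= Cmod z ->
  Cmod (Ccpow z (- b)) <= exp (Rabs (Im b) * (PI / 2)) * exp (- Re b * ln m).
Proof.
  intros Hb Hm. eapply Rle_trans; [apply Cmod_Ccpow_le|].
  change (Re (- b)) with (- Re b). change (Im (- b)) with (- Im b). rewrite Rabs_Ropp, Rmult_comm.
  apply Rmult_le_compat_l; [left; apply exp_pos|]. apply exp_monotone.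
  assert (ln m <= ln (Cmod z)) by (apply ln_le; lra). nra.
Qed.

Lemma Csum_shift (u : nat -> C) (l : C) : Csum u l -> Csum (fun p => u (S p)) (l - u 0%nat).
Proof.
  intro H. apply (Clim_ext (fun n => sum_n u (S n) - u 0%nat)%C).
  - intro n. induction n as [|n IH].
    + rewrite sum_Sn, !sum_O. change (plus ?x ?y) with (x + y)%C. ring.
    + rewrite (sum_Sn u (S n)), (sum_Sn (fun p => u (S p)) n), <- IH. change (plus ?x ?y) with (x + y)%C. ring.
  - apply Clim_minus; [|apply Clim_const].
    apply (Clim_subseq (sum_n u) l S); [intro; lia | exact H].
Qed.

Lemma is_lim_seq_inv_odd : is_lim_seq (fun L => / INR (2 * L + 3)) 0.
Proof.
  apply (is_lim_seq_le_le (fun _ => 0) _ (fun L => / INR (S L))).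
  - intro L. split.
    + left. apply Rinv_0_lt_compat, lt_0_INR. lia.
    + apply Rinv_le_contravar; [apply INR_S_pos | apply le_INR; lia].
  - apply is_lim_seq_const.
  - apply is_lim_seq_INR_inv.
Qed.

Lemma Clim_scaled_one_minus_Cexp (x t : R) :
  Clim (fun L => RtoC (INR (2 * L + 3)) * (1 - Cexp (lz x (INR (2 * L + 3)) t)))%C (x, t).
Proof.
  set (K := 8 * (Cmod (x, t) * Cmod (x, t)) * exp (Cmod (x, t))).
  apply Clim_Cmod.
  apply (is_lim_seq_le_le (fun _ => 0) _ (fun L => K * / INR (2 * L + 3))).
  - intro L. split; [apply Cmod_ge_0|]. set (M := INR (2 * L + 3)).
    assert (HM : 1 <= M) by (apply (le_INR 1); lia).
    assert (I : 0 < / M <= 1).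
    { split; [apply Rinv_0_lt_compat; lra|]. rewrite <- Rinv_1. apply Rinv_le_contravar; lra. }
    assert (El : lz x M t = (- (RtoC (/ M) * (x, t)))%C).
    { unfold lz. apply Ceq; unfold Re, Im; simpl; field; lra. }
    rewrite El. set (z := (x, t)) in *.
    assert (N : RtoC M <> RtoC 0) by (apply RtoC_neq; lra).
    replace (RtoC M * (1 - Cexp (- (RtoC (/ M) * z))) - z)%C with
      (- (RtoC M * (Cexp (- (RtoC (/ M) * z)) - 1 - - (RtoC (/ M) * z))))%C
      by (rewrite RtoC_inv by lra; field; exact N).
    rewrite Cmod_opp, Cmod_mult, Cmod_R, Rabs_pos_eq by lra.
    assert (T := Cexp_taylor2_exp (- (RtoC (/ M) * z))).
    rewrite Cmod_opp, Cmod_mult, Cmod_R, (Rabs_pos_eq (/ M)) in T by lra.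
    assert (Z0 := Cmod_ge_0 z).
    assert (E : exp (/ M * Cmod z) <= exp (Cmod z)) by (apply exp_monotone; nra).
    apply Rle_trans with (M * (8 * (/ M * Cmod z * (/ M * Cmod z)) * exp (Cmod z))).
    + apply Rmult_le_compat_l; [lra|]. eapply Rle_trans; [exact T|].
      apply Rmult_le_compat_l; [|exact E]. assert (0 <= / M * Cmod z) by nra. nra.
    + right. unfold K. fold z. field. lra.
  - apply is_lim_seq_const.
  - replace (Finite 0) with (Finite (K * 0)) by (f_equal; ring).
    apply is_lim_seq_mult'; [apply is_lim_seq_const | apply is_lim_seq_inv_odd].
Qed.

Lemma Cexp_lz (x M t : R) : Cexp (lz x M t) = (RtoC (exp (- x / M)) * (cos (- t / M), sin (- t / M)))%C.
Proof. unfold lz, Cexp, Re, Im. simpl. apply Ceq; simpl; ring. Qed.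

(** Since 2 (j + 1) <= M the angle t = 2 pi (j + 1) / M is at most pi, so the bound t/4 applies, and
    M t / 4 = (pi/2) (j + 1). Nothing depends on L any more. *)
Lemma scaled_one_minus_Cexp_bound (x : R) (L j : nat) (s : R) : 0 < x -> (j <= L)%nat -> (s = 1 \/ s = -1) ->
  INR (S j) <= Cmod (RtoC (INR (2 * L + 3)) * (1 - Cexp (lz x (INR (2 * L + 3)) (s * (2 * PI * INR (S j)))))).
Proof.
  intros Hx Hj Hs. set (M := INR (2 * L + 3)).
  assert (HM : 2 * INR (S j) <= M).
  { unfold M. replace 2 with (INR 2) by reflexivity. rewrite <- mult_INR. apply le_INR. lia. }
  assert (Pj := INR_S_ge_1 j). assert (P0 := PI_RGT_0).
  set (t := 2 * PI * INR (S j) / M).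
  assert (Ht : 0 <= t <= PI).
  { unfold t. split.
    - apply Rmult_le_pos; [nra | left; apply Rinv_0_lt_compat; lra].
    - apply Rmult_le_reg_r with M; [lra|]. unfold Rdiv. rewrite Rmult_assoc, Rinv_l by lra. nra. }
  destruct (one_minus_polar_bound (exp (- x / M)) t) as [B1 B2]; [left; apply exp_pos | exact Ht |].
  assert (B : t / 4 <= Cmod (1 - Cexp (lz x M (s * (2 * PI * INR (S j)))))).
  { rewrite Cexp_lz. destruct Hs as [-> | ->].
    - replace (- (1 * (2 * PI * INR (S j))) / M) with (- t) by (unfold t; field; lra).
      rewrite cos_neg, sin_neg. exact B2.
    - replace (- (-1 * (2 * PI * INR (S j))) / M) with t by (unfold t; field; lra). exact B1. }
  rewrite Cmod_mult, Cmod_R, Rabs_pos_eq by lra.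
  apply Rle_trans with (M * (t / 4)); [|apply Rmult_le_compat_l; lra].
  replace (M * (t / 4)) with (PI / 2 * INR (S j)) by (unfold t; field; lra).
  generalize PI2_1. nra.
Qed.

Lemma Ccont_Ccpow_l (z a : C) : 0 < Re z -> Ccont (fun w => Ccpow w a) z.
Proof.
  intro H. eapply Cder_Ccont. apply (Cder_Ccpow_l a (fun w => w)); [exact H | apply Cder_id].
Qed.

Lemma lz_neg (x M t : R) : 0 < x -> 0 < M -> Re (lz x M t) < 0.
Proof.
  intros Hx HM. unfold lz, Re. simpl. replace (- x / M) with (- (x / M)) by (field; lra).
  assert (0 < x / M) by (apply Rdiv_lt_0_compat; lra). lra.
Qed.

Lemma is_lim_seq_power_neg (r : R) (phi : nat -> nat) : r < 0 -> (forall n, (n <= phi n)%nat) ->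
  is_lim_seq (fun n => exp (r * ln (INR (phi n)))) 0.
Proof.
  intros Hr Hphi. apply is_lim_seq_spec. intros e.
  destruct (INR_unbounded (exp (ln e / r))) as [n0 Hn0]. exists n0. intros n Hn.
  rewrite Rminus_0_r, Rabs_pos_eq by (left; apply exp_pos).
  rewrite <- (exp_ln e) by apply cond_pos. apply exp_increasing.
  assert (Q : exp (ln e / r) < INR (phi n)).
  { eapply Rlt_le_trans; [exact Hn0 | apply le_INR; specialize (Hphi n); lia]. }
  apply ln_increasing in Q; [|apply exp_pos]. rewrite ln_exp in Q.
  apply Rmult_lt_gt_compat_neg_l with (r := r) in Q; [|exact Hr].
  replace (r * (ln e / r)) with (ln e) in Q by (field; lra). exact Q.
Qed.

(* Gauss's form of Gamma makes this the limit [L -> oo] of [lipschitz_finite], which is the binomial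
   series of exponent [-a] sieved by the [M]-th roots of unity, [M = 2 L + 3]. *)
Theorem lipschitz_formula (a : C) (x : R) : 0 < x -> 1 < Re a ->
  (rGamma a * Cseries (fun p => Ccpow (RtoC (INR (S p))) (a - 1) * RtoC (exp (- INR (S p) * x))))%C =
  (Ccpow (RtoC x) (- a) + Cseries (fun j => Ccpow (x, (2 * PI * INR (S j))%R) (- a)
     + Ccpow (x, (- (2 * PI * INR (S j)))%R) (- a)))%C.
Proof.
  intros Hx Ha.
  set (M := fun L => (2 * L + 3)%nat).
  assert (PM : forall L, 0 < INR (M L)) by (intro; apply lt_0_INR; unfold M; lia).
  (* The finite identity is multiplied by M^(-a). On one side the base becomes M (1 - q), tending to
     x + i t; on the other, M^(1-a) bc a (M p) = wg a (M p) p^(a-1), which brings in 1/Gamma(a). *)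
  set (E := fun L t => Ccpow (RtoC (INR (M L)) * (1 - Cexp (lz x (INR (M L)) t))) (- a)).
  set (U := fun L p => (wg a (M L * S p) * (Ccpow (RtoC (INR (S p))) (a - 1) * RtoC (exp (- INR (S p) * x))))%C).
  (* Extended by 0 beyond L, so that finite sums of growing length become series to which [tannery]
     applies. *)
  set (V := fun L j => if Nat.leb j L then (E L (1 * (2 * PI * INR (S j)))%R + E L (-1 * (2 * PI
    * INR (S j)))%R)%C else RtoC 0).
  set (B := Cmod a). set (K := B * exp (2 * wK B)).
  assert (EL : forall L t, (Ccpow (RtoC (INR (M L))) (- a) * Ccpow (1 - Cexp (lz x (INR (M L)) t)) (- a))%C = E L t).
  { intros L t. unfold E. symmetry. apply Ccpow_scal; [apply PM|].
    now apply Re_one_minus_Cexp_pos, lz_neg. }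
  assert (UB : forall L p, Cmod (U L p) <= K * (exp ((Re a - 1) * ln (INR (S p))) * exp (- INR (S p) * x))).
  { intros L p. unfold U. rewrite !Cmod_mult, Cmod_Ccpow_RtoC by apply INR_S_pos.
    rewrite Cmod_R, Rabs_pos_eq by (left; apply exp_pos). change (Re (a - 1)) with (Re a - 1).
    apply Rmult_le_compat_r; [apply Rmult_le_pos; left; apply exp_pos|].
    apply wg_converges; [apply Rle_refl | unfold M; nia]. }
  assert (UE : ex_series (fun p => K * (exp ((Re a - 1) * ln (INR (S p))) * exp (- INR (S p) * x)))).
  { apply (ex_series_scal (V := R_NormedModule) K). now apply ex_series_pow_exp. }
  set (K2 := exp (Rabs (Im a) * (PI / 2))).
  assert (VB : forall L j, Cmod (V L j) <= (K2 * 2) * exp (- Re a * ln (INR (S j)))).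
  { intros L j. assert (0 < K2) by apply exp_pos. assert (X := exp_pos (- Re a * ln (INR (S j)))).
    unfold V. destruct (Nat.leb_spec j L) as [Lj|Lj].
    - eapply Rle_trans; [apply Cmod_triangle|].
      assert (G : forall s, s = 1 \/ s = -1 -> Cmod (E L (s * (2 * PI * INR (S j)))) <= K2 * exp (- Re a
        * ln (INR (S j)))).
      { intros s Hs. apply Cmod_Ccpow_decay; [lra|]. split; [apply INR_S_pos|].
        now apply scaled_one_minus_Cexp_bound. }
      generalize (G 1 ltac:(auto)) (G (-1) ltac:(auto)). lra.
    - rewrite Cmod_0. nra. }
  assert (VE : ex_series (fun j => (K2 * 2) * exp (- Re a * ln (INR (S j))))).
  { apply (ex_series_scal (V := R_NormedModule) (K2 * 2)). now apply ex_series_riemann. }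
  (* The term p = 0 is split off. It contributes M^(1-a), which tends to 0 because Re a > 1. *)
  assert (Fin : forall L, (Ccpow (RtoC (INR (M L))) (1 - a) + Cseries (U L) = E L 0 + Cseries (V L))%C).
  { intro L. assert (S1 := Csum_shift _ _ (lipschitz_finite a x L Hx)). cbv zeta beta in S1. fold (M L) in S1.
    assert (S2 := Csum_scal (Ccpow (RtoC (INR (M L))) (- a)) _ _ S1). cbv beta in S2.
    assert (Q : Ccpow (RtoC (INR (M L))) (1 - a) = (Ccpow (RtoC (INR (M L))) (- a) * RtoC (INR (M L)))%C).
    { replace (1 - a)%C with (- a + 1)%C by ring. rewrite Ccpow_plus, Ccpow_1_r by (simpl; apply PM). reflexivity. }
    assert (SU : Csum (U L) (Ccpow (RtoC (INR (M L))) (- a) *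
      (Ccpow (1 - Cexp (lz x (INR (M L)) 0)) (- a) +
       sum_n (fun j => Ccpow (1 - Cexp (lz x (INR (M L)) (2 * PI * INR (S j))%R)) (- a) +
                    Ccpow (1 - Cexp (lz x (INR (M L)) (- (2 * PI * INR (S j)))%R)) (- a))%C L
       - RtoC (INR (M L))))).
    { match type of S2 with Csum ?u ?l => replace (Ccpow _ _ * _)%C with l; [apply (Csum_ext u); [|exact S2]|] end.
      - intro p. cbv beta. unfold U, wg. rewrite mult_INR, RtoC_mult.
        rewrite (Ccpow_scal (INR (M L)) (RtoC (INR (S p)))) by (try apply PM; simpl; apply INR_S_pos).
        replace (1 - a)%C with (- (a - 1))%C at 2 by ring.
        rewrite (Ccpow_opp (RtoC (INR (S p)))), Q. field. apply Ccpow_neq_0.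
      - f_equal. f_equal. rewrite Nat.mul_0_r. change (INR 0) with 0. cbn [bc].
        replace (- 0 * x) with 0 by ring. rewrite exp_0. ring. }
    apply Csum_Cseries in SU. rewrite SU.
    assert (SV : Cseries (V L) = sum_n (V L) L).
    { apply Csum_Cseries, Csum_finite. intros k Hk. unfold V.
      destruct (Nat.leb_spec k L); [lia | reflexivity]. }
    rewrite SV, Q, <- EL.
    assert (SE : sum_n (V L) L = (Ccpow (RtoC (INR (M L))) (- a) * sum_n
      (fun j => Ccpow (1 - Cexp (lz x (INR (M L)) (2 * PI * INR (S j))%R)) (- a) +
                    Ccpow (1 - Cexp (lz x (INR (M L)) (- (2 * PI * INR (S j)))%R)) (- a))%C L)%C).
    { rewrite <- (sum_n_mult_l (K := C_Ring)). apply sum_n_ext_loc. intros j Hj. unfold V.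
      destruct (Nat.leb_spec j L); [|lia]. rewrite <- !EL.
      match goal with |- @eq _ ?p ?q => change (@eq C p q) end.
      change (mult ?x ?y) with (x * y)%C.
      replace (1 * (2 * PI * INR (S j)))%R with (2 * PI * INR (S j))%R by ring.
      replace (-1 * (2 * PI * INR (S j)))%R with (- (2 * PI * INR (S j)))%R by ring. ring. }
    rewrite SE. ring. }
  assert (E_lim : forall t, Clim (fun L => E L t) (Ccpow (x, t) (- a))).
  { intro t. apply (Clim_Ccont (fun w => Ccpow w (- a)) _ (x, t)).
    - apply Ccont_Ccpow_l. exact Hx.
    - apply Clim_scaled_one_minus_Cexp. }
  assert (LimU : Clim (fun L => Cseries (U L)) (Cseries (fun p =>
     rGamma a * (Ccpow (RtoC (INR (S p))) (a - 1) * RtoC (exp (- INR (S p) * x))))%C)).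
  { apply (tannery _ _ _ UB UE). intro p. unfold U. apply Clim_mult; [|apply Clim_const].
    apply (Clim_subseq (wg a) _ (fun L => M L * S p)%nat); [intro; unfold M; nia | apply wg_Clim]. }
  assert (LimV : Clim (fun L => Cseries (V L)) (Cseries (fun j => Ccpow (x, (2 * PI * INR (S j))%R) (- a)
     + Ccpow (x, (- (2 * PI * INR (S j)))%R) (- a))%C)).
  { apply (tannery _ _ _ VB VE). intro j.
    apply (Clim_ext_loc (fun L => E L (2 * PI * INR (S j))%R + E L (- (2 * PI * INR (S j)))%R)%C _ _ j).
    - intros L HL. unfold V. destruct (Nat.leb_spec j L); [|lia].
      replace (1 * (2 * PI * INR (S j)))%R with (2 * PI * INR (S j))%R by ring.
      replace (-1 * (2 * PI * INR (S j)))%R with (- (2 * PI * INR (S j)))%R by ring. reflexivity.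
    - apply Clim_plus; apply E_lim. }
  assert (LimM : Clim (fun L => Ccpow (RtoC (INR (M L))) (1 - a)) 0).
  { apply Clim_Cmod. apply (is_lim_seq_ext (fun L => exp ((1 - Re a) * ln (INR (2 * L + 3))))).
    - intro L. replace (Ccpow (RtoC (INR (M L))) (1 - a) - 0)%C with (Ccpow (RtoC (INR (M L))) (1 - a)) by ring.
      rewrite Cmod_Ccpow_RtoC by apply PM. reflexivity.
    - apply (is_lim_seq_power_neg (1 - Re a) (fun L => 2 * L + 3)%nat); [lra | intro; lia]. }
  assert (F := Clim_plus _ _ _ _ LimM LimU).
  assert (G := Clim_plus _ _ _ _ (E_lim 0) LimV).
  assert (H := Clim_unique _ _ _ (Clim_ext _ _ _ Fin F) G).
  etransitivity; [|exact H]. rewrite Cplus_0_l. symmetry. apply Csum_Cseries, Csum_scal.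
  apply (Csum_dominated _ (fun p => 1 * (exp ((Re a - 1) * ln (INR (S p))) * exp (- INR (S p) * x)))).
  - intro p. rewrite Cmod_mult, Cmod_Ccpow_RtoC by apply INR_S_pos.
    rewrite Cmod_R, Rabs_pos_eq by (left; apply exp_pos). change (Re (a - 1)) with (Re a - 1). lra.
  - apply (ex_series_scal (V := R_NormedModule) 1). now apply ex_series_pow_exp.
Qed.

(** * The three series *)

Lemma exp_partial_sum_le (t : R) (n : nat) : 0 <= t -> sum_f_R0 (fun w => t ^ w / INR (fact w)) n <= exp t.
Proof.
  intro Ht. assert (H := is_exp_Reals t).
  assert (Hs : is_lim_seq (sum_n (fun w => t ^ w / INR (fact w))) (exp t)).
  { apply (is_lim_seq_ext (sum_n (fun k => scal (pow_n t k) (/ INR (fact k))))); [|exact H].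
    intro k. apply sum_n_ext. intro j. rewrite pow_n_pow. reflexivity. }
  rewrite <- sum_n_Reals.
  apply (is_lim_seq_incr_compare (sum_n (fun w => t ^ w / INR (fact w))) _ Hs).
  intro k. rewrite sum_Sn. change (sum_n (fun w => t ^ w / INR (fact w)) k <=
    sum_n (fun w => t ^ w / INR (fact w)) k + t ^ S k / INR (fact (S k))).
  assert (0 <= t ^ S k / INR (fact (S k))).
  { apply Rmult_le_pos; [now apply pow_le | left; apply Rinv_0_lt_compat, INR_fact_lt_0]. }
  lra.
Qed.

Lemma exp_partial_sum_lim (t : R) : is_lim_seq (fun n => sum_f_R0 (fun w => t ^ w / INR (fact w)) n) (exp t).
Proof.
  apply (is_lim_seq_ext (sum_n (fun k => scal (pow_n t k) (/ INR (fact k))))); [|exact (is_exp_Reals t)].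
  intro k. rewrite <- sum_n_Reals. apply sum_n_ext. intro j. rewrite pow_n_pow. reflexivity.
Qed.

Lemma Qinc_factor (v : nat) (m : R) :
  Qinc v m = sum_f_R0 (fun w => m ^ w / INR (fact w)) (v - 1) * exp (- m).
Proof. unfold Qinc. rewrite Rmult_comm. rewrite scal_sum. apply sum_eq. intros. ring. Qed.

Lemma Qinc_bounds (v : nat) (m : R) : 0 <= m -> 0 <= Qinc v m <= 1.
Proof.
  intro H. rewrite Qinc_factor. assert (E := exp_pos (- m)).
  assert (P := exp_partial_sum_le m (v - 1) H).
  assert (0 <= sum_f_R0 (fun w => m ^ w / INR (fact w)) (v - 1)).
  { apply cond_pos_sum. intro w. apply Rmult_le_pos; [now apply pow_le | left; apply Rinv_0_lt_compat, INR_fact_lt_0]. }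
  split; [nra|]. replace 1 with (exp m * exp (- m)) by (rewrite <- exp_plus, Rplus_opp_r; apply exp_0).
  apply Rmult_le_compat_r; lra.
Qed.

(** Writing m^w = 2^w (m/2)^w bounds the partial sum by 2^v exp (m/2), so half of the exponential
    decay survives. *)
Lemma Qinc_decay (v : nat) (m : R) : 0 <= m -> Qinc v m <= 2 ^ v * exp (- (m / 2)).
Proof.
  intro H. rewrite Qinc_factor.
  assert (P := exp_partial_sum_le (m / 2) (v - 1) ltac:(lra)).
  apply Rle_trans with (2 ^ v * sum_f_R0 (fun w => (m / 2) ^ w / INR (fact w)) (v - 1) * exp (- m)).
  - apply Rmult_le_compat_r; [left; apply exp_pos|]. rewrite scal_sum. apply sum_Rle. intros w Hw.
    replace m with (2 * (m / 2)) at 1 by field. rewrite Rpow_mult_distr.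
    assert (2 ^ w <= 2 ^ v) by (apply Rle_pow; [lra | lia]).
    assert (0 <= (m / 2) ^ w / INR (fact w)).
    { apply Rmult_le_pos; [apply pow_le; lra | left; apply Rinv_0_lt_compat, INR_fact_lt_0]. }
    unfold Rdiv in *. nra.
  - replace (- (m / 2)) with (m / 2 + - m) by field. rewrite exp_plus, <- Rmult_assoc.
    apply Rmult_le_compat_r; [left; apply exp_pos|]. apply Rmult_le_compat_l; [apply pow_le; lra | exact P].
Qed.

Lemma Qinc_S (v : nat) (m : R) : (1 <= v)%nat -> Qinc (S v) m = Qinc v m + m ^ v / INR (fact v) * exp (- m).
Proof.
  intro H. unfold Qinc. replace (S v - 1)%nat with (S (v - 1)) by lia. cbn [sum_f_R0].
  replace (S (v - 1)) with v by lia. reflexivity.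
Qed.

Lemma Qinc_lim (m : R) : is_lim_seq (fun v => Qinc v m) 1.
Proof.
  apply (is_lim_seq_ext (fun v => sum_f_R0 (fun w => m ^ w / INR (fact w)) (v - 1) * exp (- m))).
  - intro v. symmetry. apply Qinc_factor.
  - replace (Finite 1) with (Finite (exp m * exp (- m))) by (f_equal; rewrite <- exp_plus, Rplus_opp_r; apply exp_0).
    apply is_lim_seq_mult'; [|apply is_lim_seq_const].
    apply (is_lim_seq_incr_1 (fun v => sum_f_R0 (fun w => m ^ w / INR (fact w)) (v - 1))).
    apply (is_lim_seq_ext (fun n => sum_f_R0 (fun w => m ^ w / INR (fact w)) n)); [|apply exp_partial_sum_lim].
    intro n. f_equal. lia.
Qed.

Lemma Dterm_bound (v : nat) (N B : R) (s : C) (n : nat) : 0 < N -> Cmod s <= B ->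
  Cmod (Dterm v N n s) <= 2 ^ v * (exp (B * ln (INR (S n))) * exp (- INR (S n) * (/ N / 2))).
Proof.
  intros HN HB. unfold Dterm. rewrite Cmod_mult, Cmod_Ccpow_RtoC, Cmod_R by apply INR_S_pos.
  assert (Hm : 0 <= INR (S n) / N) by (apply Rmult_le_pos; [apply pos_INR | left; now apply Rinv_0_lt_compat]).
  rewrite Rabs_pos_eq by now apply Qinc_bounds.
  replace (2 ^ v * (exp (B * ln (INR (S n))) * exp (- INR (S n) * (/ N / 2)))) with
    (exp (B * ln (INR (S n))) * (2 ^ v * exp (- (INR (S n) / N / 2)))).
  - apply Rmult_le_compat; [left; apply exp_pos | now apply Qinc_bounds | | now apply Qinc_decay].
    apply exp_monotone. apply Rmult_le_compat_r; [apply ln_INR_S_pos|].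
    change (Re (- s)) with (- Re s). generalize (re_le_Cmod s). intro X. apply Rabs_le_between in X. lra.
  - replace (- (INR (S n) / N / 2)) with (- INR (S n) * (/ N / 2)) by (field; lra). ring.
Qed.

Lemma ex_series_Dterm_bound (v : nat) (N B : R) : 0 < N ->
  ex_series (fun n => 2 ^ v * (exp (B * ln (INR (S n))) * exp (- INR (S n) * (/ N / 2)))).
Proof.
  intro HN. apply (ex_series_scal (V := R_NormedModule) (2 ^ v)). apply ex_series_pow_exp.
  assert (0 < / N) by now apply Rinv_0_lt_compat. lra.
Qed.

(** Passing to rising factorials makes the finite sum in [Eterm] a partial sum of [binomial_series]
    with parameter 1 - s. *)
Lemma Cbinom_bc (s : C) (w : nat) : (Cbinom (s - 1) w * (- (1)) ^ w)%C = bc (1 - s) w.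
Proof.
  unfold Cbinom. induction w as [|w IH]; [simpl; field|].
  cbn [bc]. rewrite <- IH, Cpow_S. cbn [Cfalling].
  replace (RtoC (INR (fact (S w)))) with (RtoC (INR (S w)) * RtoC (INR (fact w)))%C
    by (rewrite <- RtoC_mult, <- mult_INR; reflexivity).
  assert (N1 := RtoC_INR_S_neq w). assert (N2 : RtoC (INR (fact w)) <> RtoC 0) by (apply RtoC_neq, INR_fact_neq_0).
  field. split; assumption.
Qed.

Definition zE (N mu : R) (m : nat) : C := (RtoC (INR m) + (0, (mu / (2 * PI * N))%R))%C.
(** The expansion variable: with z = [zE N mu m] and q = [qE N mu m] one has m = z (1 - q). So
    m^(s-1) = z^(s-1) (1 - q)^(s-1), and [Eterm] is z^(s-1) times a Taylor remainder in q. *)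
Definition qE (N mu : R) (m : nat) : C := ((0, (mu / (2 * PI * N))%R) / zE N mu m)%C.

Lemma Re_zE (N mu : R) (m : nat) : Re (zE N mu m) = INR m.
Proof. unfold zE, Re. simpl. ring. Qed.

Lemma Re_zE_pos (N mu : R) (m : nat) : 0 < Re (zE N mu (S m)).
Proof. rewrite Re_zE. apply INR_S_pos. Qed.

Lemma one_minus_qE (N mu : R) (m : nat) : (1 - qE N mu (S m))%C = (RtoC (INR (S m)) * / zE N mu (S m))%C.
Proof.
  assert (Nz := Re_pos_neq _ (Re_zE_pos N mu m)). unfold qE.
  replace (RtoC (INR (S m))) with (zE N mu (S m) - (0, (mu / (2 * PI * N))%R))%C by (unfold zE; ring).
  field. exact Nz.
Qed.

Lemma Eterm_summand (N mu : R) (m w : nat) (s : C) :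
  (Cbinom (s - RtoC 1) w
   * Ccpow (RtoC (INR (S m)) + (0, (mu / (2 * PI * N))%R)) (s - RtoC 1 - RtoC (INR w))
   * Cpow (0, (- mu / (2 * PI * N))%R) w)%C =
  (Ccpow (zE N mu (S m)) (s - 1) * (bc (1 - s) w * qE N mu (S m) ^ w))%C.
Proof.
  fold (zE N mu (S m)). assert (Nz := Re_pos_neq _ (Re_zE_pos N mu m)).
  rewrite <- Cbinom_bc.
  replace (s - 1 - RtoC (INR w))%C with ((s - 1) + - RtoC (INR w))%C by ring.
  rewrite Ccpow_plus, Ccpow_opp, Ccpow_INR by apply Re_zE_pos.
  replace (0, - mu / (2 * PI * N)) with (- (1) * (0, (mu / (2 * PI * N))%R))%C
    by (apply Ceq; unfold Re, Im, Rdiv; simpl; ring).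
  unfold qE, Cdiv. rewrite !Cpow_mult_l, Cpow_inv by exact Nz. field. now apply Cpow_nz.
Qed.

Lemma Eterm_factored (v : nat) (N mu : R) (m : nat) (s : C) :
  Eterm v N mu (S m) s = (Ccpow (zE N mu (S m)) (s - 1) *
    (Ccpow (1 - qE N mu (S m)) (- (1 - s)) - sum_n (fun w => bc (1 - s) w * qE N mu (S m) ^ w) (v - 1)))%C.
Proof.
  unfold Eterm. rewrite (sum_n_ext _ _ _ (fun w => Eterm_summand N mu m w s)).
  set (Sg := sum_n (fun w => bc (1 - s) w * qE N mu (S m) ^ w)%C (v - 1)).
  replace (sum_n _ (v - 1)) with (Ccpow (zE N mu (S m)) (s - 1) * Sg)%C
    by (symmetry; apply (sum_n_mult_l (K := C_Ring))).
  rewrite one_minus_qE, Ccpow_scal by (try apply INR_S_pos; apply Re_inv_pos, Re_zE_pos).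
  replace (- (1 - s))%C with (s - 1)%C by ring.
  replace (Ccpow (/ zE N mu (S m)) (s - 1)) with (/ Ccpow (zE N mu (S m)) (s - 1))%C.
  - assert (Nc := Ccpow_neq_0 (zE N mu (S m)) (s - 1)). clearbody Sg. field. exact Nc.
  - rewrite <- Ccpow_opp. unfold Ccpow. rewrite Clog_pr_inv by apply Re_zE_pos. f_equal. ring.
Qed.

(** The value of |q| at m = 1, which is the largest over all m >= 1 and is less than 1. *)
Definition rhoE (N : R) : R := / (2 * PI * N) / Cmod (1, / (2 * PI * N)).

Lemma invN_pos (N : R) : 0 < N -> 0 < / (2 * PI * N).
Proof. intro H. assert (P := PI_RGT_0). apply Rinv_0_lt_compat. nra. Qed.

Lemma rhoE_bounds (N : R) : 0 < N -> 0 < rhoE N < 1.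
Proof.
  intro H. assert (Y := invN_pos N H). unfold rhoE. set (y := / (2 * PI * N)) in *.
  assert (S2 := Cmod_sqr (1, y)). simpl in S2. assert (C0 := Cmod_ge_0 (1, y)).
  assert (y < Cmod (1, y)) by nra.
  split; [apply Rdiv_lt_0_compat; lra|].
  apply Rmult_lt_reg_r with (Cmod (1, y)); [lra|]. unfold Rdiv. rewrite Rmult_assoc, Rinv_l; lra.
Qed.

Lemma zE_lower (N mu : R) (m : nat) : (mu = 1 \/ mu = -1) ->
  INR (S m) <= Cmod (zE N mu (S m)) /\ Cmod (1, / (2 * PI * N)) <= Cmod (zE N mu (S m)).
Proof.
  intro Hmu. assert (P := INR_S_ge_1 m). split.
  - generalize (re_le_Cmod (zE N mu (S m))). rewrite Re_zE, Rabs_pos_eq; lra.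
  - apply Rsqr_incr_0; [|apply Cmod_ge_0 | apply Cmod_ge_0]. unfold Rsqr. rewrite !Cmod_sqr, Re_zE.
    unfold zE, Re, Im. cbn [fst snd Cplus RtoC]. unfold Rdiv.
    destruct Hmu as [-> | ->]; nra.
Qed.

Lemma Cmod_imag (N mu : R) : 0 < N -> (mu = 1 \/ mu = -1) ->
  Cmod (0, mu / (2 * PI * N)) = / (2 * PI * N).
Proof.
  intros HN Hmu. assert (Y := invN_pos N HN).
  replace (0, mu / (2 * PI * N)) with (RtoC mu * (Ci * RtoC (/ (2 * PI * N))))%C
    by (apply Ceq; unfold Re, Im, Rdiv; simpl; ring).
  rewrite !Cmod_mult, !Cmod_R, Cmod_Ci, (Rabs_pos_eq (/ _)) by lra.
  destruct Hmu as [-> | ->]; [rewrite Rabs_R1 | rewrite Rabs_left1 by lra]; ring.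
Qed.

Lemma Cmod_qE (N mu : R) (m : nat) : 0 < N -> (mu = 1 \/ mu = -1) ->
  Cmod (qE N mu (S m)) = / (2 * PI * N) / Cmod (zE N mu (S m)) /\ Cmod (qE N mu (S m)) <= rhoE N.
Proof.
  intros HN Hmu. assert (Nz := Re_pos_neq _ (Re_zE_pos N mu m)).
  assert (E : Cmod (qE N mu (S m)) = / (2 * PI * N) / Cmod (zE N mu (S m))).
  { unfold qE. now rewrite Cmod_div, Cmod_imag. }
  split; [exact E|]. rewrite E. unfold rhoE.
  destruct (zE_lower N mu m Hmu) as [_ L]. assert (Y := invN_pos N HN).
  apply Rmult_le_compat_l; [lra|]. apply Rinv_le_contravar; [|exact L].
  apply Cmod_gt_0. intro E1. apply (f_equal Re) in E1. simpl in E1. lra.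
Qed.

Lemma Csum_qE (N mu : R) (m : nat) (a : C) : 0 < N -> (mu = 1 \/ mu = -1) ->
  Csum (fun w => bc a w * qE N mu (S m) ^ w)%C (Ccpow (1 - qE N mu (S m)) (- a)).
Proof.
  intros HN Hmu. apply binomial_series. destruct (Cmod_qE N mu m HN Hmu) as [_ L].
  generalize (rhoE_bounds N HN). lra.
Qed.

Lemma Csum_tail (u : nat -> C) (l : C) (n : nat) : Csum u l ->
  Csum (fun k => u (S n + k)%nat) (l - sum_n u n).
Proof.
  intro H. induction n as [|n IH].
  - rewrite sum_O. now apply Csum_shift.
  - rewrite sum_Sn. change (plus ?x ?y) with (x + y)%C.
    replace (l - (sum_n u n + u (S n)))%C with (l - sum_n u n - u (S n + 0)%nat)%C
      by (rewrite Nat.add_0_r; ring).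
    apply (Csum_ext (fun k => u (S n + S k)%nat)); [intro k; f_equal; lia|].
    now apply (Csum_shift (fun k => u (S n + k)%nat)).
Qed.

(* One constant serves all [v >= v0], which is what dominates the limit [v -> oo]. *)
Lemma Eterm_bound (v0 : nat) (N sigma0 B : R) : 0 < N -> sigma0 < INR v0 -> exists K, 0 <= K /\
  forall v mu m s, (1 <= v)%nat -> (v0 <= v)%nat -> (mu = 1 \/ mu = -1) -> Re s <= sigma0 -> Cmod s <= B ->
  Cmod (Eterm v N mu (S m) s) <= K * exp (- (INR v0 + 1 - sigma0) * ln (INR (S m))).
Proof.
  intros HN H0. set (y := / (2 * PI * N)). assert (Y : 0 < y) by now apply invN_pos.
  set (rho := rhoE N). assert (R := rhoE_bounds N HN). fold rho in R.
  set (A := Rabs B + 2). assert (HA : 0 < A) by (unfold A; generalize (Rabs_pos B); lra).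
  assert (ES := ex_series_bcR A rho HA ltac:(lra)).
  set (T := Series (fun k => bcR A k * rho ^ k)).
  assert (Tpos : forall k, 0 <= bcR A k * rho ^ k).
  { intro k. apply Rmult_le_pos; [left; now apply bcR_pos | apply pow_le; lra]. }
  assert (T0 : 0 <= T).
  { eapply Rle_trans; [|apply (Series_partial_le _ 0 Tpos ES)]. rewrite sum_O. apply Tpos. }
  set (X := exp (Rabs B * (PI / 2))). assert (X0 : 0 < X) by apply exp_pos.
  assert (Rv : 0 < rho ^ v0) by (apply pow_lt; lra).
  assert (Yv : 0 < y ^ v0) by (apply pow_lt; lra).
  exists (X * (y ^ v0 * (/ rho ^ v0 * T))). split.
  { apply Rmult_le_pos; [lra|]. apply Rmult_le_pos; [lra|]. apply Rmult_le_pos;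
    [left; now apply Rinv_0_lt_compat | exact T0]. }
  intros v mu m s Hv Hvv Hmu Hs HB.
  rewrite Eterm_factored.
  set (z := zE N mu (S m)). set (q := qE N mu (S m)).
  destruct (zE_lower N mu m Hmu) as [Zm _]. fold z in Zm.
  destruct (Cmod_qE N mu m HN Hmu) as [Eq Lq]. fold q z y in Eq. fold q rho in Lq.
  assert (Pm := INR_S_ge_1 m). assert (Pz : 0 < Cmod z) by lra.
  assert (Pq : 0 < Cmod q) by (rewrite Eq; apply Rdiv_lt_0_compat; lra).
  assert (HsA : Cmod (1 - s) <= A).
  { eapply Rle_trans; [apply Cmod_triangle_minus|]. rewrite Cmod_1. unfold A. generalize (Rle_abs B). lra. }
  (* All exponents in the tail are at least v >= v0. Pulling out |q|^v0, which decays like m^(-v0),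
     and bounding the remaining powers by those of rho leaves a piece of one fixed convergent
     series. *)
  assert (Tail : Cmod (Ccpow (1 - q) (- (1 - s)) - sum_n (fun w => bc (1 - s) w * q ^ w)%C (v - 1))
     <= Cmod q ^ v0 * (/ rho ^ v0 * T)).
  { assert (S1 := Csum_tail _ _ (v - 1) (Csum_qE N mu m (1 - s) HN Hmu)). fold q in S1.
    apply Csum_Cseries in S1. rewrite <- S1.
    set (b := fun k => Cmod q ^ v0 * / rho ^ v0 * (bcR A (v + k) * rho ^ (v + k))).
    assert (Eb : ex_series (fun k => bcR A (v + k) * rho ^ (v + k))).
    { apply (ex_series_incr_n (V := R_NormedModule) (fun k => bcR A k * rho ^ k) v). exact ES. }
    assert (Ebb : ex_series b).
    { unfold b. apply (ex_series_scal (V := R_NormedModule) (Cmod q ^ v0 * / rho ^ v0)). exact Eb. }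
    apply Rle_trans with (Series b).
    - apply Csum_dominated; [|exact Ebb]. intro k.
      replace (S (v - 1) + k)%nat with (v + k)%nat by lia.
      rewrite Cmod_mult, Cmod_pow. unfold b.
      replace (Cmod q ^ v0 * / rho ^ v0 * (bcR A (v + k) * rho ^ (v + k))) with
        (bcR A (v + k) * (Cmod q ^ v0 * rho ^ (v + k - v0))).
      + apply Rmult_le_compat; [apply Cmod_ge_0 | apply pow_le; lra | now apply bc_Cmod_le|].
        replace (v + k)%nat with (v0 + (v + k - v0))%nat at 1 by lia. rewrite pow_add.
        apply Rmult_le_compat_l; [apply pow_le; lra|]. apply pow_incr. lra.
      + replace (rho ^ (v + k)) with (rho ^ v0 * rho ^ (v + k - v0)) by (rewrite <- pow_add; f_equal; lia).
        field. lra.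
    - unfold b. rewrite Series_scal_l. rewrite Rmult_assoc.
      apply Rmult_le_compat_l; [apply pow_le; lra|]. apply Rmult_le_compat_l; [left; now apply Rinv_0_lt_compat|].
      unfold T. rewrite (Series_incr_n (fun k => bcR A k * rho ^ k) v) by (try lia; exact ES).
      assert (0 <= sum_f_R0 (fun k => bcR A k * rho ^ k) (pred v)) by (apply cond_pos_sum; exact Tpos). lra. }
  assert (Zp : Cmod (Ccpow z (s - 1)) <= X * exp ((Re s - 1) * ln (Cmod z))).
  { eapply Rle_trans; [apply Cmod_Ccpow_le|]. change (Re (s - 1)) with (Re s - 1).
    replace (Im (s - 1)) with (Im s) by (unfold Im; simpl; ring).
    rewrite Rmult_comm. apply Rmult_le_compat_r; [left; apply exp_pos|]. unfold X. apply exp_monotone.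
    apply Rmult_le_compat_r; [generalize PI_RGT_0; lra|].
    generalize (im_le_Cmod s) (Rle_abs B). lra. }
  assert (Qv : Cmod q ^ v0 = y ^ v0 * exp (- INR v0 * ln (Cmod z))).
  { rewrite Eq. unfold Rdiv. rewrite Rpow_mult_distr. f_equal. rewrite pow_inv.
    replace (- INR v0 * ln (Cmod z)) with (- (INR v0 * ln (Cmod z))) by ring. rewrite exp_Ropp. f_equal.
    rewrite <- ln_pow by exact Pz. rewrite exp_ln; [reflexivity | now apply pow_lt]. }
  rewrite Cmod_mult. rewrite Qv in Tail.
  apply Rle_trans with (X * exp ((Re s - 1) * ln (Cmod z)) * (y ^ v0 * exp (- INR v0 * ln (Cmod z))
    * (/ rho ^ v0 * T))).
  { apply Rmult_le_compat; try apply Cmod_ge_0; assumption. }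
  replace (X * exp ((Re s - 1) * ln (Cmod z)) * (y ^ v0 * exp (- INR v0 * ln (Cmod z)) * (/ rho ^ v0 * T)))
    with (X * (y ^ v0 * (/ rho ^ v0 * T)) * (exp ((Re s - 1) * ln (Cmod z)) * exp (- INR v0 * ln (Cmod z)))) by ring.
  apply Rmult_le_compat_l.
  { apply Rmult_le_pos; [lra|]. apply Rmult_le_pos; [lra|]. apply Rmult_le_pos;
    [left; now apply Rinv_0_lt_compat | exact T0]. }
  rewrite <- exp_plus. apply exp_monotone.
  assert (L0 := ln_INR_S_pos m).
  assert (L1 : ln (INR (S m)) <= ln (Cmod z)) by (apply ln_le; lra).
  (* First Re s is replaced by sigma0, as ln |z| >= 0; then |z| by m + 1 <= |z|, as the exponent
     -(v0 + 1 - sigma0) is negative. *)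
  apply Rle_trans with (- (INR v0 + 1 - sigma0) * ln (Cmod z)); [nra|]. nra.
Qed.

Lemma ex_series_Eterm_bound (v : nat) (sigma0 K : R) : sigma0 < INR v ->
  ex_series (fun m => K * exp (- (INR v + 1 - sigma0) * ln (INR (S m)))).
Proof.
  intro H. apply (ex_series_scal (V := R_NormedModule) K). apply ex_series_riemann. lra.
Qed.

Lemma Eterm_Csum (v : nat) (N mu : R) (s : C) : (1 <= v)%nat -> 0 < N -> (mu = 1 \/ mu = -1) -> Re s < INR v ->
  Csum (fun m => Eterm v N mu (S m) s) (Cseries (fun m => Eterm v N mu (S m) s)).
Proof.
  intros Hv HN Hmu Hs. destruct (Eterm_bound v N (Re s) (Cmod s) HN Hs) as (K & _ & HK).
  apply (Csum_dominated _ (fun m => K * exp (- (INR v + 1 - Re s) * ln (INR (S m))))).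
  - intro m. apply HK; auto; lra.
  - now apply ex_series_Eterm_bound.
Qed.

Lemma Dterm_Csum (v : nat) (N : R) (s : C) : 0 < N ->
  Csum (fun n => Dterm v N n s) (Cseries (fun n => Dterm v N n s)).
Proof.
  intro HN. apply (Csum_dominated _ _ (fun n => Dterm_bound v N (Cmod s) s n HN (Rle_refl _))).
  now apply ex_series_Dterm_bound.
Qed.

(** * Independence of the order of the incomplete gamma function *)

Definition Rzeta (v : nat) (N : R) (s : C) : C :=
  (Dfun v N s + Efun v N 1 s + Efun v N (-1) s - Corr v N s)%C.

Lemma zE_pair (N mu : R) (m : nat) : zE N mu m = (INR m, mu / (2 * PI * N)).
Proof. apply Ceq; unfold zE, Re, Im; simpl; ring. Qed.

(** With n = m + 1, 1/N - 2 pi i mu n is 2 pi times n + i mu/(2 pi N), turned by the angle -mu pi/2.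
    Both points lie in the right half-plane, and atan(n/y) + atan(y/n) = pi/2 shows that the
    principal logarithms differ by exactly this angle, with no multiple of 2 pi i. *)
Lemma Clog_pr_rotate (N mu : R) (m : nat) : 0 < N -> (mu = 1 \/ mu = -1) ->
  Clog_pr (/ N, - (mu * (2 * PI * INR (S m)))) =
  (RtoC (ln (2 * PI)) + Clog_pr (zE N mu (S m)) - (0, (mu * PI / 2)%R))%C.
Proof.
  intros HN Hmu. assert (Y := invN_pos N HN). set (y := / (2 * PI * N)) in *. assert (P0 := PI_RGT_0).
  assert (Pm := INR_S_pos m). set (n := INR (S m)) in *.
  assert (E : (/ N, - (mu * (2 * PI * n))) = (RtoC (2 * PI) * (y, (- (mu * n))%R))%C).
  { apply Ceq; unfold Re, Im, y; simpl; field; lra. }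
  rewrite E, Clog_pr_scal by (simpl; lra).
  assert (L : Clog_pr (y, - (mu * n)) = (Clog_pr (zE N mu (S m)) - (0, (mu * PI / 2)%R))%C); [|rewrite L; ring].
  rewrite zE_pair. fold n. replace (mu / (2 * PI * N)) with (mu * y) by reflexivity.
  unfold Clog_pr. apply Ceq; unfold Re, Im; cbn [fst snd Cminus Cplus Copp].
  - rewrite Ropp_0, Rplus_0_r. f_equal. unfold Cmod; cbn [fst snd]. f_equal.
    destruct Hmu as [-> | ->]; ring.
  - assert (A := atan_complement n y Pm Y).
    destruct Hmu as [-> | ->].
    + replace (- (1 * n) / y) with (- (n / y)) by (field; lra). replace (1 * y / n) with (y / n) by (field; lra).
      rewrite atan_opp. lra.
    + replace (- (-1 * n) / y) with (n / y) by (field; lra). replace (-1 * y / n) with (- (y / n)) by (field; lra).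
      rewrite atan_opp. lra.
Qed.

(* The terms [(1/N - 2 pi i mu (m+1))^b] of Lipschitz's formula. *)
Definition Pterm (N mu : R) (b : C) (m : nat) : C :=
  Ccpow (/ N, - (mu * (2 * PI * INR (S m)))) b.

Lemma Pterm_rotate (N mu : R) (m : nat) (b : C) : 0 < N -> (mu = 1 \/ mu = -1) ->
  Pterm N mu b m = (Ccpow (RtoC (2 * PI)) b * Ccpow (zE N mu (S m)) b * Cexp ((0, (mu * PI / 2)%R) * - b))%C.
Proof.
  intros HN Hmu. unfold Pterm, Ccpow. rewrite Clog_pr_rotate by assumption.
  rewrite (Clog_pr_RtoC (2 * PI)) by (generalize PI_RGT_0; lra).
  rewrite <- !Cexp_plus. f_equal. ring.
Qed.

Lemma Cexp_quarter (mu : R) : (mu = 1 \/ mu = -1) -> Cexp (0, mu * PI / 2) = (0, mu).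
Proof.
  intro Hmu. unfold Cexp, Re, Im; simpl. rewrite exp_0.
  destruct Hmu as [-> | ->].
  - replace (1 * PI / 2) with (PI / 2) by field. rewrite cos_PI2, sin_PI2. apply Ceq; simpl; ring.
  - replace (-1 * PI / 2) with (- (PI / 2))
    by field. rewrite cos_neg, sin_neg, cos_PI2, sin_PI2. apply Ceq; simpl; ring.
Qed.

Lemma Pterm_Csum (N mu : R) (a : C) : 0 < N -> (mu = 1 \/ mu = -1) -> 1 < Re a ->
  Csum (Pterm N mu (- a)) (Cseries (Pterm N mu (- a))).
Proof.
  intros HN Hmu Ha.
  apply (Csum_dominated _ (fun m => exp (Rabs (Im a) * (PI / 2)) * exp (- Re a * ln (INR (S m))))).
  - intro m. apply Cmod_Ccpow_decay; [lra|]. split; [apply INR_S_pos|].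
    eapply Rle_trans; [|apply im_le_Cmod]. unfold Im; cbn [snd].
    rewrite Rabs_Ropp, Rabs_mult. assert (P := INR_S_pos m). assert (P2 := PI2_1).
    rewrite (Rabs_pos_eq (2 * PI * INR (S m))) by nra.
    destruct Hmu as [-> | ->]; [rewrite Rabs_R1 | rewrite Rabs_left1 by lra]; nra.
  - apply (ex_series_scal (V := R_NormedModule) (exp (Rabs (Im a) * (PI / 2)))). now apply ex_series_riemann.
Qed.

Lemma Eterm_S (v : nat) (N mu : R) (m : nat) (s : C) : (1 <= v)%nat ->
  (Eterm v N mu (S m) s - Eterm (S v) N mu (S m) s =
   Ccpow (zE N mu (S m)) (s - 1) * (bc (1 - s) v * qE N mu (S m) ^ v))%C.
Proof.
  intro Hv. rewrite !Eterm_factored. replace (S v - 1)%nat with (S (v - 1)) by lia.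
  rewrite sum_Sn. replace (S (v - 1)) with v by lia.
  change (plus ?x ?y) with (x + y)%C. ring.
Qed.

(** The difference is the single Taylor term w = v. Its factor (i mu)^v, coming from q^v, is
    absorbed when z^(-a) is rotated into a [Pterm], so the coefficient in front is the same for both
    signs mu. Re s < v makes Re a > 1 for a = v + 1 - s. *)
Lemma Efun_S (v : nat) (N mu : R) (s : C) : (1 <= v)%nat -> 0 < N -> (mu = 1 \/ mu = -1) -> Re s < INR v ->
  (Efun v N mu s - Efun (S v) N mu s =
   Gamma (1 - s) * bc (1 - s) v * RtoC ((/ N) ^ v) * Cseries (Pterm N mu (- (RtoC (INR v) + 1 - s))))%C.
Proof.
  intros Hv HN Hmu Hs. unfold Efun.
  set (c := (Ccpow (RtoC (2 * PI)) (s - 1) * Gamma (1 - s) * Cexp ((0, (mu * PI / 2)%R) * (1 - s)))%C).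
  assert (S1 := Eterm_Csum v N mu s Hv HN Hmu Hs).
  assert (S2 := Eterm_Csum (S v) N mu s ltac:(lia) HN Hmu ltac:(rewrite S_INR; lra)).
  assert (S3 := Csum_scal c _ _ (Csum_minus _ _ _ _ S1 S2)).
  set (k := (Gamma (1 - s) * bc (1 - s) v * RtoC ((/ N) ^ v))%C).
  assert (S4 := Csum_scal k _ _ (Pterm_Csum N mu (RtoC (INR v) + 1 - s) HN Hmu
    ltac:(unfold Re in *; simpl; lra))).
  replace (c * Cseries (fun m => Eterm v N mu (S m) s) - c * Cseries (fun m => Eterm (S v) N mu (S m) s))%C
    with (c * (Cseries (fun m => Eterm v N mu (S m) s) - Cseries (fun m => Eterm (S v) N mu (S m) s)))%C by ring.
  apply (Clim_unique _ _ _ S3). eapply Csum_ext; [|exact S4].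
  intro m. cbv beta. rewrite Eterm_S by exact Hv. rewrite Pterm_rotate by assumption.
  assert (Pz := Re_zE_pos N mu m). assert (Nz := Re_pos_neq _ Pz). assert (P0 := PI_RGT_0).
  replace (- (RtoC (INR v) + 1 - s))%C with ((s - 1) + - RtoC (INR v))%C by ring.
  rewrite !Ccpow_plus, !Ccpow_opp, !Ccpow_INR by (try exact Pz; simpl; lra).
  replace ((0, (mu * PI / 2)%R) * - (s - 1 + - RtoC (INR v)))%C with
    ((0, (mu * PI / 2)%R) * (1 - s) + RtoC (INR v) * (0, (mu * PI / 2)%R))%C by ring.
  rewrite Cexp_plus, <- Cexp_pow, Cexp_quarter by exact Hmu.
  unfold c, k, qE, Cdiv.
  replace (0, mu * / (2 * PI * N)) with (RtoC (/ N) * (/ RtoC (2 * PI) * (0, mu)))%C.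
  2: { rewrite <- RtoC_inv by lra. apply Ceq; unfold Re, Im; simpl; field; lra. }
  assert (N2 : RtoC (2 * PI) <> RtoC 0) by (apply RtoC_neq; lra).
  unfold Rdiv. 
  replace (0, mu * / (2 * PI * N)) with (RtoC (/ N) * (/ RtoC (2 * PI) * (0, mu)))%C.
  2: { rewrite <- RtoC_inv by lra. apply Ceq; unfold Re, Im; simpl; field; lra. }
  rewrite !Cpow_mult_l, !Cpow_inv, RtoC_pow by assumption.
  assert (N3 := Cpow_nz _ v Nz). assert (N4 := Cpow_nz _ v N2).
  field. split; assumption.
Qed.

(** Q(v+1, m) - Q(v, m) = m^v e^(-m) / v! at m = n/N turns the difference into the left side of
    [lipschitz_formula] at x = 1/N and a = v + 1 - s. *)
Lemma Dfun_S (v : nat) (N : R) (s : C) : (1 <= v)%nat -> 0 < N -> Re s < INR v ->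
  (rGamma (RtoC (INR v) + 1 - s) * RtoC (INR (fact v)) * (Dfun (S v) N s - Dfun v N s) =
   RtoC ((/ N) ^ v) * (Ccpow (RtoC (/ N)) (- (RtoC (INR v) + 1 - s)) +
     (Cseries (Pterm N 1 (- (RtoC (INR v) + 1 - s))) + Cseries (Pterm N (-1) (- (RtoC (INR v) + 1 - s))))))%C.
Proof.
  intros Hv HN Hs. set (a := (RtoC (INR v) + 1 - s)%C).
  assert (Ha : 1 < Re a) by (unfold a, Re in *; simpl; lra).
  assert (HN' : 0 < / N) by now apply Rinv_0_lt_compat.
  assert (Nf : RtoC (INR (fact v)) <> RtoC 0) by (apply RtoC_neq, INR_fact_neq_0).
  assert (S1 := Dterm_Csum v N s HN). assert (S2 := Dterm_Csum (S v) N s HN).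
  assert (S3 := Csum_minus _ _ _ _ S2 S1). cbv beta in S3.
  set (k := (RtoC ((/ N) ^ v) / RtoC (INR (fact v)))%C).
  assert (S4 : Csum (fun p => Ccpow (RtoC (INR (S p))) (a - 1) * RtoC (exp (- INR (S p) * / N)))%C
    (Cseries (fun p => Ccpow (RtoC (INR (S p))) (a - 1) * RtoC (exp (- INR (S p) * / N)))%C)).
  { apply (Csum_dominated _ (fun p => 1 * (exp ((Re a - 1) * ln (INR (S p))) * exp (- INR (S p) * / N)))).
    - intro p. rewrite Cmod_mult, Cmod_Ccpow_RtoC by apply INR_S_pos.
      rewrite Cmod_R, Rabs_pos_eq by (left; apply exp_pos). change (Re (a - 1)) with (Re a - 1). lra.
    - apply (ex_series_scal (V := R_NormedModule) 1). now apply ex_series_pow_exp. }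
  assert (S5 := Csum_scal k _ _ S4).
  assert (E : (Dfun (S v) N s - Dfun v N s)%C = (k * Cseries (fun p => Ccpow (RtoC (INR (S p))) (a - 1)
    * RtoC (exp (- INR (S p) * / N))))%C).
  { apply (Clim_unique _ _ _ S3). eapply Csum_ext; [|exact S5]. intro n. cbv beta.
    unfold Dterm. rewrite Qinc_S by exact Hv. rewrite RtoC_plus.
    replace (a - 1)%C with (- s + RtoC (INR v))%C by (unfold a; ring).
    rewrite Ccpow_plus, Ccpow_INR by (simpl; apply INR_S_pos).
    replace (- (INR (S n) / N)) with (- INR (S n) * / N) by (field; lra).
    unfold Rdiv. rewrite Rpow_mult_distr, !RtoC_mult, (RtoC_inv (INR (fact v))) by apply INR_fact_neq_0.
    rewrite (RtoC_pow (INR (S n))). unfold k, Cdiv. ring. }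
  assert (L := lipschitz_formula a (/ N) HN' Ha).
  assert (LP : Cseries (fun j => Ccpow ((/ N)%R, (2 * PI * INR (S j))%R) (- a) + Ccpow ((/ N)%R, (- (2 * PI
    * INR (S j)))%R) (- a))%C
    = (Cseries (Pterm N 1 (- a)) + Cseries (Pterm N (-1) (- a)))%C).
  { apply Csum_Cseries.
    apply (Csum_ext (fun j => Pterm N 1 (- a) j + Pterm N (-1) (- a) j)%C).
    - intro j. unfold Pterm.
      replace (- (1 * (2 * PI * INR (S j)))) with (- (2 * PI * INR (S j))) by ring.
      replace (- (-1 * (2 * PI * INR (S j)))) with (2 * PI * INR (S j)) by ring. ring.
    - apply Csum_plus; apply Pterm_Csum; auto. }
  rewrite LP in L. rewrite E, <- L. unfold k. field. exact Nf.
Qed.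

Lemma not_pole (s : C) : (forall k : nat, (1 <= k)%nat -> s <> RtoC (INR k)) ->
  rGamma (1 - s) <> RtoC 0 /\ (1 - s)%C <> RtoC 0.
Proof.
  intro H. assert (G : forall n : nat, (1 - s + RtoC (INR n))%C <> RtoC 0).
  { intros n E. apply (H (S n)); [lia|]. rewrite S_INR, RtoC_plus.
    replace s with (RtoC (INR n) + 1 - (1 - s + RtoC (INR n)))%C by ring. rewrite E. ring. }
  split; [now apply rGamma_neq_0|]. specialize (G 0%nat). now rewrite Cplus_0_r in G.
Qed.

Lemma Ccpow_inv_base (r : R) (b : C) : 0 < r -> Ccpow (RtoC (/ r)) (- b) = Ccpow (RtoC r) b.
Proof.
  intro H. unfold Ccpow. rewrite !Clog_pr_RtoC by (try apply Rinv_0_lt_compat; lra).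
  rewrite ln_Rinv by lra. rewrite RtoC_opp. f_equal. ring.
Qed.

Lemma Corr_eq (v : nat) (N : R) (s : C) : (1 <= v)%nat -> rGamma (1 - s + RtoC (INR v)) <> RtoC 0 ->
  Corr v N s = (/ rGamma (1 - s + RtoC (INR v)) / ((1 - s) * RtoC (INR (fact (v - 1)))) * Ccpow (RtoC N) (1 - s))%C.
Proof.
  intros Hv H. unfold Corr. rewrite Gamma_eq_inv_rGamma by exact H.
  replace v with (S (v - 1)) at 2 by lia. now rewrite Gamma_INR.
Qed.

(** The two functions [Efun] account for the terms m <> 0 of Lipschitz's formula. The remaining term
    x^(-a) = N^a is the change of the correction: Gamma(a+1)/v! - Gamma(a)/(v-1)! = Gamma(a) (a - v)
    / v!, and a - v = 1 - s cancels the denominator. *)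
Lemma Rzeta_S (v : nat) (N : R) (s : C) : (1 <= v)%nat -> 0 < N -> Re s < INR v ->
  (forall k : nat, (1 <= k)%nat -> s <> RtoC (INR k)) -> Rzeta (S v) N s = Rzeta v N s.
Proof.
  intros Hv HN Hs Hk. destruct (not_pole s Hk) as [N1 N2].
  assert (EP := Efun_S v N 1 s Hv HN (or_introl eq_refl) Hs).
  assert (EM := Efun_S v N (-1) s Hv HN (or_intror eq_refl) Hs).
  assert (ED := Dfun_S v N s Hv HN Hs).
  set (a := (RtoC (INR v) + 1 - s)%C) in *.
  set (P1 := Cseries (Pterm N 1 (- a))) in *. set (P2 := Cseries (Pterm N (-1) (- a))) in *.
  assert (Ha : 0 < Re a) by (unfold a, Re in *; simpl; lra).
  assert (Na : a <> RtoC 0) by now apply Re_pos_neq.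
  assert (Ga := rGamma_Re_pos a Ha).
  assert (Sh := rGamma_shift (1 - s) v).
  replace (1 - s + RtoC (INR v))%C with a in Sh by (unfold a; ring).
  assert (Nf : RtoC (INR (fact v)) <> RtoC 0) by (apply RtoC_neq, INR_fact_neq_0).
  assert (Nb : bc (1 - s) v <> RtoC 0) by (intro E; apply N1; rewrite Sh, E; ring).
  rewrite Gamma_eq_inv_rGamma, Sh in EP, EM by exact N1.
  assert (C1 : Corr v N s = (/ rGamma a / ((1 - s) * RtoC (INR (fact (v - 1)))) * Ccpow (RtoC N) (1 - s))%C).
  { assert (Eq : (1 - s + RtoC (INR v))%C = a) by (unfold a; ring).
    rewrite (Corr_eq v N s Hv) by (rewrite Eq; exact Ga). now rewrite Eq. }
  assert (G1 := rGamma_S a).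
  assert (Ga1 : rGamma (a + 1) <> RtoC 0) by (intro E; apply Ga; rewrite G1, E; ring).
  assert (C2 : Corr (S v) N s = (/ rGamma (a + 1) / ((1 - s) * RtoC (INR (fact v))) * Ccpow (RtoC N) (1 - s))%C).
  { assert (Eq : (1 - s + RtoC (INR (S v)))%C = (a + 1)%C) by (unfold a; rewrite S_INR, RtoC_plus; ring).
    rewrite Corr_eq by (try lia; rewrite Eq; exact Ga1). rewrite Eq. replace (S v - 1)%nat with v by lia. reflexivity. }
  assert (Fv : RtoC (INR (fact v)) = (RtoC (INR v) * RtoC (INR (fact (v - 1))))%C).
  { rewrite <- RtoC_mult, <- mult_INR. replace v with (S (v - 1)) at 1 2 by lia. reflexivity. }
  assert (Nv : RtoC (INR v) <> RtoC 0) by (apply RtoC_neq, not_0_INR; lia).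
  assert (Nf1 : RtoC (INR (fact (v - 1))) <> RtoC 0) by (apply RtoC_neq, INR_fact_neq_0).
  rewrite Ccpow_inv_base in ED by exact HN.
  assert (Pa : Ccpow (RtoC N) a = (Ccpow (RtoC N) (1 - s) * RtoC N ^ v)%C).
  { replace a with ((1 - s) + RtoC (INR v))%C by (unfold a; ring). rewrite Ccpow_plus, Ccpow_INR
    by (simpl; exact HN). reflexivity. }
  assert (Nn : RtoC N <> RtoC 0) by (apply RtoC_neq; lra).
  assert (Nnv := Cpow_nz _ v Nn).
  assert (Px : RtoC ((/ N) ^ v) = (/ RtoC N ^ v)%C) by (rewrite RtoC_pow, RtoC_inv, Cpow_inv
    by (exact Nn || lra); reflexivity).
  rewrite Px in *. rewrite Pa in ED.
  assert (ED' : (Dfun (S v) N s - Dfun v N s)%C = (/ (rGamma a * RtoC (INR (fact v))) * (Ccpow (RtoC N) (1 - s)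
    + / RtoC N ^ v * (P1 + P2)))%C).
  { transitivity (/ (rGamma a * RtoC (INR (fact v))) * (rGamma a * RtoC (INR (fact v))
    * (Dfun (S v) N s - Dfun v N s)))%C.
    - field. split; assumption.
    - rewrite ED. field. repeat split; assumption. }
  apply Ceq_minus. unfold Rzeta.
  transitivity ((Dfun (S v) N s - Dfun v N s) - (Efun v N 1 s - Efun (S v) N 1 s) - (Efun v N (-1) s - Efun (S v) N (-1) s)
    - (Corr (S v) N s - Corr v N s))%C; [ring|].
  rewrite ED', EP, EM, C1, C2, G1, Fv.
  assert (Es : s = (RtoC (INR v) + 1 - a)%C) by (unfold a; ring).
  assert (N2' : (a - RtoC (INR v))%C <> RtoC 0) by (replace (a - RtoC (INR v))%C with (1 - s)%C
    by (unfold a; ring); exact N2).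
  replace (1 - s)%C with (a - RtoC (INR v))%C in * by (unfold a; ring).
  clearbody a. field. repeat split; assumption.
Qed.

Lemma Rzeta_add (v k : nat) (N : R) (s : C) : (1 <= v)%nat -> 0 < N -> Re s < INR v ->
  (forall k : nat, (1 <= k)%nat -> s <> RtoC (INR k)) -> Rzeta (v + k) N s = Rzeta v N s.
Proof.
  intros Hv HN Hs Hk. induction k as [|k IH]; [now rewrite Nat.add_0_r|].
  rewrite Nat.add_succ_r, Rzeta_S, IH; auto; [lia|].
  rewrite plus_INR. generalize (pos_INR k). lra.
Qed.

(** * The limit of large order *)

Lemma Dfun_lim (N : R) (s : C) : 0 < N -> 1 < Re s ->
  Clim (fun v => Dfun v N s) (Cseries (fun n => Ccpow (RtoC (INR (S n))) (- s))).
Proof.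
  intros HN Hs. unfold Dfun.
  apply (tannery (fun v n => Dterm v N n s) _ (fun n => exp (- Re s * ln (INR (S n))))).
  - intros v n. unfold Dterm. rewrite Cmod_mult, Cmod_Ccpow_RtoC, Cmod_R by apply INR_S_pos.
    assert (Hm : 0 <= INR (S n) / N) by (apply Rmult_le_pos; [apply pos_INR | left; now apply Rinv_0_lt_compat]).
    destruct (Qinc_bounds v _ Hm) as [Q0 Q1]. rewrite Rabs_pos_eq by exact Q0.
    change (Re (- s)) with (- Re s). generalize (exp_pos (- Re s * ln (INR (S n)))). nra.
  - now apply ex_series_riemann.
  - intro n. unfold Dterm. 
    assert (G := Clim_scal (Ccpow (RtoC (INR (S n))) (- s)) _ _ (Clim_RtoC _ _ (Qinc_lim (INR (S n) / N)))).
    rewrite Cmult_1_r in G. exact G.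
Qed.

(** A fixed v0 > Re s supplies one majorant for all orders v >= v0, while each single remainder
    tends to 0 because its binomial series converges to the power. *)
Lemma Efun_lim (N mu : R) (s : C) : 0 < N -> (mu = 1 \/ mu = -1) -> Clim (fun v => Efun v N mu s) 0.
Proof.
  intros HN Hmu. destruct (INR_unbounded (Re s)) as [n0 Hn0].
  set (v0 := S n0). assert (Hv0 : Re s < INR v0) by (unfold v0; rewrite S_INR; lra).
  destruct (Eterm_bound v0 N (Re s) (Cmod s) HN Hv0) as (K & _ & HK).
  assert (L : Clim (fun k => Cseries (fun m => Eterm (v0 + k) N mu (S m) s)) 0).
  { assert (Z : Cseries (fun _ : nat => RtoC 0) = RtoC 0).
    { now apply Csum_Cseries, Csum_zero. }
    rewrite <- Z. apply (tannery (fun k m => Eterm (v0 + k) N mu (S m) s) _ (fun m => K * exp (- (INR v0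
      + 1 - Re s) * ln (INR (S m))))).
    - intros k m. apply HK; auto; try lra; unfold v0; lia.
    - now apply ex_series_Eterm_bound.
    - intro m.
        apply (Clim_ext (fun k => Ccpow (zE N mu (S m)) (s - 1) *
          (Ccpow (1 - qE N mu (S m)) (- (1 - s)) - sum_n (fun w => bc (1 - s) w * qE N mu (S m) ^ w)%C (v0
            + k - 1)))%C).
        { intro k. symmetry. apply Eterm_factored. }
        replace (RtoC 0) with (Ccpow (zE N mu (S m)) (s - 1) *
          (Ccpow (1 - qE N mu (S m)) (- (1 - s)) - Ccpow (1 - qE N mu (S m)) (- (1 - s))))%C by ring.
        apply Clim_scal, Clim_minus; [apply Clim_const|].
        apply (Clim_subseq (sum_n (fun w => bc (1 - s) w * qE N mu (S m) ^ w)%C) _ (fun k => (v0 + k - 1)%nat));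
          [intro; unfold v0; lia | now apply Csum_qE]. }
  set (c := (Ccpow (RtoC (2 * PI)) (s - 1) * Gamma (1 - s) * Cexp ((0, (mu * PI / 2)%R) * (1 - s)))%C).
  apply (Clim_scal c) in L. rewrite Cmult_0_r in L.
  intros e He. destruct (L e He) as [k0 B]. exists (v0 + k0)%nat. intros v Hv.
  specialize (B (v - v0)%nat ltac:(lia)). replace (v0 + (v - v0))%nat with v in B by lia. exact B.
Qed.

(** Gamma(1-s+v) / Gamma(v) equals Gamma(1-s) times [wg (1 - s) v] times v^(1-s). The middle factor
    converges and the last tends to 0 for Re s > 1. *)
Lemma Corr_lim (N : R) (s : C) : 0 < N -> 1 < Re s -> (forall k : nat, (1 <= k)%nat -> s <> RtoC (INR k)) ->
  Clim (fun v => Corr v N s) 0.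
Proof.
  intros HN Hs Hk. destruct (not_pole s Hk) as [N1 N2].
  set (c := (/ ((1 - s) * rGamma (1 - s)) * Ccpow (RtoC N) (1 - s))%C).
  apply (Clim_ext_loc (fun v => c * (wg (1 - s) v * Ccpow (RtoC (INR v)) (1 - s)))%C _ _ 1).
  - intros v Hv. assert (Pv : 0 < INR v) by (apply lt_0_INR; lia).
    assert (Nv : RtoC (INR v) <> RtoC 0) by (apply RtoC_neq; lra).
    assert (Sh := rGamma_shift (1 - s) v).
    set (a := (1 - s + RtoC (INR v))%C) in *.
    assert (Nf : RtoC (INR (fact (v - 1))) <> RtoC 0) by (apply RtoC_neq, INR_fact_neq_0).
    assert (Fv : RtoC (INR (fact v)) = (RtoC (INR v) * RtoC (INR (fact (v - 1))))%C).
    { rewrite <- RtoC_mult, <- mult_INR. replace v with (S (v - 1)) at 1 2 by lia. reflexivity. }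
    assert (Nb : bc (1 - s) v <> RtoC 0) by (intro E; apply N1; rewrite Sh, E; ring).
    assert (Na : rGamma a <> RtoC 0) by (intro E; apply N1; rewrite Sh, E; ring).
    rewrite Corr_eq by assumption. fold a. unfold c, wg. rewrite Sh, Fv.
    replace (1 - (1 - s))%C with (1 - (1 - s))%C by ring.
    (* The power v^s inside [wg (1 - s) v] recombines with v^(1-s) into the factor v that separates
       v! from (v-1)!. *)
    assert (W : (Ccpow (RtoC (INR v)) (1 - (1 - s)) * Ccpow (RtoC (INR v)) (1 - s))%C = RtoC (INR v)).
    { rewrite <- Ccpow_plus. replace (1 - (1 - s) + (1 - s))%C with (RtoC 1)
      by ring. apply Ccpow_1_r. simpl. exact Pv. }
    transitivity (/ ((1 - s) * (RtoC (INR v) * RtoC (INR (fact (v - 1))) * bc (1 - s) v * rGamma a)) *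
      Ccpow (RtoC N) (1 - s) * bc (1 - s) v * (Ccpow (RtoC (INR v)) (1 - (1 - s))
        * Ccpow (RtoC (INR v)) (1 - s)))%C; [ring|].
    rewrite W. field. repeat split; assumption.
  - replace (RtoC 0) with (c * (rGamma (1 - s) * 0))%C by ring.
    apply Clim_scal, Clim_mult; [apply wg_Clim|].
    apply Clim_Cmod. apply is_lim_seq_incr_1.
    apply (is_lim_seq_ext (fun v => exp ((1 - Re s) * ln (INR (S v))))).
    + intro v. replace (Ccpow (RtoC (INR (S v))) (1 - s) - 0)%C with (Ccpow (RtoC (INR (S v))) (1 - s)) by ring.
      rewrite Cmod_Ccpow_RtoC by apply INR_S_pos. reflexivity.
    + apply (is_lim_seq_power_neg (1 - Re s) S); [lra | intro; lia].
Qed.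

Lemma Rzeta_Dirichlet (v : nat) (N : R) (s : C) : (1 <= v)%nat -> 0 < N -> 1 < Re s < INR v ->
  (forall k : nat, (1 <= k)%nat -> s <> RtoC (INR k)) ->
  Rzeta v N s = Cseries (fun n => Ccpow (RtoC (INR (S n))) (- s)).
Proof.
  intros Hv HN [Hs1 Hs] Hk.
  assert (L : Clim (fun v => Rzeta v N s) (Cseries (fun n => Ccpow (RtoC (INR (S n))) (- s)) + 0 + 0 - 0)%C).
  { unfold Rzeta. apply Clim_minus; [|now apply Corr_lim].
    apply Clim_plus; [|apply Efun_lim; auto]. apply Clim_plus; [now apply Dfun_lim | apply Efun_lim; auto]. }
  apply (Clim_subseq _ _ (fun k => (v + k)%nat)) in L; [|intro; lia].
  replace (Cseries (fun n => Ccpow (RtoC (INR (S n))) (- s)) + 0 + 0 - 0)%C with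
    (Cseries (fun n => Ccpow (RtoC (INR (S n))) (- s))) in L by ring.
  apply (Clim_unique (fun k => Rzeta (v + k) N s)); [|exact L].
  apply (Clim_ext (fun _ => Rzeta v N s)); [|apply Clim_const].
  intro k. symmetry. now apply Rzeta_add.
Qed.

(** * Analytic continuation *)

Lemma Cder_one_minus (z : C) : Cder (fun w => 1 - w)%C z (0 - 1).
Proof. apply Cder_minus; [apply Cder_const | apply Cder_id]. Qed.

Lemma Re_near (s w : C) (r : R) : Cmod (w - s) < r -> Re s - r < Re w < Re s + r.
Proof.
  intro H. generalize (re_le_Cmod (w - s)). change (Re (w - s)) with (Re w - Re s). intro X.
  apply Rabs_le_between in X. lra.
Qed.

Lemma Cder_Dfun (v : nat) (N : R) (s : C) : 0 < N -> exists l, Cder (Dfun v N) s l.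
Proof.
  intro HN. apply (Cder_Cseries (fun n w => Dterm v N n w) _ s 1) with (4 := ex_series_Dterm_bound v N (Cmod s + 1) HN).
  - lra.
  - intros n w _. eexists. unfold Dterm.
    apply Cder_mult; [apply Cder_Ccpow_r, Cder_opp, Cder_id | apply Cder_const].
  - intros n w Hw. apply Dterm_bound; [exact HN|]. generalize (Cmod_triangle_rev w s). lra.
Qed.

Lemma Cder_Eterm (v : nat) (N mu : R) (m : nat) (s : C) : exists l, Cder (Eterm v N mu (S m)) s l.
Proof.
  assert (D1 := Cder_one_minus s).
  destruct (Cder_sum_n (fun k w => bc (1 - w) k * qE N mu (S m) ^ k)%C s (v - 1)) as [l Hl].
  { intro k. destruct (Cder_bc (fun w => 1 - w)%C s _ k D1) as [l Hl].
    eexists. apply Cder_mult; [exact Hl | apply Cder_const]. }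
  eexists. eapply (Cder_ext (fun w => Ccpow (zE N mu (S m)) (w - 1) *
    (Ccpow (1 - qE N mu (S m)) (- (1 - w)) - sum_n (fun k => bc (1 - w) k * qE N mu (S m) ^ k)%C (v - 1)))%C _ s _ 1);
    [lra | intros; symmetry; apply Eterm_factored |].
  apply Cder_mult; [apply Cder_Ccpow_r, Cder_minus; [apply Cder_id | apply Cder_const]|].
  apply Cder_minus; [apply Cder_Ccpow_r, Cder_opp, D1 | exact Hl].
Qed.

Definition Esum (v : nat) (N mu : R) (s : C) : C := Cseries (fun m => Eterm v N mu (S m) s).

Lemma Cder_Esum (v : nat) (N mu : R) (s : C) : (1 <= v)%nat -> 0 < N -> (mu = 1 \/ mu = -1) -> Re s < INR v ->
  exists l, Cder (Esum v N mu) s l.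
Proof.
  intros Hv HN Hmu Hs. set (sg := (Re s + INR v) / 2). assert (Hsg : sg < INR v) by (unfold sg; lra).
  set (r := (INR v - Re s) / 2). assert (Hr : 0 < r) by (unfold r; lra).
  destruct (Eterm_bound v N sg (Cmod s + r) HN Hsg) as (K & _ & HK).
  apply (Cder_Cseries (fun m w => Eterm v N mu (S m) w) _ s r) with (4 := ex_series_Eterm_bound v sg K Hsg).
  - exact Hr.
  - intros m w _. apply Cder_Eterm.
  - intros m w Hw. apply HK; auto.
    + apply Re_near in Hw. unfold sg, r in *. lra.
    + generalize (Cmod_triangle_rev w s). lra.
Qed.

Lemma Cder_Gamma (s : C) : rGamma s <> RtoC 0 -> exists l, Cder Gamma s l.
Proof.
  intro H. destruct (Cder_rGamma s) as [l Hl].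
  destruct (Ccont_neq_0 rGamma s (Cder_Ccont _ _ _ Hl) H) as (d & Hd & B).
  eexists. apply (Cder_ext (fun w => / rGamma w)%C _ s _ d Hd).
  - intros w Hw. symmetry. apply Gamma_eq_inv_rGamma. now apply B.
  - apply Cder_inv; [exact Hl | exact H].
Qed.

(** The entire part of the prefactor. Gamma(1 - s) stays with [Esum], whose zeros cancel its poles
    at the integers below v. *)
Definition Ecoef (mu : R) (s : C) : C :=
  (Ccpow (RtoC (2 * PI)) (s - 1) * Cexp ((0, (mu * PI / 2)%R) * (1 - s)))%C.

Lemma Efun_Ecoef (v : nat) (N mu : R) (s : C) :
  Efun v N mu s = (Ecoef mu s * (Gamma (1 - s) * Esum v N mu s))%C.
Proof. unfold Efun, Ecoef, Esum. ring. Qed.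

Lemma Cder_Ecoef (mu : R) (s : C) : exists l, Cder (Ecoef mu) s l.
Proof.
  eexists. apply Cder_mult.
  - apply Cder_Ccpow_r, Cder_minus; [apply Cder_id | apply Cder_const].
  - apply Cder_Cexp_comp, Cder_scal, Cder_minus; [apply Cder_const | apply Cder_id].
Qed.

Lemma Cder_Efun (v : nat) (N mu : R) (s : C) : (1 <= v)%nat -> 0 < N -> (mu = 1 \/ mu = -1) ->
  Re s < INR v -> rGamma (1 - s) <> RtoC 0 -> exists l, Cder (Efun v N mu) s l.
Proof.
  intros Hv HN Hmu Hs Hg. destruct (Cder_Esum v N mu s Hv HN Hmu Hs) as [l1 H1].
  destruct (Cder_Gamma (1 - s) Hg) as [l2 H2]. destruct (Cder_Ecoef mu s) as [l3 H3].
  eexists. apply (Cder_ext (fun w => Ecoef mu w * (Gamma (1 - w) * Esum v N mu w))%C _ s _ 1);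
    [lra | intros; symmetry; apply Efun_Ecoef |].
  apply Cder_mult; [exact H3|]. apply Cder_mult; [|exact H1].
  apply (Cder_comp Gamma (fun w => 1 - w)%C); [apply Cder_minus; [apply Cder_const | apply Cder_id] | exact H2].
Qed.

Lemma Cder_Corr (v : nat) (N : R) (s : C) : (1 <= v)%nat -> Re s < INR v -> (1 - s)%C <> RtoC 0 ->
  exists l, Cder (Corr v N) s l.
Proof.
  intros Hv Hs H1.
  assert (Rp : 0 < Re (1 - s + RtoC (INR v))) by (unfold Re in *; simpl; lra).
  destruct (Cder_Gamma _ (rGamma_Re_pos _ Rp)) as [l Hl].
  assert (D1 := Cder_one_minus s).
  assert (Gv : Gamma (RtoC (INR v)) <> RtoC 0).
  { replace v with (S (v - 1)) by lia. rewrite Gamma_INR. apply RtoC_neq, INR_fact_neq_0. }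
  eexists. unfold Corr. apply Cder_mult.
  - apply Cder_div.
    + apply (Cder_comp Gamma (fun w => 1 - w + RtoC (INR v))%C); [|exact Hl].
      apply Cder_plus; [exact D1 | apply Cder_const].
    + apply Cder_mult; [exact D1 | apply Cder_const].
    + now apply Cmult_neq_0.
  - apply Cder_Ccpow_r, D1.
Qed.

(** * The Dirichlet series and the glued function *)

Definition dirichlet_zeta (s : C) : C := Cseries (fun n => Ccpow (RtoC (INR (S n))) (- s)).

Lemma dirichlet_term_bound (s : C) (sg : R) (n : nat) : sg <= Re s ->
  Cmod (Ccpow (RtoC (INR (S n))) (- s)) <= exp (- sg * ln (INR (S n))).
Proof.
  intro H. rewrite Cmod_Ccpow_RtoC by apply INR_S_pos. apply exp_monotone.
  apply Rmult_le_compat_r; [apply ln_INR_S_pos|]. change (Re (- s)) with (- Re s). lra.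
Qed.

Lemma Cder_dirichlet_zeta (s : C) : 1 < Re s -> exists l, Cder dirichlet_zeta s l.
Proof.
  intro H. set (sg := (1 + Re s) / 2). assert (Hsg : 1 < sg) by (unfold sg; lra).
  apply (Cder_Cseries (fun n w => Ccpow (RtoC (INR (S n))) (- w)) _ s ((Re s - 1) / 2))
    with (4 := ex_series_riemann sg Hsg).
  - lra.
  - intros n w _. eexists. apply Cder_Ccpow_r, Cder_opp, Cder_id.
  - intros n w Hw. apply dirichlet_term_bound.
    apply Re_near in Hw. unfold sg. lra.
Qed.

(** Order 2 is the right one for gluing: its half-plane Re s < 2 overlaps Re s > 1, and the only
    pole of Gamma(1 - s) in it is s = 1. The cut at Re s = 2 leaves no trace because both branches
    agree for 1 < Re s < 2. *)
Definition zeta_continuation (N : R) (s : C) : C :=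
  if Rlt_dec (Re s) 2 then Rzeta 2 N s else dirichlet_zeta s.

Lemma Re_neq_INR (s : C) (k : nat) : Re s <> INR k -> s <> RtoC (INR k).
Proof. intros H E. apply H. now rewrite E. Qed.

Lemma zeta_continuation_dirichlet (N : R) (s : C) : 0 < N -> 1 < Re s -> zeta_continuation N s = dirichlet_zeta s.
Proof.
  intros HN H. unfold zeta_continuation. destruct (Rlt_dec (Re s) 2) as [L|L]; [|reflexivity].
  apply Rzeta_Dirichlet; [lia | exact HN | simpl; lra |].
  intros k Hk. apply Re_neq_INR. destruct k as [|[|k]]; [lia | simpl; lra|].
  rewrite !S_INR. generalize (pos_INR k). lra.
Qed.

Lemma zeta_continuation_is_riemann_zeta (N : R) : 0 < N -> is_riemann_zeta (zeta_continuation N).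
Proof.
  intro HN. split.
  - intros s Hs. destruct (Rlt_dec 1 (Re s)) as [L|L].
    + destruct (Cder_dirichlet_zeta s L) as [l Hl]. exists l. apply Cder_is_derive.
      apply (Cder_ext dirichlet_zeta _ s l (Re s - 1)); [lra | | exact Hl].
      intros w Hw. symmetry. apply zeta_continuation_dirichlet; [exact HN|].
      apply Re_near in Hw. lra.
    + assert (Hk : forall k : nat, (1 <= k)%nat -> s <> RtoC (INR k)).
      { intros k Hk. destruct k as [|[|k]]; [lia | exact Hs|]. apply Re_neq_INR.
        rewrite !S_INR. generalize (pos_INR k). lra. }
      destruct (not_pole s Hk) as [N1 N2].
      destruct (Cder_Dfun 2 N s HN) as [l1 H1].
      destruct (Cder_Efun 2 N 1 s ltac:(lia) HN ltac:(auto) ltac:(simpl; lra) N1) as [l2 H2].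
      destruct (Cder_Efun 2 N (-1) s ltac:(lia) HN ltac:(auto) ltac:(simpl; lra) N1) as [l3 H3].
      destruct (Cder_Corr 2 N s ltac:(lia) ltac:(simpl; lra) N2) as [l4 H4].
      (* Here Re s <= 1, so the disc of radius 1 around s stays in Re w < 2. *)
      eexists. apply Cder_is_derive. apply (Cder_ext (Rzeta 2 N) _ s _ 1); [lra | |].
      * intros w Hw. unfold zeta_continuation. destruct (Rlt_dec (Re w) 2) as [_|L2]; [reflexivity|].
        exfalso. apply Re_near in Hw. lra.
      * unfold Rzeta. apply Cder_minus; [apply Cder_plus; [apply Cder_plus|]|]; eassumption.
  - intros s Hs. rewrite zeta_continuation_dirichlet by assumption. apply is_series_C.
    apply (Csum_dominated _ (fun n => exp (- Re s * ln (INR (S n))))).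
    + intro n. apply dirichlet_term_bound. lra.
    + now apply ex_series_riemann.
Qed.

(** The choice operator returns a function meeting the specification once one is exhibited; N = 1 is
    an arbitrary positive value. *)
Lemma zeta_is_riemann_zeta : is_riemann_zeta zeta.
Proof.
  unfold zeta. apply epsilon_spec. exists (zeta_continuation 1).
  apply zeta_continuation_is_riemann_zeta. lra.
Qed.

Lemma zeta_eq_Rzeta (v : nat) (N : R) (s : C) : (1 <= v)%nat -> 0 < N -> Re s < INR v ->
  (forall k : nat, (1 <= k)%nat -> s <> RtoC (INR k)) -> zeta s = Rzeta v N s.
Proof.
  intros Hv HN Hs Hk. assert (N1 : s <> RtoC 1) by (apply (Hk 1%nat); lia).
  rewrite (is_riemann_zeta_unique _ _ zeta_is_riemann_zeta (zeta_continuation_is_riemann_zeta N HN) s N1).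
  destruct (Rlt_dec 1 (Re s)) as [L|L].
  - rewrite zeta_continuation_dirichlet by assumption. symmetry. now apply Rzeta_Dirichlet.
  - unfold zeta_continuation. destruct (Rlt_dec (Re s) 2) as [_|]; [|lra].
    (* Order 1 is one step below the glued order 2; higher orders are reached by climbing from 2,
       where Re s < 2 holds. *)
    destruct v as [|[|v]]; [lia | apply Rzeta_S; auto|].
    symmetry. apply (Rzeta_add 2 v); auto. simpl. lra.
Qed.

(** * The removable singularities at the integers *)

Lemma bc_vanish (k w : nat) : (1 <= k)%nat -> (k <= w)%nat -> bc (1 - RtoC (INR k)) w = RtoC 0.
Proof.
  intros Hk Hw. induction Hw as [|w Hw IH].
  - destruct k as [|k]; [lia|]. cbn [bc]. replace (1 - RtoC (INR (S k)) + RtoC (INR k))%C with (RtoC 0).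
    + unfold Cdiv. ring.
    + rewrite S_INR, RtoC_plus. ring.
  - cbn [bc]. rewrite IH. unfold Cdiv. ring.
Qed.

Lemma bc_not_vanish (k w : nat) : (w < k)%nat -> bc (1 - RtoC (INR k)) w <> RtoC 0.
Proof.
  intro H. induction w as [|w IH]; [apply RtoC_neq; lra|]. cbn [bc].
  unfold Cdiv. repeat apply Cmult_neq_0; [apply IH; lia | |].
  - replace (1 - RtoC (INR k) + RtoC (INR w))%C with (RtoC (INR (S w) - INR k)).
    + apply RtoC_neq. apply lt_INR in H. lra.
    + rewrite RtoC_minus, S_INR, RtoC_plus. ring.
  - intro E. apply (RtoC_INR_S_neq w). 
    replace (RtoC (INR (S w))) with (RtoC (INR (S w)) * RtoC (INR (S w)) * / RtoC (INR (S w)))%C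
      by (field; apply RtoC_INR_S_neq).
    rewrite E. ring.
Qed.

(** For s = k the power (1 - q)^(k-1) is a polynomial of degree k - 1 < v, so the Taylor polynomial
    is exact and every remainder vanishes. *)
Lemma Esum_INR (v k : nat) (N mu : R) : 0 < N -> (mu = 1 \/ mu = -1) -> (1 <= k < v)%nat ->
  Esum v N mu (RtoC (INR k)) = RtoC 0.
Proof.
  intros HN Hmu Hk. unfold Esum. apply Csum_Cseries.
  assert (Z : forall m, Eterm v N mu (S m) (RtoC (INR k)) = RtoC 0).
  { intro m. rewrite Eterm_factored.
    assert (F := Csum_finite (fun w => bc (1 - RtoC (INR k)) w * qE N mu (S m) ^ w)%C (v - 1)).
    rewrite (Clim_unique _ _ _ (Csum_qE N mu m (1 - RtoC (INR k)) HN Hmu) (F ltac:(intros w Hw; cbv beta;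
      rewrite bc_vanish by lia; ring))). ring. }
  now apply Csum_zero.
Qed.

(* [Esum] vanishes at [k], which cancels the simple pole of [Gamma (1 - s)]. *)
Lemma Efun_removable (v k : nat) (N mu : R) : 0 < N -> (mu = 1 \/ mu = -1) -> (1 <= k < v)%nat ->
  exists E0 : C -> C, Ccont E0 (RtoC (INR k)) /\ exists d, 0 < d /\
    forall s, Cmod (s - RtoC (INR k)) < d -> s <> RtoC (INR k) -> Efun v N mu s = E0 s.
Proof.
  intros HN Hmu Hk. set (c := RtoC (INR k)).
  destruct (Cder_Esum v N mu c ltac:(lia) HN Hmu ltac:(apply lt_INR; lia)) as [l Hl].
  (* As [Esum] vanishes at c, this gives [Esum] s = p(s) (s - c) with p continuous at c. *)
  destruct (Cder_elim _ _ _ Hl) as (p & Hp & _ & Ep).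
  unfold c in Ep. rewrite Esum_INR in Ep by assumption. fold c in Ep.
  (* The zero of 1/Gamma(1 - s) at c made explicit: the last factor of the rising product of length
     k is c - s, and the cofactor g does not vanish at c. *)
  set (g := fun s => (RtoC (INR (fact (k - 1))) * bc (1 - s) (k - 1) * rGamma (1 - s + c))%C).
  assert (D1 := Cder_one_minus).
  assert (Cg : Ccont g c).
  { destruct (Cder_bc (fun w => 1 - w)%C c _ (k - 1) (D1 c)) as [l1 H1].
    destruct (Cder_rGamma (1 - c + c)) as [l2 H2].
    eapply Cder_Ccont. apply Cder_mult; [apply Cder_scal, H1|].
    apply (Cder_comp rGamma (fun w => 1 - w + c)%C); [|exact H2].
    apply Cder_plus; [apply D1 | apply Cder_const]. }
  assert (Ng : g c <> RtoC 0).
  { unfold g. replace (1 - c + c)%C with (RtoC 1) by ring. rewrite rGamma_1.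
    repeat apply Cmult_neq_0; try (apply RtoC_neq; first [apply INR_fact_neq_0 | lra]).
    apply bc_not_vanish. lia. }
  assert (Eg : forall s, rGamma (1 - s) = (g s * (c - s))%C).
  { intro s. rewrite (rGamma_shift (1 - s) k). fold c. unfold g.
    assert (Nk : RtoC (INR (S (k - 1))) <> RtoC 0) by apply RtoC_INR_S_neq.
    replace (bc (1 - s) k) with (bc (1 - s) (S (k - 1))) by (f_equal; lia).
    replace (fact k) with (fact (S (k - 1))) by (f_equal; lia).
    replace (RtoC (INR (fact (S (k - 1))))) with (RtoC (INR (S (k - 1))) * RtoC (INR (fact (k - 1))))%C
      by (rewrite <- RtoC_mult, <- mult_INR; reflexivity).
    cbn [bc]. replace (c - s)%C with (1 - s + RtoC (INR (k - 1)))%C.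
    - field. exact Nk.
    - unfold c. replace k with (S (k - 1)) at 2 by lia. rewrite S_INR, RtoC_plus. ring. }
  destruct (Cder_Ecoef mu c) as [l3 H3].
  (* The minus sign is the quotient of s - c by c - s. *)
  exists (fun s => Ecoef mu s * (- (p s) * / g s))%C. split.
  - apply Ccont_mult; [eapply Cder_Ccont, H3|].
    apply Ccont_mult; [now apply Ccont_opp | now apply Ccont_inv].
  - destruct (Ccont_neq_0 g c Cg Ng) as (d & Hd & B). exists d. split; [exact Hd|].
    intros s Hs Ns. destruct (B s Hs) as [_ Gs].
    assert (Ncs : (c - s)%C <> RtoC 0) by (intro E; apply Ns; symmetry; now apply Ceq_minus).
    rewrite Efun_Ecoef, Ep, Gamma_eq_inv_rGamma; rewrite Eg; [|now apply Cmult_neq_0].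
    field. split; assumption.
Qed.

Lemma filterlim_Ccont (f g : C -> C) (D : C -> Prop) (z : C) (d : R) : Ccont g z -> 0 < d ->
  (forall s, D s -> Cmod (s - z) < d -> f s = g s) ->
  filterlim f (within D (locally z)) (locally (g z)).
Proof.
  intros Hg Hd E P [e He]. destruct (Hg e (cond_pos e)) as (d' & Hd' & B).
  (* Neighbourhoods in the product C are squares; half the radius in each coordinate keeps the
     modulus below the whole radius. *)
  assert (Hm : 0 < Rmin d d' / 2) by (generalize (Rmin_pos d d' Hd Hd'); lra).
  exists (mkposreal _ Hm). intros s Hs HD.
  assert (Hsz : Cmod (s - z) < Rmin d d').
  { destruct Hs as [H1 H2]. eapply Rle_lt_trans; [apply Cmod_le_ReIm|].
    change (Rabs (fst s - fst z) < Rmin d d' / 2) in H1.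
    change (Rabs (snd s - snd z) < Rmin d d' / 2) in H2.
    change (Re (s - z)) with (fst s - fst z). change (Im (s - z)) with (snd s - snd z). lra. }
  rewrite (E s HD) by (eapply Rlt_le_trans; [exact Hsz | apply Rmin_l]).
  apply He. specialize (B s ltac:(eapply Rlt_le_trans; [exact Hsz | apply Rmin_r])).
  split.
  - change (Rabs (fst (g s) - fst (g z)) < e).
    eapply Rle_lt_trans; [|exact B]. apply (re_le_Cmod (g s - g z)).
  - change (Rabs (snd (g s) - snd (g z)) < e).
    eapply Rle_lt_trans; [|exact B]. apply (im_le_Cmod (g s - g z)).
Qed.

Lemma near_INR_neq (k : nat) (s : C) : Cmod (s - RtoC (INR k)) < 1 -> s <> RtoC (INR k) ->
  forall j : nat, s <> RtoC (INR j).
Proof.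
  intros H N j E. subst s. rewrite <- RtoC_minus, Cmod_R in H. apply Rabs_def2 in H.
  apply N. f_equal. f_equal.
  destruct (Nat.lt_trichotomy j k) as [L|[L|L]]; [|exact L|]; exfalso;
    apply le_INR in L; rewrite S_INR in L; lra.
Qed.

(** Both sides are continuous at k, zeta because k is not 1, and they agree at nearby points that
    are not integers. A nonzero difference at k would persist at such a point. *)
Lemma zeta_INR (v k : nat) (N : R) (E1 E2 : C -> C) (d : R) : 0 < N -> (2 <= k < v)%nat -> 0 < d ->
  Ccont E1 (RtoC (INR k)) -> Ccont E2 (RtoC (INR k)) ->
  (forall s, Cmod (s - RtoC (INR k)) < d -> s <> RtoC (INR k) ->
     Efun v N 1 s = E1 s /\ Efun v N (-1) s = E2 s) ->
  zeta (RtoC (INR k)) = (Dfun v N (RtoC (INR k)) + E1 (RtoC (INR k)) + E2 (RtoC (INR k)) - Corr v N (RtoC (INR k)))%C.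
Proof.
  intros HN Hk Hd C1 C2 HE. set (c := RtoC (INR k)) in *.
  assert (Kv : INR k + 1 <= INR v) by (rewrite <- S_INR; apply le_INR; lia).
  assert (K2 : 2 <= INR k) by (replace 2 with (INR 2) by reflexivity; apply le_INR; lia).
  assert (Nc1 : c <> RtoC 1) by (intro E; apply RtoC_inj in E; lra).
  assert (N1c : (1 - c)%C <> RtoC 0) by (intro E; apply Nc1; symmetry; now apply Ceq_minus).
  destruct (proj1 zeta_is_riemann_zeta c Nc1) as [lz Hz]. apply is_derive_Cder, Cder_Ccont in Hz.
  destruct (Cder_Dfun v N c HN) as [l1 H1]. apply Cder_Ccont in H1.
  destruct (Cder_Corr v N c ltac:(lia) ltac:(unfold c; simpl; lra) N1c) as [l2 H2]. apply Cder_Ccont in H2.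
  set (h := fun s => (zeta s - (Dfun v N s + E1 s + E2 s - Corr v N s))%C).
  assert (Ch : Ccont h c).
  { unfold h. apply Ccont_minus; [exact Hz|]. apply Ccont_minus; [|exact H2].
    apply Ccont_plus; [|exact C2]. now apply Ccont_plus. }
  apply Ceq_minus. change (h c = RtoC 0).
  destruct (Ceq_dec (h c) 0) as [E|Ne]; [exact E|]. exfalso.
  destruct (Ccont_neq_0 h c Ch Ne) as (d' & Hd' & B).
  (* The point k + t lies in both discs, is not an integer as 0 < t < 1, and has real part below k +
     1 <= v, so [zeta_eq_Rzeta] applies there. *)
  set (t := Rmin (Rmin d d') 1 / 2).
  assert (Ht : 0 < t) by (unfold t; generalize (Rmin_pos _ 1 (Rmin_pos d d' Hd Hd')); lra).
  assert (Ht1 : t < d /\ t < d' /\ t < 1).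
  { unfold t in *. generalize (Rmin_l (Rmin d d') 1) (Rmin_r (Rmin d d') 1) (Rmin_l d d') (Rmin_r d d'). lra. }
  set (s := (c + RtoC t)%C).
  assert (Ms : Cmod (s - c) = t).
  { unfold s. replace (c + RtoC t - c)%C with (RtoC t) by ring. rewrite Cmod_R, Rabs_pos_eq; lra. }
  assert (Ns : s <> c).
  { intro E. rewrite E in Ms. replace (c - c)%C with (RtoC 0) in Ms by ring. rewrite Cmod_0 in Ms. lra. }
  destruct (B s ltac:(lra)) as [_ Hs]. apply Hs. unfold h.
  destruct (HE s ltac:(lra) Ns) as [<- <-].
  rewrite (zeta_eq_Rzeta v N s); [unfold Rzeta; ring | lia | exact HN | |].
  - unfold s, c, Re. simpl. lra.
  - intros j _. apply (near_INR_neq k); [fold c; lra | exact Ns].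
Qed.

Theorem theorem1 (v : nat) (N sigma0 : R) :
  (0 < v)%nat -> 0 < N -> sigma0 < INR v ->
  (* absolute convergence of the three series on Re s <= sigma0 *)
  (forall s : C, Re s <= sigma0 ->
     ex_series (fun n => Cmod (Dterm v N n s)) /\
     ex_series (fun m => Cmod (Eterm v N 1 (S m) s)) /\
     ex_series (fun m => Cmod (Eterm v N (-1) (S m) s))) /\
  (* uniform convergence on compact subsets of Re s <= sigma0
     (every such compact set lies in some {Re s <= sigma0, |s| <= B}) *)
  (forall B : R,
     let K := fun s : C => Re s <= sigma0 /\ Cmod s <= B in
     unif_conv_series_on K (Dterm v N) /\
     unif_conv_series_on K (fun m => Eterm v N 1 (S m)) /\
     unif_conv_series_on K (fun m => Eterm v N (-1) (S m))) /\
  (* the identity, away from s = 1, ..., v-1 *)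
  (forall s : C, Re s <= sigma0 -> s <> RtoC 1 ->
     (forall k : nat, (1 <= k < v)%nat -> s <> RtoC (INR k)) ->
     zeta s = (Dfun v N s + Efun v N 1 s + Efun v N (-1) s - Corr v N s)%C) /\
  (* at integers s = k < v (k >= 2, k in the region): E_mu(k) := lim_{s->k} E_mu(s)
     exists and the identity holds with this interpretation *)
  (forall k : nat, (2 <= k < v)%nat -> INR k <= sigma0 ->
     exists L1 L2 : C,
       filterlim (Efun v N 1)
         (within (fun s : C => Re s <= sigma0 /\ s <> RtoC (INR k)) (locally (RtoC (INR k))))
         (locally L1) /\
       filterlim (Efun v N (-1))
         (within (fun s : C => Re s <= sigma0 /\ s <> RtoC (INR k)) (locally (RtoC (INR k))))
         (locally L2) /\
       zeta (RtoC (INR k)) = (Dfun v N (RtoC (INR k)) + L1 + L2 - Corr v N (RtoC (INR k)))%C).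
Proof.
  intros Hv HN Hs0.
  assert (H1 : (1 <= v)%nat) by lia.
  repeat match goal with |- _ /\ _ => split end.
  - intros s Hs. destruct (Eterm_bound v N sigma0 (Cmod s) HN Hs0) as (K & _ & HK).
    repeat split.
    + apply (ex_series_Cmod_dominated _ _ (fun n => Dterm_bound v N (Cmod s) s n HN (Rle_refl _))).
      now apply ex_series_Dterm_bound.
    + apply (ex_series_Cmod_dominated _ (fun m => K * exp (- (INR v + 1 - sigma0) * ln (INR (S m))))).
      * intro m. apply HK; auto; lra.
      * now apply ex_series_Eterm_bound.
    + apply (ex_series_Cmod_dominated _ (fun m => K * exp (- (INR v + 1 - sigma0) * ln (INR (S m))))).
      * intro m. apply HK; auto; lra.
      * now apply ex_series_Eterm_bound.
  - intros B K0. destruct (Eterm_bound v N sigma0 B HN Hs0) as (K & _ & HK).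
    repeat split.
    + eapply weierstrass_test; [|apply (ex_series_Dterm_bound v N B HN)].
      intros n s [_ Hs]. now apply Dterm_bound.
    + eapply weierstrass_test; [|apply (ex_series_Eterm_bound v sigma0 K Hs0)].
      intros m s [Hs1 Hs2]. apply HK; auto.
    + eapply weierstrass_test; [|apply (ex_series_Eterm_bound v sigma0 K Hs0)].
      intros m s [Hs1 Hs2]. apply HK; auto.
  - intros s Hs N1 Hk. apply zeta_eq_Rzeta; [exact H1 | exact HN | lra |].
    (* Integers k >= v are out of reach because Re s <= sigma0 < v. *)
    intros k Hk1. destruct (Nat.lt_ge_cases k v) as [L|L]; [apply Hk; lia|].
    apply Re_neq_INR. apply le_INR in L. lra.
  - intros k Hk Hk0.
    destruct (Efun_removable v k N 1 HN (or_introl eq_refl) ltac:(lia)) as (E1 & C1 & d1 & Hd1 & B1).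
    destruct (Efun_removable v k N (-1) HN (or_intror eq_refl) ltac:(lia)) as (E2 & C2 & d2 & Hd2 & B2).
    exists (E1 (RtoC (INR k))), (E2 (RtoC (INR k))). repeat split.
    + apply (filterlim_Ccont _ E1 _ _ d1 C1 Hd1). intros s [_ Ns] Hs. now apply B1.
    + apply (filterlim_Ccont _ E2 _ _ d2 C2 Hd2). intros s [_ Ns] Hs. now apply B2.
    + apply (zeta_INR v k N E1 E2 (Rmin d1 d2) HN Hk (Rmin_pos _ _ Hd1 Hd2) C1 C2).
      intros s Hs Ns. split; [apply B1 | apply B2]; try exact Ns;
        (eapply Rlt_le_trans; [exact Hs|]); [apply Rmin_l | apply Rmin_r].
Qed.
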